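(* Let $\ell_N=N^{4/5}$ if $d=1$; let $\ell_N$ be defined by $\ell_N^3\log \ell_N=N^2$ if $d=2$; and let $\ell_N=N^{4/(3d)}$ if $d\ge 3$. Assume that $\lim_{N\to\infty}K_N=\infty$ and $\sup_{N\ge1}K_N^2/\ell_N^d<\infty$. Then there exists a finite constant $\mathfrak c_0=\mathfrak c_0(\boldsymbol u^N)$, depending only on $\boldsymbol u^N$ and uniformly bounded in $N$, such that $$H_N(f^N_t)\;\le\;(N/\ell_N)^d\,e^{\mathfrak c_0K_N^2t}$$ for all $t\ge0$, $N\ge1$.
   Context: Fix $d\ge1$. $\mathbb T_N=\mathbb Z/N\mathbb Z$, $\Omega_N=\{0,1\}^{\mathbb T_N^d}$, $\{e_1,\dots,e_d\}$ is the canonical basis of $\mathbb R^d$. For $\eta\in\Omega_N$, $T^{x,y}\eta$ is obtained from $\eta$ by exchanging $\eta_x$ and $\eta_y$, $T^x\eta$ by replacing $\eta_x$ by $1-\eta_x$, and $(\tau_x\eta)_z=\eta_{x+z}$. Let $(L^E_Nf)(\eta)=\sum_{x\in\mathbb T_N^d}\sum_{j=1}^d\{f(T^{x,x+e_j}\eta)-f(\eta)\}$ and $(L^G_Nf)(\eta)=\sum_{x\in\mathbb T_N^d}c_0(\tau_x\eta)[f(T^x\eta)-f(\eta)]$, where, with $\sigma_x=2\eta_x-1$, $c_0(\eta)=1-\gamma\sigma_0[\sigma_{-e_1}+\sigma_{e_1}]+\gamma^2\sigma_{-e_1}\sigma_{e_1}$ and $1/2<\gamma<1$ is fixed. $(K_N)$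 is an increasing sequence of positive numbers with $K_N\to\infty$, $K_N/N\to0$. $L_N=N^2L^E_N+K_NL^G_N$ generates the Markov chain $\eta^N(t)$ on $\Omega_N$, with semigroup $S^N(t)$. $V:[0,1]\to\mathbb R$ is a potential with $V'(\rho)=-(2\gamma-1)(2\rho-1)+\gamma^2(2\rho-1)^3$; the zeros of $V'$ are $0<\rho_-<\rho^*=1/2<\rho_+<1$. For $K=K_N$ (assumed such that it exists), $\rho^K:\sqrt K\,\mathbb T\to(0,1)$ ($\sqrt K\,\mathbb T$ the torus of length $\sqrt K$) is the unique $\sqrt K$-periodic solution of $\partial_\vartheta^2\rho^K-V'(\rho^K)=0$ taking the value $\rho^*$ at exactly two points of $\sqrt K\,\mathbb T$, with $\rho^K(0)=\rho^*$, $\partial_\vartheta\rho^K(0)<0$. Set $\boldsymbol u^N(x_1,\dots,x_d)=\rho^{K_N}(x_1\sqrt{K_N}/N)$, $x\in\mathbb T_N^d$, and let $\nu^N$ be the product measure on $\Omega_N$ with $\nu^N\{\eta_x=1\}=\boldsymbol u^N(x)$. $f^N_t=\dfrac{d\,\nu^NS^N(t)}{d\nu^N}$ is the density at time $t$ of the law of the process started from $\nu^N$, and $H_N(f)=\int f\log f\,d\nu^N$ for a density $f$ with respect to $\nu^N$. *)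

(* Defs.v *)
From HB Require Import structures.
From mathcomp Require Import all_boot all_order all_algebra.
From mathcomp Require Import all_classical all_reals all_analysis.

Set Implicit Arguments.
Unset Strict Implicit.
Unset Printing Implicit Defensive.

Import Order.TTheory GRing.Theory Num.Theory.
Import numFieldNormedType.Exports.

Local Open Scope classical_set_scope.
Local Open Scope card_scope.
Local Open Scope ring_scope.

(* (Z/NZ)^d with its pointwise additive group structure.  ['I_N.-1.+1] is
   Z/NZ for every N >= 1, including N = 1 (unlike ['Z_N]); N = 0 is junk. *)
Definition torus (d N : nat) := {ffun 'I_d -> 'I_N.-1.+1}.

Definition config (d N : nat) := {ffun torus d N -> bool}.

Definition unitv (d N : nat) (j : 'I_d) : torus d N :=
  [ffun i => inZp (i == j)].

Section Dynamics.
Variables (R : realType) (d N : nat).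
Implicit Types (eta zeta : config d N) (x y z : torus d N).
Implicit Types (f : config d N -> R) (u : torus d N -> R).

Definition exchange x y eta : config d N :=
  [ffun z => if z == x then eta y else if z == y then eta x else eta z].

Definition flip x eta : config d N :=
  [ffun z => if z == x then ~~ eta z else eta z].

Definition translate x eta : config d N := [ffun z => eta (x + z)].

Definition spin eta x : R := 2 * (eta x)%:R - 1.

(* [i1] is the first coordinate, so that [unitv N i1] is e_1. *)
Definition flip_rate (i1 : 'I_d) (gamma : R) eta : R :=
  let e1 := unitv N i1 in
  1 - gamma * spin eta 0 * (spin eta (- e1) + spin eta e1)
    + gamma ^+ 2 * spin eta (- e1) * spin eta e1.

Definition exclusion_gen f : config d N -> R := fun eta =>
  \sum_(x : torus d N) \sum_(j < d)
     (f (exchange x (x + unitv N j) eta) - f eta).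

Definition glauber_gen (i1 : 'I_d) (gamma : R) f : config d N -> R :=
  fun eta => \sum_(x : torus d N)
     flip_rate i1 gamma (translate x eta) * (f (flip x eta) - f eta).

Definition generator (i1 : 'I_d) (gamma K : R) f : config d N -> R :=
  fun eta => N%:R ^+ 2 * exclusion_gen f eta + K * glauber_gen i1 gamma f eta.

(* S(t) = e^{tL}; the state space is finite, so the series converges. *)
Definition semigroup (L : (config d N -> R) -> (config d N -> R)) (t : R) f :
    config d N -> R :=
  fun eta => limn (series (fun k => t ^+ k / k`!%:R * iter k L f eta)).

Definition product_measure u eta : R :=
  \prod_(x : torus d N) (if eta x then u x else 1 - u x).

(* mass at zeta of mu S(t), where (mu S(t)) f = mu (S(t) f) *)
Definition evolved_law (L : (config d N -> R) -> (config d N -> R))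
    (mu : config d N -> R) (t : R) zeta : R :=
  \sum_eta mu eta * semigroup L t (fun xi => (xi == zeta)%:R) eta.

(* mu must charge every configuration, which holds for product measures
   with densities in (0, 1) *)
Definition density (L : (config d N -> R) -> (config d N -> R))
    (mu : config d N -> R) (t : R) zeta : R :=
  evolved_law L mu t zeta / mu zeta.

(* [ln 0 = 0], so 0 log 0 = 0 *)
Definition entropy (mu f : config d N -> R) : R :=
  \sum_eta f eta * ln (f eta) * mu eta.

(* The first coordinate is read in {0, ..., N-1}; rho is sqrt K-periodic. *)
Definition interface_profile (i1 : 'I_d) (K : R) (rho : R -> R) : torus d N -> R :=
  fun x => rho ((x i1 : nat)%:R * Num.sqrt K / N%:R).

End Dynamics.

Section Interface.
Variable R : realType.

Definition rho_star : R := 2^-1.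

Definition potential' (gamma r : R) : R :=
  - (2 * gamma - 1) * (2 * r - 1) + gamma ^+ 2 * (2 * r - 1) ^+ 3.

(* A function on the torus of length sqrt K is a sqrt K-periodic function on
   R; its points are represented by [0, sqrt K[. *)
Definition stationary_interface (gamma K : R) (rho : R -> R) : Prop :=
  [/\ forall th, 0 < rho th < 1,
      forall th, rho (th + Num.sqrt K) = rho th,
      forall th, [/\ derivable rho th 1, derivable (derive1 rho) th 1
                   & derive1 (derive1 rho) th - potential' gamma (rho th) = 0],
      [set th | 0 <= th < Num.sqrt K /\ rho th = rho_star] #= `I_2
    & rho 0 = rho_star /\ derive1 rho 0 < 0].

(* For d = 2 and N >= 1 the equation has exactly one real solution, which
   is > 1 ([ln] is 0 on nonpositive reals). *)
Definition block_size (d N : nat) (l : R) : Prop :=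
  match d with
  | 1 => l = N%:R `^ (4 / 5)
  | 2 => l ^+ 3 * ln l = N%:R ^+ 2
  | _ => l = N%:R `^ (4 / (3 * d%:R))
  end.

End Interface.

(* Main.v *)
Require Import Defs.
From HB Require Import structures.
From mathcomp Require Import all_boot all_order all_algebra.
From mathcomp Require Import all_classical all_reals all_analysis.
From mathcomp Require Import ring lra zify.

Set Implicit Arguments.
Unset Strict Implicit.
Unset Printing Implicit Defensive.

Import Order.TTheory GRing.Theory Num.Theory.
Import numFieldNormedType.Exports.

Local Open Scope classical_set_scope.
Local Open Scope ring_scope.

(* Yau's relative entropy method.  With [E] the expectation under the product
   measure and [L] the generator, H' <= E[L f] - N^2 D(sqrt f), where D is the
   Dirichlet form of the exclusion dynamics.  The adjoint of [L] applied to 1 is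
   a polynomial in the centred variables [omega x]: because the profile solves
   the stationary equation its linear part is only O(K^(3/2) / N), and what
   remains is K sum_z omega_z G_z, with G_z a function of the two sites
   preceding z in direction e_1.  The mass of omega_z is transported onto a box
   in front of z (a segment of length N/8 if d = 1, a square of side N^(2/3) in
   two coordinate directions if d >= 2).  The gradients appearing along the way
   are integrated by parts against N^2 D; the errors, and the averaged term, are
   of the form sum_z omega_z Z_z with Z_z depending on sites behind z, hence
   exponential martingales controlled by sum_z Z_z^2.  The entropy inequality
   and a Gaussian linearization of the squares give
   H' <= C K^2 (H + (N/l)^d), and Gronwall's lemma concludes.  As K is bounded
   below by a constant, C depends on d and gamma only; it serves as c_0. *)

(** * Product measures and exponential martingales *)

(** The size of the box is dictated by two constraints. Averaging over [m1 * m2] sites leaves an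
    additive error [N^d / (m1 * m2)], which must be of order [(N/l)^d] at most. Conversely the flow
    has squared norm up to [m1], and the [4 * (m1 * m2)] colours that separate overlapping boxes
    multiply it; the integration by parts gains [1 / N^2], so [m1 * (m1 * m2) <= N ^ 2] is needed. A
    square in two directions already meets both constraints in every dimension at least 2. The box
    lies on one side of [z] only, so that the coefficient of [omega_z] never depends on [z] itself
    or on later sites. No constant may depend on [K]. The maximum principle keeps the profile at a
    distance from 0 and 1 that depends on [gamma] only; the derivative bounds use nothing but
    [0 < rho < 1] and the equation; and [K >= 1/2], forced by the non-constancy of the profile,
    absorbs [K] into [2 K^2]. *)

Lemma expR_le_add_expR_sqr (R : realType) (x : R) :
  expR x <= x + expR (2 * x ^+ 2).
Proof.
have h2 : 1 + 2 * x ^+ 2 <= expR (2 * x ^+ 2) by exact: expR_ge1Dx.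
have [x1|x1] := lerP x 1; last first.
  have : expR x <= expR (2 * x ^+ 2) by rewrite ler_expR; nra.
  lra.
have [xm1|xm1] := lerP x (-1).
  have : expR x <= 1 by rewrite expR_le1; lra.
  nra.
apply: (@le_trans _ _ (1 + x + 2 * x ^+ 2)); last by lra.
(* [e^x = (e^(-x/2))^-2 <= (1 - x/2)^-2] *)
have e1 : 1 - x / 2 <= expR (- (x / 2)) by exact: expR_ge1Dx.
have e2 : expR x * expR (- (x / 2)) ^+ 2 = 1.
  rewrite expr2 -!expRD.
  have -> : x + (- (x / 2) + - (x / 2)) = 0 by lra.
  exact: expR0.
have e3 : expR x * (1 - x / 2) ^+ 2 <= 1.
  rewrite -[leRHS]e2; apply: ler_wpM2l; first exact: expR_ge0.
  by rewrite lerXn2r ?nnegrE ?expR_ge0//; lra.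
(* The difference of the two sides is exactly half of [x^2 (1 - x) (5/2 - x)], which is nonnegative
   for [x <= 1]. *)
have e4 : 1 <= (1 + x + 2 * x ^+ 2) * (1 - x / 2) ^+ 2.
  have : 0 <= x ^+ 2 * ((1 - x) * (5 / 2 - x)).
    apply: mulr_ge0; first exact: sqr_ge0.
    by apply: mulr_ge0; lra.
  nra.
have e5 : 0 < (1 - x / 2) ^+ 2 by apply: exprn_gt0; lra.
by rewrite -(ler_pM2r e5); apply: le_trans e4.
Qed.

Section ProductMeasure.
Variables (R : realType) (d N : nat) (u : torus d N -> R).
Implicit Types (eta : config d N) (F Z : config d N -> R) (x z : torus d N).

Definition expect F : R := \sum_eta F eta * product_measure u eta.

(** This is [(eta_x - u_x) / (u_x (1 - u_x))]. With this normalization [omega x * product_measure]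
    changes sign under the flip at [x]. *)
Definition omega x eta : R := if eta x then (u x)^-1 else - (1 - u x)^-1.

Definition ignores F x : Prop := forall eta, F (flip x eta) = F eta.

Lemma flipK x : involutive (@flip d N x).
Proof.
by move=> eta; apply/ffunP => z; rewrite !ffunE; case: eqP => // _; rewrite negbK.
Qed.

Lemma flip_eq x eta : flip x eta x = ~~ eta x.
Proof. by rewrite ffunE eqxx. Qed.

Lemma flip_neq x z eta : z != x -> flip x eta z = eta z.
Proof. by rewrite ffunE => /negbTE ->. Qed.

Lemma sum_flip x F : \sum_eta F (flip x eta) = \sum_eta F eta.
Proof. by rewrite [RHS](reindex_inj (inv_inj (flipK x))). Qed.

Lemma product_measure_flip x eta :
  product_measure u (flip x eta) * (if eta x then u x else 1 - u x) =
  product_measure u eta * (if eta x then 1 - u x else u x).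
Proof.
rewrite /product_measure (bigD1 x)//= [in RHS](bigD1 x)//= flip_eq.
rewrite (eq_bigr (fun z => if eta z then u z else 1 - u z)); last first.
  by move=> z zx; rewrite flip_neq.
by case: (eta x); rewrite /=; ring.
Qed.

Lemma expectD F Z : expect (fun eta => F eta + Z eta) = expect F + expect Z.
Proof. by rewrite /expect -big_split; apply: eq_bigr => eta _; rewrite mulrDl. Qed.

Lemma expectZ (a : R) F : expect (fun eta => a * F eta) = a * expect F.
Proof. by rewrite /expect mulr_sumr; apply: eq_bigr => eta _; rewrite mulrA. Qed.

Lemma expect_sum (I : finType) (P : pred I) (F : I -> config d N -> R) :
  expect (fun eta => \sum_(i | P i) F i eta) = \sum_(i | P i) expect (F i).
Proof.
rewrite /expect exchange_big; apply: eq_bigr => eta _.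
by rewrite mulr_suml.
Qed.

Lemma eq_expect F Z : F =1 Z -> expect F = expect Z.
Proof. by move=> FZ; apply: eq_bigr => eta _; rewrite FZ. Qed.

Lemma sum_product_measure : \sum_eta product_measure u eta = 1.
Proof.
rewrite /product_measure.
rewrite -(@bigA_distr_bigA R 0 1 *%R +%R (torus d N) bool
  (fun x b => if b then u x else 1 - u x)).
by apply: big1 => x _; rewrite big_bool /= addrC subrK.
Qed.

Lemma expect_cst (a : R) : expect (fun=> a) = a.
Proof. by rewrite /expect -mulr_sumr sum_product_measure mulr1. Qed.

Variable eps : R.
Hypothesis eps_gt0 : 0 < eps.
Hypothesis u_eps : forall x, eps <= u x <= 1 - eps.

Lemma product_measure_gt0 eta : 0 < product_measure u eta.
Proof.
apply: prodr_gt0 => x _.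
by have /andP[] := u_eps x; have := eps_gt0; case: (eta x) => ? ? ?; lra.
Qed.

Lemma ler_expect F Z : (forall eta, F eta <= Z eta) -> expect F <= expect Z.
Proof.
move=> FZ; apply: ler_sum => eta _.
by rewrite ler_wpM2r// ltW// product_measure_gt0.
Qed.

Lemma expect_ge0 F : (forall eta, 0 <= F eta) -> 0 <= expect F.
Proof.
move=> F0; apply: sumr_ge0 => eta _.
by rewrite mulr_ge0// ltW// product_measure_gt0.
Qed.

Lemma omega_bound x eta : `|omega x eta| <= eps^-1.
Proof.
have /andP[u1 u2] := u_eps x; rewrite /omega.
case: (eta x); rewrite ?normrN ger0_norm ?invr_ge0 ?lef_pV2 ?posrE;
  have := eps_gt0; lra.
Qed.

Lemma product_measure_flip_le x eta :
  product_measure u (flip x eta) <= eps^-1 * product_measure u eta.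
Proof.
have := product_measure_flip x eta.
have /andP[u1 u2] := u_eps x; have e0 := eps_gt0.
have p1 := product_measure_gt0 eta; have p2 := product_measure_gt0 (flip x eta).
rewrite ler_pdivlMl//.
set p := product_measure u eta in p1 *; set q := product_measure _ _ in p2 *.
by case: (eta x) => E; nra.
Qed.

(** [omega x] is centred and independent of [F] and [Z], so the linear term of
    [e^y <= y + e^(2 y^2)] integrates to zero. The compensator [2 / eps^2] pays for [2 (omega Z)^2],
    as [omega] is at most [1 / eps] in absolute value. *)
Lemma expect_exp_site x F Z :
    ignores F x -> ignores Z x -> (forall eta, 0 <= F eta) ->
  expect (fun eta => expR (omega x eta * Z eta - 2 / eps ^+ 2 * Z eta ^+ 2) * F eta)
  <= expect F.
Proof.
move=> Fx Zx F0; set A := fun eta => _.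
(* Pairing each configuration with its flip at [x] reduces the claim to a two-point inequality. *)
have sym G : expect G = 2^-1 * \sum_eta
    (G eta * product_measure u eta + G (flip x eta) * product_measure u (flip x eta)).
  rewrite big_split /= (sum_flip x (fun eta => G eta * product_measure u eta)).
  by rewrite /expect; lra.
rewrite (sym A) (sym F); apply: ler_wpM2l; first by lra.
apply: ler_sum => eta _; rewrite /A Fx Zx -!(mulrA (expR _)).
have -> : omega x (flip x eta) = (if eta x then - (1 - u x)^-1 else (u x)^-1).
  by rewrite /omega flip_eq; case: (eta x).
have -> : omega x eta = (if eta x then (u x)^-1 else - (1 - u x)^-1) by [].
set zz := Z eta; set c := 2 / eps ^+ 2.
have /andP[u1 u2] := u_eps x; have e0 := eps_gt0.
have ux0 : 0 < u x by lra.
have ux1 : 0 < 1 - u x by lra.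
have key v : 0 < v -> eps <= v -> expR (v^-1 * zz - c * zz ^+ 2) <=
    v^-1 * zz * expR (- (c * zz ^+ 2)) + 1.
  move=> v0 ev.
  have h := expR_le_add_expR_sqr (v^-1 * zz).
  rewrite expRD; apply: (@le_trans _ _ ((v^-1 * zz + expR (2 * (v^-1 * zz) ^+ 2))
    * expR (- (c * zz ^+ 2)))).
    by apply: ler_wpM2r => //; exact: expR_ge0.
  rewrite mulrDl lerD2l -expRD expR_le1 subr_le0 exprMn mulrA.
  apply: ler_wpM2r; first exact: sqr_ge0.
  rewrite ler_pM2l// -exprVn ler_sqr ?nnegrE ?invr_ge0; try lra.
  by rewrite lef_pV2.
have keyN v : 0 < v -> eps <= v -> expR (- v^-1 * zz - c * zz ^+ 2) <=
    - v^-1 * zz * expR (- (c * zz ^+ 2)) + 1.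
  move=> v0 ev.
  have h := expR_le_add_expR_sqr (- v^-1 * zz).
  rewrite expRD; apply: (@le_trans _ _ ((- v^-1 * zz + expR (2 * (- v^-1 * zz) ^+ 2))
    * expR (- (c * zz ^+ 2)))).
    by apply: ler_wpM2r => //; exact: expR_ge0.
  rewrite mulrDl lerD2l -expRD expR_le1 subr_le0 exprMn mulrA sqrrN.
  apply: ler_wpM2r; first exact: sqr_ge0.
  rewrite ler_pM2l// -exprVn ler_sqr ?nnegrE ?invr_ge0; try lra.
  by rewrite lef_pV2.
have hu := key _ ux0 u1; have h1u := keyN _ ux1 (_ : eps <= 1 - u x).
have {}h1u := h1u ltac:(lra).
have := product_measure_flip x eta.
have p1 := product_measure_gt0 eta; have p2 := product_measure_gt0 (flip x eta).
set p := product_measure u eta in p1 *; set q := product_measure _ _ in p2 *.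
set ee := expR (- _) in hu h1u.
have F0e := F0 eta; set ff := F eta in F0e *.
case: (eta x) => E.
  have E1 : q = p * (1 - u x) / u x by rewrite -E mulfK// gt_eqF.
  apply: (@le_trans _ _ (((u x)^-1 * zz * ee + 1) * (ff * p)
     + (- (1 - u x)^-1 * zz * ee + 1) * (ff * q))).
    by apply: lerD; apply: ler_wpM2r => //; rewrite mulr_ge0// ltW.
  rewrite E1 le_eqVlt; apply/orP; left; apply/eqP; field.
  by rewrite !gt_eqF.
have E1 : q = p * u x / (1 - u x) by rewrite -E mulfK// gt_eqF.
apply: (@le_trans _ _ ((- (1 - u x)^-1 * zz * ee + 1) * (ff * p)
     + ((u x)^-1 * zz * ee + 1) * (ff * q))).
  by apply: lerD; apply: ler_wpM2r => //; rewrite mulr_ge0// ltW.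
rewrite E1 le_eqVlt; apply/orP; left; apply/eqP; field.
by rewrite !gt_eqF.
Qed.

(* integrate out the sites in decreasing order of rank *)
Lemma expect_exp_ranked (r : torus d N -> nat) (Z : torus d N -> config d N -> R)
    (A : {set torus d N}) :
    (forall z z', z \in A -> (r z <= r z')%N -> ignores (Z z) z') ->
  expect (fun eta =>
    expR (\sum_(z in A) (omega z eta * Z z eta - 2 / eps ^+ 2 * Z z eta ^+ 2)))
  <= 1.
Proof.
have [n] := ubnP #|A|; elim: n A => // n IH A; rewrite ltnS => An ZA.
case: (set_0Vmem A) => [A0|[z0 z0A]].
  rewrite (eq_expect (Z := fun=> 1)) ?expect_cst// => eta.
  by rewrite A0 big_set0 expR0.
(* By maximality of the rank, [Z z] and all the remaining factors ignore [z]. *)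
have [z zA zmax] := @arg_maxnP _ z0 [in A] r z0A.
pose F eta := expR (\sum_(y in A :\ z) (omega y eta * Z y eta - 2 / eps ^+ 2 * Z y eta ^+ 2)).
have -> : expect (fun eta => expR (\sum_(y in A) (omega y eta * Z y eta
    - 2 / eps ^+ 2 * Z y eta ^+ 2))) =
  expect (fun eta => expR (omega z eta * Z z eta - 2 / eps ^+ 2 * Z z eta ^+ 2) * F eta).
  by apply: eq_expect => eta; rewrite (big_setD1 z)//= expRD.
apply: (@le_trans _ _ (expect F)).
  apply: expect_exp_site; last by move=> eta; exact: expR_ge0.
  - move=> eta; rewrite /F; congr expR; apply: eq_bigr => y; rewrite in_setD1 => /andP[yz yA].
    by rewrite ZA//; [rewrite /omega flip_neq|exact: zmax].
  - exact: ZA.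
apply: IH; first by apply: leq_trans An; rewrite [X in (_ < X)%N](cardsD1 z) zA.
by move=> y y'; rewrite in_setD1 => /andP[_]; exact: ZA.
Qed.

End ProductMeasure.

(** Convex duality between [a ln a - a] and [exp]: the tangent inequality [1 + y <= e^y] at
    [y = x - ln a]. *)
Lemma young_entropy (R : realType) (a x : R) :
  0 <= a -> a * x <= a * ln a - a + expR x.
Proof.
rewrite le_eqVlt => /predU1P[<-|a0]; first by rewrite !mul0r !subr0 add0r expR_ge0.
have := expR_ge1Dx (x - ln a); rewrite expRB lnK ?posrE//.
by rewrite ler_pdivlMr//; lra.
Qed.

(** * Entropy inequality and martingales around the torus *)

Section EntropyInequality.
Variables (R : realType) (d N : nat) (u : torus d N -> R).
Variable eps : R.
Hypothesis eps_gt0 : 0 < eps.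
Hypothesis u_eps : forall x, eps <= u x <= 1 - eps.
Variable f : config d N -> R.
Hypothesis f_ge0 : forall eta, 0 <= f eta.
Hypothesis f_density : expect u f = 1.

Local Notation H := (entropy (product_measure u) f).

(** Gibbs variational principle. Young's inequality is applied pointwise to [X - B]; the terms [- f]
    and [exp (X - B)] then contribute at most [-1 + 1]. *)
Lemma expect_le_entropy (X : config d N -> R) (B : R) :
    expect u (fun eta => expR (X eta)) <= expR B ->
  expect u (fun eta => f eta * X eta) <= H + B.
Proof.
move=> XB.
have {}XB : expect u (fun eta => expR (X eta - B)) <= 1.
  rewrite (@eq_expect _ _ _ u _ (fun eta => expR (- B) * expR (X eta))).
    by rewrite expectZ expRN mulrC ler_pdivrMr ?expR_gt0// mul1r.
  by move=> eta; rewrite -expRD addrC.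
have HE : H = expect u (fun eta => f eta * ln (f eta)) by [].
have h : expect u (fun eta => f eta * (X eta - B)) <=
    expect u (fun eta => f eta * ln (f eta) + (-1) * f eta + expR (X eta - B)).
  apply: (ler_expect eps_gt0 u_eps) => eta.
  by have := young_entropy (X eta - B) (f_ge0 eta); lra.
rewrite !expectD expectZ f_density -HE in h.
have E1 : expect u (fun eta => f eta * (X eta - B)) =
    expect u (fun eta => f eta * X eta) - B.
  rewrite (@eq_expect _ _ _ u _ (fun eta => f eta * X eta + (- B) * f eta)).
    by rewrite expectD expectZ f_density mulr1.
  by move=> eta; lra.
lra.
Qed.

Lemma entropy_ge0 : 0 <= H.
Proof.
have := @expect_le_entropy (fun=> 0) 0.
rewrite (_ : expect u (fun eta => f eta * 0) = 0); last first.
  by rewrite -[RHS](expect_cst u 0); apply: eq_expect => eta; rewrite mulr0.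
by rewrite expect_cst expR0 addr0; apply.
Qed.

Section CyclicPast.
Variables (j : 'I_d) (w : nat).
Hypothesis N_gt0 : (0 < N)%N.
Hypothesis w_small : (w.*2 <= N)%N.

(* [Z z] is measurable with respect to the sites that precede [z] by 1, ..., w
   steps in direction [j] around the torus *)
Definition cyclic_past (Z : torus d N -> config d N -> R) : Prop :=
  forall z z' : torus d N, ~~ (0 < ((z - z')%R j : nat) <= w)%N -> ignores (Z z) z'.

(* The torus is not ordered; but the sites with [w <= z j] and those with
   [z j < w] both are, after cutting it at 0, resp. at [- w]. *)
Lemma expect_exp_cyclic (Z : torus d N -> config d N -> R) :
    cyclic_past Z ->
  expect u (fun eta =>
    expR (\sum_z (omega u z eta * Z z eta - 4 / eps ^+ 2 * Z z eta ^+ 2))) <= 1.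
Proof.
move=> ZP.
pose A : {set torus d N} := finset (fun z : torus d N => w <= z j)%N.
(* The two halves are joined by [e^(a+b) <= (e^(2a) + e^(2b)) / 2], so each is run with [2 Z]; this
   doubles the compensator from [2 / eps^2] to [4 / eps^2]. *)
pose Z2 z eta := 2 * Z z eta.
have n1 : N.-1.+1 = N by lia.
have diffE (z z' : torus d N) :
    ((z - z')%R j : nat) = ((z j + (N.-1.+1 - z' j) %% N.-1.+1) %% N.-1.+1)%N.
  by rewrite !ffunE.
have bd (z : torus d N) : (z j < N.-1.+1)%N by [].
have hA : expect u (fun eta => expR (\sum_(z in A)
    (omega u z eta * Z2 z eta - 2 / eps ^+ 2 * Z2 z eta ^+ 2))) <= 1.
  apply: (expect_exp_ranked eps_gt0 u_eps (r := fun z => z j)) => z z'.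
  rewrite inE => wz zz' eta; congr (_ * _); apply: ZP; rewrite diffE.
  have := bd z; have := bd z'; move: wz zz' n1 w_small.
  move: (z j : nat) (z' j : nat) => a b wa ab n1 w2 bN aN.
  rewrite n1 in aN bN *; case: b => [|b] in ab bN *.
    by rewrite subn0 modnn addn0 modn_small//; lia.
  rewrite (@modn_small (N - b.+1)); last by lia.
  by case: (ltnP (a + (N - b.+1)) N) => h; [rewrite modn_small//; lia|
    rewrite (_ : (a + (N - b.+1) = N)%N) ?modnn; lia].
have hB : expect u (fun eta => expR (\sum_(z in ~: A)
    (omega u z eta * Z2 z eta - 2 / eps ^+ 2 * Z2 z eta ^+ 2))) <= 1.
  apply: (expect_exp_ranked eps_gt0 u_eps (r := fun z => ((z j + w) %% N.-1.+1)%N)) => z z'.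
  rewrite !inE -ltnNge => wz zz' eta; congr (_ * _); apply: ZP; rewrite diffE.
  have := bd z; have := bd z'; move: wz zz' n1 w_small.
  move: (z j : nat) (z' j : nat) => a b wa ab n1 w2 bN aN.
  rewrite n1 in aN bN ab *.
  rewrite (@modn_small (a + w)) in ab; last by lia.
  have hb : (b + w < N)%N.
    rewrite ltnNge; apply/negP => hb.
    have : ((b + w) %% N = b + w - N)%N by rewrite -[in LHS](subnK hb) modnDr modn_small//; lia.
    by lia.
  rewrite (@modn_small (b + w)) // in ab.
  case: b => [|b] in ab bN hb *.
    by rewrite subn0 modnn addn0 modn_small//; lia.
  rewrite (@modn_small (N - b.+1)); last by lia.
  by case: (ltnP (a + (N - b.+1)) N) => h; [rewrite modn_small//; lia|
    rewrite (_ : (a + (N - b.+1) = N)%N) ?modnn; lia].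
pose EA eta := expR (\sum_(z in A)
    (omega u z eta * Z2 z eta - 2 / eps ^+ 2 * Z2 z eta ^+ 2)).
pose EB eta := expR (\sum_(z in ~: A)
    (omega u z eta * Z2 z eta - 2 / eps ^+ 2 * Z2 z eta ^+ 2)).
apply: (@le_trans _ _ (expect u (fun eta => 2^-1 * EA eta + 2^-1 * EB eta))); last first.
  by rewrite expectD !expectZ; lra.
apply: (ler_expect eps_gt0 u_eps) => eta.
rewrite (bigID (mem A))/= expRD.
set a := \sum_(_ | _) _; set b := \sum_(_ | _) _.
have -> : EA eta = expR a ^+ 2.
  rewrite -expRM_natl /EA /a mulr_sumr; congr expR; apply: eq_bigr => z _.
  by rewrite /Z2; ring.
have -> : EB eta = expR b ^+ 2.
  rewrite -expRM_natl /EB /b mulr_sumr; congr expR; apply: eq_big => z; first by rewrite !inE.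
  by move=> _; rewrite /Z2; ring.
by have := sqr_ge0 (expR a - expR b); lra.
Qed.

(** The entropy inequality for [g Z], divided by [g]. The free parameter trades the coefficient of
    the entropy against the squares; the values used are [K^-2] and 1. *)
Lemma expect_cyclic (Z : torus d N -> config d N -> R) (g : R) :
    0 < g -> cyclic_past Z ->
  expect u (fun eta => f eta * \sum_z omega u z eta * Z z eta) <=
  g^-1 * H + 4 / eps ^+ 2 * g * expect u (fun eta => f eta * \sum_z Z z eta ^+ 2).
Proof.
move=> g0 ZP.
have ZP' : cyclic_past (fun z eta => g * Z z eta).
  by move=> z z' zz' eta; rewrite ZP.
have := @expect_le_entropy (fun eta => \sum_z (omega u z eta * (g * Z z eta)
   - 4 / eps ^+ 2 * (g * Z z eta) ^+ 2)) 0.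
rewrite expR0 addr0 => /(_ (expect_exp_cyclic ZP')).
set S := expect u (fun eta => f eta * \sum_z omega u z eta * Z z eta).
set Q := expect u (fun eta => f eta * \sum_z Z z eta ^+ 2).
have -> : expect u (fun eta => f eta * \sum_z (omega u z eta * (g * Z z eta)
   - 4 / eps ^+ 2 * (g * Z z eta) ^+ 2)) = g * S + (- (4 / eps ^+ 2 * g ^+ 2)) * Q.
  rewrite /S /Q -!expectZ -expectD; apply: eq_expect => eta.
  rewrite !mulr_sumr -big_split; apply: eq_bigr => z _ /=; ring.
move=> h; rewrite -(ler_pM2l g0) mulrDr mulrA divff ?gt_eqF// mul1r.
by lra.
Qed.

Lemma expect_exp_cyclic_bounded (Z : torus d N -> config d N -> R) (V : R) :
    cyclic_past Z -> (forall eta, \sum_z Z z eta ^+ 2 <= V) ->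
  expect u (fun eta => expR (\sum_z omega u z eta * Z z eta)) <=
  expR (4 / eps ^+ 2 * V).
Proof.
move=> ZP ZV.
apply: (@le_trans _ _ (expect u (fun eta => expR (4 / eps ^+ 2 * V) *
    expR (\sum_z (omega u z eta * Z z eta - 4 / eps ^+ 2 * Z z eta ^+ 2))))).
  apply: (ler_expect eps_gt0 u_eps) => eta.
  rewrite -expRD ler_expR sumrB -mulr_sumr addrCA lerDl subr_ge0.
  by apply: ler_wpM2l => //; rewrite divr_ge0// exprn_ge0// ltW.
rewrite expectZ ger_pMr ?expR_gt0//; exact: expect_exp_cyclic.
Qed.

End CyclicPast.
End EntropyInequality.

(** * Quadratic functionals of the fluctuations *)

Section DiscreteGaussian.
Variable R : realType.

Definition signed_nat P (q : bool * 'I_P) : R := (if q.1 then 1 else -1) * (q.2 : nat)%:R.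

(* discrete substitute for the Gaussian linearization of [expR (x ^+ 2)]: the
   maximum over [a] of [a x - a^2 / 4] is [x^2], and an integer [a] is nearly
   optimal *)
Lemma expR_sqr_le_sum P (x : R) : 2 * `|x| < P%:R ->
  expR (x ^+ 2) <=
  2 * \sum_(q : bool * 'I_P) expR (signed_nat q * x - signed_nat q ^+ 2 / 4).
Proof.
move=> xP.
have x0 : 0 <= 2 * `|x| by rewrite mulr_ge0.
have /andP[n1 n2] := Num.Theory.truncn_itv x0.
set n := Num.truncn _ in n1 n2.
have nP : (n < P)%N by rewrite -(ltr_nat R); apply: le_lt_trans xP.
pose q0 := (0 <= x, Ordinal nP).
rewrite (bigD1 q0)//= mulrDr.
set rest := \sum_(_ | _) _.
have rest0 : 0 <= rest by apply: sumr_ge0 => q _; exact: expR_ge0.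
have E : signed_nat q0 * x = n%:R * `|x|.
  rewrite /signed_nat /q0 /=; case: ifPn => [x_ge0|]; first by rewrite mul1r ger0_norm.
  by rewrite -ltNge => x_lt0; rewrite ltr0_norm// mulN1r mulrN mulNr.
have E2 : signed_nat q0 ^+ 2 = n%:R ^+ 2.
  by rewrite /signed_nat /q0 /=; case: ifP => _; rewrite ?mul1r ?mulN1r ?sqrrN.
rewrite E E2.
apply: (@le_trans _ _ (2 * expR (n%:R * `|x| - n%:R ^+ 2 / 4))); last by lra.
(* The prefactor 2 pays for the rounding: [x^2 - (n |x| - n^2/4) = (|x| - n/2)^2 <= 1/4], as [n] is
   the integer part of [2 |x|]. *)
have h4 : expR (4^-1 : R) <= 2.
  have h : 1 + - (4^-1) <= expR (- (4^-1) : R) by exact: expR_ge1Dx.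
  have e0 : 0 < expR (4^-1 : R) by exact: expR_gt0.
  have e1 : expR (4^-1 : R) * expR (- (4^-1)) = 1 by rewrite -expRD subrr expR0.
  nra.
apply: (@le_trans _ _ (expR (4^-1) * expR (n%:R * `|x| - n%:R ^+ 2 / 4))); last first.
  by apply: ler_wpM2r => //; exact: expR_ge0.
rewrite -expRD ler_expR -(real_normK (num_real x)).
set y := `|x| in n1 n2 *; set k := n%:R in n1 n2 *.
rewrite -natr1 -/k in n2.
nra.
Qed.

(** Since [n <= n^2], each sign is dominated by a geometric series of ratio [e^(-1/8) <= 8/9], with
    sum at most 9. The bound is uniform in the truncation [P]. *)
Lemma sum_gaussian_le P : \sum_(q : bool * 'I_P) expR (- (signed_nat q ^+ 2 / 8)) <= 18.
Proof.
rewrite -(pair_bigA _ (fun (b : bool) (n : 'I_P) => expR (- (signed_nat (b, n) ^+ 2 / 8))))/=.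
pose r := expR (- (8^-1)) : R.
have r1 : r <= 8 / 9.
  have h : 1 + 8^-1 <= expR (8^-1 : R) by exact: expR_ge1Dx.
  by rewrite /r expRN -[leRHS]invrK lef_pV2 ?posrE ?expR_gt0 ?invr_gt0; lra.
have r0 : 0 <= r by exact: expR_ge0.
have b9 b : \sum_(n < P) expR (- (signed_nat (b, n) ^+ 2 / 8)) <= 9.
  apply: (@le_trans _ _ (\sum_(n < P) r ^+ n)).
    apply: ler_sum => n _; rewrite /r -expRM_natl ler_expR mulrN lerN2 ler_wpM2r//.
    rewrite /signed_nat /=; set k := (n : nat).
    have : (k <= k ^ 2)%N by case: k => // k; rewrite expnS expn1 leq_pmulr.
    rewrite -(ler_nat R) natrX => kk.
    by case: b; rewrite ?mul1r ?mulN1r ?sqrrN.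
  have := subrX1 r P; set S := \sum_(_ < _) _ => E.
  have rP : 0 <= r ^+ P by exact: exprn_ge0.
  nra.
by rewrite big_bool /=; have := b9 true; have := b9 false; lra.
Qed.

End DiscreteGaussian.

Section Quadratic.
Variables (R : realType) (d N : nat) (u : torus d N -> R).
Variable eps : R.
Hypothesis eps_gt0 : 0 < eps.
Hypothesis u_eps : forall x, eps <= u x <= 1 - eps.
Variable f : config d N -> R.
Hypothesis f_ge0 : forall eta, 0 <= f eta.
Hypothesis f_density : expect u f = 1.
Variables (i1 : 'I_d) (A B : torus d N -> R) (D : R).
Hypothesis N_ge2 : (2 <= N)%N.
Hypothesis A_le : forall z, `|A z| <= D.
Hypothesis B_le : forall z, `|B z| <= D.

Local Notation H := (entropy (product_measure u) f).
Local Notation e1 := (unitv N i1).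

(** The function [G_z] of the overview; [A] and [B] will be [pair_coef] and [triple_coef]. It starts
    with an [omega] of its own, so it is again a martingale increment, indexed by [z - e1]. *)
Definition local_fluct (z : torus d N) (eta : config d N) : R :=
  omega u (z - e1) eta * (A z + B z * omega u (z - e1 - e1) eta).

Definition subgauss_cst : R := 4 / eps ^+ 2 * (D + D / eps) ^+ 2.

Lemma unitv_same : (unitv N i1 i1 : nat) = 1%N.
Proof. by rewrite ffunE eqxx /= modn_small//; case: N N_ge2 => [|[|]]. Qed.

Lemma expect_exp_linear (c : torus d N -> R) :
  expect u (fun eta => expR (\sum_x c x * local_fluct x eta)) <=
  expR (subgauss_cst * \sum_x c x ^+ 2).
Proof.
pose Z z eta := c (z + e1) * (A (z + e1) + B (z + e1) * omega u (z - e1) eta).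
have -> : expect u (fun eta => expR (\sum_x c x * local_fluct x eta)) =
    expect u (fun eta => expR (\sum_z omega u z eta * Z z eta)).
  apply: eq_expect => eta; congr expR.
  rewrite (reindex_inj (addIr e1)); apply: eq_bigr => z _.
  by rewrite /local_fluct /Z addrK mulrCA.
have ZP : cyclic_past i1 1 Z.
  move=> z z' zz' eta; rewrite /Z /omega.
  have [E|ne] := eqVneq (z - e1) z'; last by rewrite flip_neq.
  by move: zz'; rewrite -E opprB addrCA subrr addr0 unitv_same.
have ZV eta : \sum_z Z z eta ^+ 2 <= (D + D / eps) ^+ 2 * \sum_x c x ^+ 2.
  rewrite [in leRHS](reindex_inj (addIr e1)) mulr_sumr; apply: ler_sum => z _.
  rewrite /Z exprMn mulrC ler_wpM2r ?sqr_ge0//.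
  rewrite -(real_normK (num_real (A _ + _))).
  have D0 : 0 <= D by apply: le_trans (A_le z).
  apply: lerXn2r; rewrite ?nnegrE ?addr_ge0 ?divr_ge0 ?(ltW eps_gt0)//.
  apply: le_trans (ler_normD _ _) _; apply: lerD => //.
  rewrite normrM ler_pM//; exact: omega_bound.
have := expect_exp_cyclic_bounded eps_gt0 u_eps (leq_trans (isT : 0 < 2)%N N_ge2) (N_ge2 : 1.*2 <= N)%N ZP ZV.
by rewrite mulrA.
Qed.

Variables (I C : finType) (p : I -> torus d N) (col : torus d N -> C) (phi : I -> R).
Variable V : R.
Hypothesis V_gt0 : 0 < V.
Hypothesis phi_V : \sum_k phi k ^+ 2 <= V.
(* points with the same colour have disjoint windows *)
Hypothesis col_inj : forall (x : torus d N) k k', col (x + p k) = col (x + p k') -> k = k'.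

Definition window_sum (y : torus d N) (eta : config d N) : R :=
  \sum_k phi k * local_fluct (y - p k) eta.

(** Inside one colour class at most one window meets a given site through the offsets, so the cross
    terms in the squared coefficient of [local_fluct x] vanish and no overlap count is lost. *)
Lemma expect_exp_window_sum (c : C) (n : torus d N -> R) :
    (forall y, col y != c -> n y = 0) ->
  expect u (fun eta => expR (\sum_y n y * window_sum y eta)) <=
  expR (subgauss_cst * (V * \sum_y n y ^+ 2)).
Proof.
move=> n0; pose cc (x : torus d N) := \sum_k phi k * n (x + p k).
have -> : expect u (fun eta => expR (\sum_y n y * window_sum y eta)) =
    expect u (fun eta => expR (\sum_x cc x * local_fluct x eta)).
  apply: eq_expect => eta; congr expR.
  transitivity (\sum_y \sum_k n y * (phi k * local_fluct (y - p k) eta)).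
    by apply: eq_bigr => y _; rewrite mulr_sumr.
  rewrite exchange_big /=.
  transitivity (\sum_k \sum_(x : torus d N) n (x + p k) * (phi k * local_fluct x eta)).
    apply: eq_bigr => k _; rewrite (reindex_inj (addIr (p k))).
    by apply: eq_bigr => x _; rewrite addrK.
  rewrite exchange_big /=; apply: eq_bigr => x _; rewrite /cc mulr_suml.
  by apply: eq_bigr => k _; rewrite mulrCA mulrA.
apply: le_trans (expect_exp_linear cc) _; rewrite ler_expR.
apply: ler_wpM2l.
  by rewrite /subgauss_cst mulr_ge0 ?sqr_ge0// divr_ge0 ?sqr_ge0.
have sq (x : torus d N) : cc x ^+ 2 = \sum_k phi k ^+ 2 * n (x + p k) ^+ 2.
  rewrite /cc expr2 mulr_suml; apply: eq_bigr => k _.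
  rewrite mulr_sumr (bigD1 k)//= big1 ?addr0; first by ring.
  move=> k' kk'; have [ck|/n0 ->] := eqVneq (col (x + p k)) c; last by ring.
  have [ck'|/n0 ->] := eqVneq (col (x + p k')) c; last by ring.
  by have := @col_inj x k k'; rewrite ck ck' => /(_ erefl) E; rewrite E eqxx in kk'.
rewrite (eq_bigr _ (fun x _ => sq x)) exchange_big /=.
have E k : \sum_(x : torus d N) phi k ^+ 2 * n (x + p k) ^+ 2 = phi k ^+ 2 * \sum_y n y ^+ 2.
  by rewrite -mulr_sumr [in RHS](reindex_inj (addIr (p k))).
rewrite (eq_bigr _ (fun k _ => E k)) -mulr_suml.
by apply: ler_wpM2r => //; apply: sumr_ge0 => y _; exact: sqr_ge0.
Qed.

(** After linearization, the product over the class becomes a sum over families [g] of integers. For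
    each family the exponent is linear, and the smallness of [s] spends half of the Gaussian weight
    [a^2 / 4] on its exponential moment. The rest factorizes, with [2 * 18 = 36 <= e^36] per
    site. *)
Lemma expect_exp_window_sqr (c : C) (s : R) :
    subgauss_cst * (V * s ^+ 2) <= 8^-1 ->
  expect u (fun eta => expR (\sum_(y | col y == c) (s * window_sum y eta) ^+ 2)) <=
  expR (36 * (\sum_(y | col y == c) 1)).
Proof.
move=> s_small.
(* There are finitely many sites and configurations, so one truncation [P] serves them all. *)
pose T := \sum_y \sum_eta 2 * `|s * window_sum y eta|.
have T0 : 0 <= T by do 2!(apply: sumr_ge0 => ? _); rewrite mulr_ge0.
pose P := Num.bound T.
have TP : T < P%:R by exact: archi_boundP.
have wP y eta : 2 * `|s * window_sum y eta| < P%:R.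
  apply: le_lt_trans TP; rewrite /T (bigD1 y)//= (bigD1 eta)//= -addrA lerDl addr_ge0//.
    by apply: sumr_ge0 => ? _; rewrite mulr_ge0.
  by do 2!(apply: sumr_ge0 => ? _); rewrite mulr_ge0.
have P0 : (0 < P)%N.
  by rewrite -(ltr_nat R); apply: le_lt_trans TP.
pose Q := (bool * 'I_P)%type; pose q0 : Q := (true, Ordinal P0).
pose a (q : Q) : R := signed_nat R q.
pose col_c := [pred y | col y == c].
pose W y eta := s * window_sum y eta.
apply: (@le_trans _ _ (expect u (fun eta => \prod_(y in col_c) (\sum_(q in {: Q})
    2 * expR (a q * W y eta - a q ^+ 2 / 4))))).
  apply: (ler_expect eps_gt0 u_eps) => eta; rewrite expR_sum.
  apply: ler_prod => y _; rewrite expR_ge0 /= -mulr_sumr.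
  exact: expR_sqr_le_sum.
(* The default [q0] outside the colour class makes a family indexed by the class a total function,
   as [big_distr_big] expects. *)
pose Fam := pffun_on q0 col_c {: Q}.
have -> : expect u (fun eta => \prod_(y in col_c) (\sum_(q in {: Q})
    2 * expR (a q * W y eta - a q ^+ 2 / 4))) =
  \sum_(g in Fam) expect u (fun eta => \prod_(y in col_c)
    (2 * expR (a (g y) * W y eta - a (g y) ^+ 2 / 4))).
  rewrite -expect_sum; apply: eq_expect => eta.
  exact: (big_distr_big q0).
apply: (@le_trans _ _ (\sum_(g in Fam) \prod_(y in col_c) (2 * expR (- (a (g y) ^+ 2 / 8))))).
  apply: ler_sum => g _.
  pose n y := if col y == c then s * a (g y) else 0.
  have En : \sum_y n y ^+ 2 = s ^+ 2 * \sum_(y in col_c) a (g y) ^+ 2.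
    rewrite mulr_sumr [RHS]big_mkcond /=; apply: eq_bigr => y _.
    by rewrite /n inE; case: ifP => _; rewrite ?exprMn ?expr0n.
  have n0 y : col y != c -> n y = 0 by rewrite /n => /negbTE ->.
  have := expect_exp_window_sum n0; rewrite En => hh.
  have -> : expect u (fun eta => \prod_(y in col_c)
      (2 * expR (a (g y) * W y eta - a (g y) ^+ 2 / 4))) =
    (\prod_(y in col_c) (2 * expR (- (a (g y) ^+ 2 / 4)))) *
     expect u (fun eta => expR (\sum_y n y * window_sum y eta)).
    rewrite -expectZ; apply: eq_expect => eta.
    have -> : \sum_y n y * window_sum y eta = \sum_(y in col_c) a (g y) * W y eta.
      rewrite [RHS]big_mkcond /=; apply: eq_bigr => y _.
      by rewrite /n /W inE; case: ifP => _; rewrite ?mul0r//; ring.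
    rewrite expR_sum -big_split; apply: eq_bigr => y _ /=.
    by rewrite expRD; ring.
  apply: le_trans (ler_wpM2l _ hh) _.
    by apply: prodr_ge0 => y _; rewrite mulr_ge0 ?expR_ge0.
  have -> : subgauss_cst * (V * (s ^+ 2 * \sum_(y in col_c) a (g y) ^+ 2)) =
      \sum_(y in col_c) (subgauss_cst * (V * s ^+ 2)) * a (g y) ^+ 2.
    by rewrite -mulr_sumr; ring.
  rewrite expR_sum -big_split; apply: ler_prod => y _ /=.
  rewrite !mulr_ge0 ?expR_ge0//= -(mulrA 2) ler_pM2l// -expRD ler_expR.
  have : 0 <= a (g y) ^+ 2 by exact: sqr_ge0.
  by move: s_small; set b := _ * (V * _); set t := _ ^+ 2; nra.
rewrite -(big_distr_big q0 _ _ (fun y q => 2 * expR (- (a q ^+ 2 / 8)))) /=.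
rewrite mulr_sumr expR_sum; apply: ler_prod => y _.
rewrite -mulr_sumr mulr1; apply/andP; split.
  by rewrite mulr_ge0// sumr_ge0// => q _; exact: expR_ge0.
apply: (@le_trans _ _ (2 * 18)); first by rewrite ler_pM2l//; exact: sum_gaussian_le.
by have := expR_ge1Dx (36 : R); lra.
Qed.

(** The entropy is paid once per colour, the constant 36 once per site. The scale [s] makes the
    condition of [expect_exp_window_sqr] an equality. *)
Lemma expect_window_sqr :
    0 < D ->
  expect u (fun eta => f eta * \sum_y window_sum y eta ^+ 2) <=
  8 * subgauss_cst * V * (#|C|%:R * H + 36 * #|{: torus d N}|%:R).
Proof.
move=> D0.
have sg0 : 0 < subgauss_cst.
  rewrite /subgauss_cst; apply: mulr_gt0; first by rewrite divr_gt0// exprn_gt0.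
  by rewrite exprn_gt0// addr_gt0// divr_gt0.
pose s := Num.sqrt (8 * subgauss_cst * V)^-1.
have sV0 : 0 < 8 * subgauss_cst * V by apply: mulr_gt0 => //; apply: mulr_gt0.
have s2 : s ^+ 2 = (8 * subgauss_cst * V)^-1 by rewrite sqr_sqrtr// invr_ge0 ltW.
have hc (c : C) : expect u (fun eta => f eta * \sum_(y | col y == c) (s * window_sum y eta) ^+ 2)
    <= H + 36 * (\sum_(y | col y == c) 1).
  apply: (expect_le_entropy eps_gt0 u_eps f_ge0 f_density).
  apply: expect_exp_window_sqr; rewrite s2 le_eqVlt; apply/orP; left; apply/eqP.
  by field; rewrite !gt_eqF.
have s20 : 0 < s ^+ 2 by rewrite s2 invr_gt0.
rewrite -(ler_pM2l s20).
rewrite mulrA s2 mulVf ?gt_eqF// mul1r -s2 -expectZ.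
have -> : expect u (fun eta => s ^+ 2 * (f eta * \sum_y window_sum y eta ^+ 2)) =
    \sum_c expect u (fun eta => f eta * \sum_(y | col y == c) (s * window_sum y eta) ^+ 2).
  rewrite -expect_sum; apply: eq_expect => eta.
  rewrite -mulr_sumr mulrCA; congr (_ * _); rewrite mulr_sumr.
  rewrite (partition_big col xpredT)//=; apply: eq_bigr => c _.
  by apply: eq_bigr => y _; rewrite exprMn.
apply: le_trans (ler_sum _ (fun c _ => hc c)) _.
rewrite big_split /=; apply: lerD; first by rewrite sumr_const mulr_natl.
rewrite -mulr_sumr ler_wpM2l//.
by rewrite -(@partition_big _ _ _ _ _ _ xpredT col xpredT (fun=> 1))//= sumr_const.
Qed.

End Quadratic.

(** * Integration by parts along a bond *)

Section Exchange.
Variables (R : realType) (d N : nat) (u : torus d N -> R).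
Variable eps : R.
Hypothesis eps_gt0 : 0 < eps.
Hypothesis u_eps : forall x, eps <= u x <= 1 - eps.
Implicit Types (eta : config d N) (x y z : torus d N).

Lemma exchange_id x y eta : eta x = eta y -> exchange x y eta = eta.
Proof.
by move=> E; apply/ffunP => z; rewrite ffunE; case: eqP => [->//|_]; case: eqP => [->|].
Qed.

Lemma exchange_flip x y eta : x != y -> eta x != eta y ->
  exchange x y eta = flip x (flip y eta).
Proof.
move=> xy E; apply/ffunP => z; rewrite !ffunE.
have [->|zx] := eqVneq z x; first by rewrite (negbTE xy); case: (eta x) (eta y) E => [] [].
by have [->|//] := eqVneq z y; case: (eta x) (eta y) E => [] [].
Qed.

Lemma exchangeK x y : involutive (@exchange d N x y).
Proof.
move=> eta; apply/ffunP => z; rewrite !ffunE eqxx.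
have [->|zx] := eqVneq z x; last by have [->|//] := eqVneq z y; rewrite eqxx.
by have [->|//] := eqVneq y x; rewrite ?eqxx.
Qed.

Lemma sum_exchange x y (F : config d N -> R) :
  \sum_eta F (exchange x y eta) = \sum_eta F eta.
Proof. by rewrite [RHS](reindex_inj (inv_inj (exchangeK x y))). Qed.

(* normalized so that [current * product_measure] is exactly antisymmetric under
   the exchange of [x] and [y], although [u x <> u y] *)
Definition current x y eta : R :=
  omega u y eta - omega u x eta + (u y - u x) * omega u x eta * omega u y eta.

(** The density of the exchanged measure is affine in the current; this is why the adjoint of the
    exclusion dynamics, applied to 1, is a polynomial in the [omega]'s. *)
Lemma product_measure_exchange x y eta : x != y ->
  product_measure u (exchange x y eta) =
  product_measure u eta * (1 - (u y - u x) * current x y eta).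
Proof.
move=> xy.
have /andP[x1 x2] := u_eps x; have /andP[y1 y2] := u_eps y; have e0 := eps_gt0.
have ux0 : u x != 0 by rewrite gt_eqF//; lra.
have ux1 : 1 - u x != 0 by rewrite gt_eqF//; lra.
have uy0 : u y != 0 by rewrite gt_eqF//; lra.
have uy1 : 1 - u y != 0 by rewrite gt_eqF//; lra.
have [E|E] := eqVneq (eta x) (eta y).
  rewrite exchange_id// /current /omega E; case: (eta y); field; rewrite ?ux0 ?uy0 ?ux1 ?uy1//.
rewrite exchange_flip// /current /omega.
have h1 := product_measure_flip u x (flip y eta).
have h2 := product_measure_flip u y eta.
rewrite (flip_neq _ xy) in h1.
move: h1 h2 E; case: (eta x) (eta y) => [] [] // h1 h2 _.
  have -> : product_measure u (flip x (flip y eta)) =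
     product_measure u eta * u y / (1 - u y) * (1 - u x) / u x.
    by rewrite -h2 mulfK// -h1 mulfK.
  by field; rewrite ux0 uy1.
have -> : product_measure u (flip x (flip y eta)) =
   product_measure u eta * (1 - u y) / (u y) * (u x) / (1 - u x).
  by rewrite -h2 mulfK// -h1 mulfK.
by field; rewrite ux1 uy0.
Qed.

Lemma current_antisym x y eta : x != y ->
  current x y (exchange x y eta) * product_measure u (exchange x y eta) =
  - (current x y eta * product_measure u eta).
Proof.
move=> xy; rewrite product_measure_exchange//.
have /andP[x1 x2] := u_eps x; have /andP[y1 y2] := u_eps y; have e0 := eps_gt0.
have ux0 : u x != 0 by rewrite gt_eqF//; lra.
have ux1 : 1 - u x != 0 by rewrite gt_eqF//; lra.
have uy0 : u y != 0 by rewrite gt_eqF//; lra.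
have uy1 : 1 - u y != 0 by rewrite gt_eqF//; lra.
rewrite /current /omega !ffunE eqxx [y == x]eq_sym (negbTE xy) eqxx.
by case: (eta x) (eta y) => [] []; field; rewrite ?ux0 ?uy0 ?ux1 ?uy1.
Qed.

Lemma current_le x y eta : `|current x y eta| <= 3 / eps ^+ 2.
Proof.
have /andP[x1 x2] := u_eps x; have /andP[y1 y2] := u_eps y; have e0 := eps_gt0.
have i0 : 0 < eps^-1 by rewrite invr_gt0.
have i1 : 1 <= eps^-1 by rewrite invf_ge1//; lra.
have ox := omega_bound eps_gt0 u_eps x eta; have oy := omega_bound eps_gt0 u_eps y eta.
have h : `|current x y eta| <= eps^-1 + eps^-1 + 1 * eps^-1 * eps^-1.
  apply: le_trans (ler_normD _ _) _; apply: lerD.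
    by apply: le_trans (ler_normB _ _) _; apply: lerD.
  rewrite !normrM; apply: ler_pM => //.
  by apply: ler_pM => //; rewrite ler_norml; lra.
by apply: le_trans h _; rewrite -exprVn; nra.
Qed.

Variable f : config d N -> R.
Hypothesis f_ge0 : forall eta, 0 <= f eta.

Definition dirichlet_bond x y : R := expect u (fun eta =>
  (Num.sqrt (f (exchange x y eta)) - Num.sqrt (f eta)) ^+ 2).

Lemma dirichlet_bond_ge0 x y : 0 <= dirichlet_bond x y.
Proof. by apply: (expect_ge0 eps_gt0 u_eps) => eta; exact: sqr_ge0. Qed.

(** Antisymmetry turns the left side into half the expectation of [(f - f o T)] times the current
    and [h], where [T] is the exchange. The difference factors through square roots, which brings in
    the Dirichlet form. *)
Lemma expect_current x y (h : config d N -> R) (b : R) : x != y -> 0 < b ->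
    (forall eta, h (exchange x y eta) = h eta) ->
  expect u (fun eta => f eta * (current x y eta * h eta)) <=
  b / 4 * dirichlet_bond x y +
  b^-1 * (3 / eps ^+ 2) ^+ 2 * expect u (fun eta => f eta * h eta ^+ 2).
Proof.
move=> xy b0 hT; set P := 3 / eps ^+ 2.
pose T := exchange x y; set nu := product_measure u.
have P0 : 0 <= P by rewrite /P divr_ge0// exprn_ge0// ltW.
have nu0 eta : 0 <= nu eta by rewrite ltW// (product_measure_gt0 eps_gt0 u_eps).
have E1 : expect u (fun eta => f eta * (current x y eta * h eta)) =
   2^-1 * \sum_eta (f eta - f (T eta)) * (current x y eta * h eta) * nu eta.
  have : \sum_eta f eta * (current x y eta * h eta) * nu eta =
      - \sum_eta f (T eta) * (current x y eta * h eta) * nu eta.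
    rewrite -(sum_exchange x y) -sumrN; apply: eq_bigr => eta _.
    rewrite hT -/(T eta) /nu /T.
    have := current_antisym eta xy; set a := current _ _ (exchange _ _ _).
    set b1 := product_measure u (exchange _ _ _) => E.
    transitivity (f (exchange x y eta) * h eta * (a * b1)); first by ring.
    by rewrite E; ring.
  rewrite [X in _ = 2^-1 * X](eq_bigr (fun eta => f eta * (current x y eta * h eta) * nu eta
    - f (T eta) * (current x y eta * h eta) * nu eta)); last by move=> eta _; ring.
  by rewrite sumrB /expect -/nu; set s1 := \sum_i _; set s2 := \sum_i _; lra.
pose S1 := \sum_eta f eta * (current x y eta * h eta) ^+ 2 * nu eta.
pose S2 := \sum_eta f (T eta) * (current x y eta * h eta) ^+ 2 * nu eta.
have pt eta : (f eta - f (T eta)) * (current x y eta * h eta) <=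
    b / 2 * (Num.sqrt (f (T eta)) - Num.sqrt (f eta)) ^+ 2 +
    b^-1 * (f eta * (current x y eta * h eta) ^+ 2) +
    b^-1 * (f (T eta) * (current x y eta * h eta) ^+ 2).
  set c := current x y eta * h eta.
  have e1 := sqr_sqrtr (f_ge0 eta); have e2 := sqr_sqrtr (f_ge0 (T eta)).
  rewrite -{1 3}e1 -{1 3}e2; set p := Num.sqrt (f eta); set q := Num.sqrt (f (T eta)).
  have bi : b * b^-1 = 1 by rewrite divff// gt_eqF.
  have bi0 : 0 < b^-1 by rewrite invr_gt0.
  (* Young's inequality with weight [b], as a completed square; [h2] then replaces [(p + q)^2] by
     [2 p^2 + 2 q^2]. *)
  have h1 : 0 <= b / 2 * (q - p + b^-1 * c * (p + q)) ^+ 2.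
    by rewrite mulr_ge0 ?sqr_ge0// divr_ge0// ltW.
  have h2 : 0 <= b^-1 / 2 * (c ^+ 2 * (p - q) ^+ 2).
    by apply: mulr_ge0; [lra|rewrite mulr_ge0 ?sqr_ge0].
  have E : b / 2 * (q - p + b^-1 * c * (p + q)) ^+ 2 =
     b / 2 * (q - p) ^+ 2 + (b * b^-1) * ((q ^+ 2 - p ^+ 2) * c)
       + (b * b^-1) * (b^-1 / 2 * c ^+ 2 * (p + q) ^+ 2).
    set hf := 2^-1; have hf2 : 2 * hf = 1 by rewrite /hf divff.
    transitivity (b * hf * (q - p) ^+ 2 + (2 * hf) * (b * b^-1) * ((q ^+ 2 - p ^+ 2) * c)
       + (b * b^-1) * (b^-1 * hf * c ^+ 2 * (p + q) ^+ 2)); first by ring.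
    by rewrite hf2 mul1r.
  rewrite E bi !mul1r in h1; lra.
have hS1 : S1 <= P ^+ 2 * expect u (fun eta => f eta * h eta ^+ 2).
  rewrite -expectZ; apply: ler_sum => eta _; apply: ler_wpM2r => //.
  rewrite exprMn mulrCA; apply: ler_wpM2r; first by apply: mulr_ge0 => //; exact: sqr_ge0.
  rewrite -(real_normK (num_real (current _ _ _))).
  by rewrite lerXn2r ?nnegrE ?current_le.
(* The change of variables brings [f o T] back to [f]. One factor of the current is consumed by
   antisymmetry, the other is bounded. *)
have hS2 : S2 <= P ^+ 2 * expect u (fun eta => f eta * h eta ^+ 2).
  rewrite /S2 -(sum_exchange x y) -expectZ; apply: ler_sum => eta _.
  rewrite /T exchangeK hT.
  have := current_antisym eta xy; set a := current _ _ (exchange _ _ _).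
  set b1 := product_measure u (exchange _ _ _) => E.
  rewrite -[nu _]/b1.
  have -> : f eta * (a * h eta) ^+ 2 * b1 = (f eta * h eta ^+ 2 * a) * (a * b1) by ring.
  rewrite E -/(nu _).
  have -> : f eta * h eta ^+ 2 * a * - (current x y eta * nu eta) =
     (- (a * current x y eta)) * (f eta * h eta ^+ 2 * nu eta) by ring.
  rewrite -(mulrA (P ^+ 2)); apply: ler_wpM2r; first by do 2!apply: mulr_ge0 => //; exact: sqr_ge0.
  apply: le_trans (ler_norm _) _; rewrite normrN normrM expr2.
  by apply: ler_pM => //; exact: current_le.
have S12 : \sum_eta (f eta - f (T eta)) * (current x y eta * h eta) * nu eta <=
    b / 2 * dirichlet_bond x y + b^-1 * S1 + b^-1 * S2.
  rewrite -[b / 2 * _]expectZ /S1 /S2 !mulr_sumr -!big_split; apply: ler_sum => eta _ /=.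
  rewrite -/nu; have := ler_wpM2r (nu0 eta) (pt eta); rewrite !mulrDl.
  by move/le_trans; apply; rewrite -!mulrA.
rewrite E1.
have bi0 : 0 < b^-1 by rewrite invr_gt0.
have := ler_wpM2l (ltW bi0) hS1; have := ler_wpM2l (ltW bi0) hS2.
rewrite !mulrA; lra.
Qed.

End Exchange.

Section Transport.
Variables (R : realType) (d N : nat) (u : torus d N -> R).
Variable eps : R.
Hypothesis eps_gt0 : 0 < eps.
Hypothesis u_eps : forall x, eps <= u x <= 1 - eps.
Variable f : config d N -> R.
Hypothesis f_ge0 : forall eta, 0 <= f eta.
Hypothesis f_density : expect u f = 1.
Variables (j : 'I_d) (w : nat).
Hypothesis N_ge2 : (2 <= N)%N.
Hypothesis w_small : (w.*2 <= N)%N.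

Local Notation H := (entropy (product_measure u) f).
Local Notation e := (unitv N j).

Lemma addr_unitv_neq (x : torus d N) : x != x + e.
Proof.
apply/eqP => /(congr1 (fun y : torus d N => y - x)); rewrite subrr addrAC subrr add0r.
move/(congr1 (fun y : torus d N => y j : nat)); rewrite unitv_same//.
by rewrite ffunE.
Qed.

Lemma ignores_exchange (F : config d N -> R) (x y : torus d N) eta :
  ignores F x -> ignores F y -> F (exchange x y eta) = F eta.
Proof.
move=> Fx Fy; have [<-|xy] := eqVneq x y; first by rewrite exchange_id.
have [E|E] := eqVneq (eta x) (eta y); first by rewrite exchange_id.
by rewrite exchange_flip// Fx Fy.
Qed.

(* [omega_y - omega_(y+e)] is minus a current, absorbed by the Dirichlet form,
   plus [(u_(y+e) - u_y) omega_y omega_(y+e)], to which [expect_cyclic] applies *)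
Lemma expect_transport (h : torus d N -> config d N -> R) (K L : R) :
    0 < K ->
    (forall x : torus d N, (u (x + e) - u x) ^+ 2 <= L * (K / N%:R) ^+ 2) ->
    (forall y, ignores (h y) y) -> (forall y : torus d N, ignores (h y) (y + e)) ->
    cyclic_past j w (fun z eta => omega u (z - e) eta * h (z - e) eta) ->
  expect u (fun eta => f eta *
    (K * \sum_(y : torus d N) (omega u y eta - omega u (y + e) eta) * h y eta)) <=
  N%:R ^+ 2 / 2 * (\sum_(y : torus d N) dirichlet_bond u f y (y + e)) + K ^+ 2 * H +
  (9 / 2 + 4 * L) / eps ^+ 4 * (K / N%:R) ^+ 2 *
    expect u (fun eta => f eta * \sum_y h y eta ^+ 2).
Proof.
move=> K0 uL hy hye hZ.
have N0 : 0 < N%:R :> R by rewrite ltr0n; lia.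
set Q := expect u (fun eta => f eta * \sum_y h y eta ^+ 2).
have Q0 : 0 <= Q.
  apply: (expect_ge0 eps_gt0 u_eps) => eta; rewrite mulr_ge0// sumr_ge0// => y _.
  exact: sqr_ge0.
pose Z (z : torus d N) eta := K * (u z - u (z - e)) * (omega u (z - e) eta * h (z - e) eta).
have ZP : cyclic_past j w Z.
  by move=> z z' zz' eta; rewrite /Z; congr (_ * _); exact: (hZ z z' zz').
have hb := expect_cyclic eps_gt0 u_eps f_ge0 f_density (ltnW N_ge2) w_small
   (_ : 0 < (K ^+ 2)^-1) ZP.
have {}hb := hb ltac:(by rewrite invr_gt0 exprn_gt0).
rewrite invrK in hb.
have hZ2 : expect u (fun eta => f eta * \sum_z Z z eta ^+ 2) <=
    K ^+ 2 * (L * (K / N%:R) ^+ 2) / eps ^+ 2 * Q.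
  rewrite -expectZ; apply: (ler_expect eps_gt0 u_eps) => eta.
  rewrite mulrCA; apply: ler_wpM2l => //.
  rewrite (reindex_inj (addIr e)) mulr_sumr; apply: ler_sum => y _.
  rewrite /Z addrK (_ : _ ^+ 2 = K ^+ 2 * ((u (y + e) - u y) ^+ 2 * omega u y eta ^+ 2)
    * h y eta ^+ 2); last by ring.
  apply: ler_wpM2r; first exact: sqr_ge0.
  rewrite -[in leRHS]mulrA; apply: ler_wpM2l; first exact: sqr_ge0.
  apply: ler_pM => //; try exact: sqr_ge0.
  rewrite -(real_normK (num_real (omega _ _ _))) -exprVn.
  by rewrite lerXn2r ?nnegrE ?invr_ge0 ?(ltW eps_gt0)// (omega_bound eps_gt0 u_eps).
(* This gives [K b / 4 = N^2 / 2]: half of the available Dirichlet form, because the transport is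
   done twice, along [e1] and along [e2]. *)
pose b := 2 * N%:R ^+ 2 / K.
have b0 : 0 < b by rewrite /b divr_gt0// mulr_gt0// exprn_gt0.
have ha (y : torus d N) := @expect_current R d N u eps eps_gt0 u_eps f f_ge0 y (y + e)
   (fun eta => - h y eta) b (addr_unitv_neq y) b0.
have {}ha (y : torus d N) : expect u (fun eta => f eta * (current u y (y + e) eta * - h y eta)) <=
   b / 4 * dirichlet_bond u f y (y + e) +
    b^-1 * (3 / eps ^+ 2) ^+ 2 * expect u (fun eta => f eta * h y eta ^+ 2).
  have := ha y (fun eta => congr1 (@GRing.opp R) (ignores_exchange eta (hy y) (@hye y))).
  rewrite (@eq_expect _ _ _ u (fun eta => f eta * (- h y eta) ^+ 2)
    (fun eta => f eta * h y eta ^+ 2)) // => eta.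
  by rewrite sqrrN.
have E : expect u (fun eta => f eta * (K * \sum_(y : torus d N)
     (omega u y eta - omega u (y + e) eta) * h y eta)) =
   K * (\sum_(y : torus d N) expect u (fun eta => f eta * (current u y (y + e) eta * - h y eta)))
   + expect u (fun eta => f eta * \sum_z omega u z eta * Z z eta).
  rewrite -expect_sum -expectZ -expectD; apply: eq_expect => eta.
  rewrite [X in _ = _ + _ * X](reindex_inj (addIr e)) /=.
  rewrite !mulr_sumr -big_split; apply: eq_bigr => y _ /=.
  by rewrite /Z /current addrK; ring.
rewrite E.
have {}ha := @ler_sum R _ (index_enum (torus d N)) xpredT _ _ (fun y _ => ha y).
have EQ : \sum_y expect u (fun eta => f eta * h y eta ^+ 2) = Q.
  by rewrite -expect_sum; apply: eq_expect => eta; rewrite mulr_sumr.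
rewrite big_split /= -!mulr_sumr EQ in ha.
have {}ha := ler_wpM2l (ltW K0) ha.
have {}hb := le_trans hb (lerD (lexx _) (ler_wpM2l _ hZ2)).
have {}hb := hb ltac:(by rewrite mulr_ge0 ?invr_ge0 ?divr_ge0 ?sqr_ge0).
apply: le_trans (lerD ha hb) _; set DD := \sum_y _.
rewrite le_eqVlt; apply/orP; left; apply/eqP.
by rewrite /b; field; rewrite !gt_eqF.
Qed.

End Transport.

(** * Transport onto a box *)

Section Coloring.

(** The residue modulo [w] would fail across the seam of the cycle when [w] does not divide [n]; the
    last [n mod w] points therefore receive colours of their own, at the price of fewer than [2 w]
    colours in all. *)
Definition cyclic_color (w n i : nat) : nat :=
  if (i < n %/ w * w)%N then (i %% w)%N else (w + (i - n %/ w * w))%N.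

Lemma cyclic_color_lt w n i : (0 < w)%N -> (i < n)%N -> (cyclic_color w n i < w.*2)%N.
Proof.
move=> w0 ni; rewrite /cyclic_color; have := ltn_pmod i w0; have := ltn_pmod n w0.
by have := divn_eq n w; case: ifP; lia.
Qed.

Lemma cyclic_color_inj w n i k k' : (w <= n)%N -> (k < w)%N -> (k' < w)%N ->
  cyclic_color w n ((i + k) %% n) = cyclic_color w n ((i + k') %% n) -> k = k'.
Proof.
wlog kk' : k k' / (k <= k')%N => [th|].
  by case: (leqP k k') => [|/ltnW] h; [|move=> *; apply/esym]; apply: th.
move=> wn kw k'w.
have n0 : (0 < n)%N by apply: leq_trans wn; apply: leq_ltn_trans kw.
have w0 : (0 < w)%N by apply: leq_ltn_trans kw.
have bn := ltn_pmod (i + k') n0; have an := ltn_pmod (i + k) n0.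
have : ((i + k') %% n = ((i + k) %% n + (k' - k)) %% n)%N.
  by rewrite modnDml -addnA subnKC.
move: an bn; set a := ((i + k) %% n)%N; set b := ((i + k') %% n)%N => an bn E.
have dw : (k' - k < w)%N by apply: leq_ltn_trans k'w; exact: leq_subr.
have ltmod c t : (c %% w = w + t)%N -> False.
  by move=> h; have := ltn_pmod c w0; rewrite h ltnNge leq_addr.
have dvd0 : (w %| k' - k)%N -> k = k'.
  case: (posnP (k' - k)) => [/eqP|p0 /(dvdn_leq p0)]; last by rewrite leqNgt dw.
  by rewrite subn_eq0 => h _; apply/eqP; rewrite eqn_leq kk'.
rewrite /cyclic_color; case: ifP => h1; case: ifP => h2; last 1 first.
- move/addnI => Em; have {}Em : a = b.
    by move: h1 h2 Em; move: (n %/ w * w)%N => q; clear; lia.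
  have [lt|ge] := ltnP (a + (k' - k)) n; last first.
    have := E; rewrite -(subnK ge) modnDr modn_small; last by move: bn Em ge dw wn; clear; lia.
    by move: Em ge dw wn; clear; lia.
  by apply: dvd0; move: E; rewrite modn_small// Em => /eqP; rewrite -[X in X == _]addn0 eqn_add2l => /eqP <-.
- move=> Em.
  have [lt|ge] := ltnP (a + (k' - k)) n.
    apply: dvd0; rewrite modn_small// in E.
    by have := Em; rewrite E => /eqP; rewrite eq_sym eqn_mod_dvd ?leq_addr// addKn.
  have {}E : b = (a + (k' - k) - n)%N.
    rewrite E -[in LHS](subnK ge) modnDr modn_small//.
    by move: an dw wn; clear; lia.
  have ba : (b <= a)%N by move: E dw wn; clear; lia.
  have : (w %| a - b)%N by rewrite -eqn_mod_dvd// Em.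
  case/dvdnP => t ht.
  (* Here the shift wraps around, so [a - b = n - (k' - k) > n - w]; but a multiple of [w] below
     [n %/ w * w] is at most [n - w]. *)
  have tq : (t < n %/ w)%N.
    by rewrite -(ltn_pmul2r w0) -ht; apply: leq_ltn_trans h1; exact: leq_subr.
  have : (t.+1 * w <= n %/ w * w)%N by rewrite leq_mul2r tq orbT.
  have := leq_trunc_div n w.
  rewrite mulSn; move: ht E ge dw; clear; move: (t * w)%N (n %/ w * w)%N => tw qw; lia.
- by move/ltmod.
- by move/esym/ltmod.
Qed.

End Coloring.

(** * Transport of a point mass along a line *)

Section Telescoping.
Variables (R : realType) (d N : nat).

(** Equal to [(m - 1 - i) / m] for [i < m], the mass still to be moved beyond step [i]. In
    particular it vanishes for [m = 1]. *)
Definition ramp (m i : nat) : R := m%:R^-1 * \sum_(k < m) (i < k)%N%:R.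

Lemma ramp_ge0 m i : 0 <= ramp m i.
Proof. by rewrite mulr_ge0 ?invr_ge0// sumr_ge0. Qed.

Lemma ramp_le1 m i : ramp m i <= 1.
Proof.
rewrite /ramp; case: m => [|m]; first by rewrite big_ord0 mulr0.
rewrite mulrC ler_pdivrMr ?ltr0n// mul1r.
rewrite -[leRHS]mulr1 mulr_natl -[in leRHS](card_ord m.+1) -sumr_const.
by apply: ler_sum => k _; case: (i < k)%N.
Qed.

(* the flow [ramp m] along [e] transports a unit mass at the origin onto the
   uniform measure on [0, e, ..., (m - 1) e] *)
Lemma sum_telescope (m : nat) (e : torus d N) (G W : torus d N -> R) : (0 < m)%N ->
  \sum_z W z * G z =
  \sum_(z : torus d N) W z * (m%:R^-1 * \sum_(k < m) G (z - e *+ k)) +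
  \sum_(y : torus d N) (W y - W (y + e)) * \sum_(i < m) ramp m i * G (y - e *+ i).
Proof.
move=> m0.
(* Moving [G] by [k] steps costs [k] gradients of [W]; the statement is the average of this identity
   over [k < m]. *)
have step k : \sum_z W z * G z = \sum_(z : torus d N) W z * G (z - e *+ k) +
    \sum_(i < k) \sum_(y : torus d N) (W y - W (y + e)) * G (y - e *+ i).
  elim: k => [|k IH].
    by rewrite big_ord0 addr0; apply: eq_bigr => z _; rewrite subr0.
  rewrite IH big_ord_recr /= [RHS]addrA [RHS]addrAC; congr (_ + _).
  rewrite [X in _ = X + _](reindex_inj (addIr e)) /=.
  rewrite -big_split; apply: eq_bigr => y _ /=.
  have -> : y + e - e *+ k.+1 = y - e *+ k.
    by rewrite mulrSr [_ *+ k + e]addrC opprD addrA addrK.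
  by ring.
have mR : m%:R != 0 :> R by rewrite pnatr_eq0 -lt0n.
transitivity (m%:R^-1 * \sum_(k < m) \sum_z W z * G z).
  by rewrite sumr_const card_ord -[X in _ = _ * X]mulr_natl mulKf.
rewrite (eq_bigr _ (fun (k : 'I_m) _ => step k)) big_split mulrDr; congr (_ + _).
  rewrite exchange_big /= mulr_sumr; apply: eq_bigr => z _.
  by rewrite mulrCA; congr (_ * _); rewrite mulr_sumr.
transitivity (m%:R^-1 * \sum_(k < m) \sum_(i < m) (i < k)%N%:R *
    \sum_(y : torus d N) (W y - W (y + e)) * G (y - e *+ i)).
  congr (_ * _); apply: eq_bigr => k _.
  rewrite (big_ord_widen m (fun i => \sum_(y : torus d N) (W y - W (y + e)) * G (y - e *+ i)))//.
    rewrite big_mkcond; apply: eq_bigr => i _.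
    by case: ifP => _; rewrite ?mul1r ?mul0r.
  exact: ltnW.
rewrite exchange_big mulr_sumr.
transitivity (\sum_(i < m) \sum_(y : torus d N) (W y - W (y + e)) * (ramp m i * G (y - e *+ i))).
  apply: eq_bigr => i _; rewrite -mulr_suml mulrA -/(ramp m i) mulr_sumr.
  by apply: eq_bigr => y _; rewrite mulrCA.
by rewrite exchange_big; apply: eq_bigr => y _; rewrite mulr_sumr.
Qed.

End Telescoping.

(** * Estimate of the quadratic and cubic fluctuations *)

Section Fluctuation.
Variables (R : realType) (d N : nat) (u : torus d N -> R).
Variable eps : R.
Hypothesis eps_gt0 : 0 < eps.
Hypothesis u_eps : forall x, eps <= u x <= 1 - eps.
Variable f : config d N -> R.
Hypothesis f_ge0 : forall eta, 0 <= f eta.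
Hypothesis f_density : expect u f = 1.
Variables (i1 j2 : 'I_d) (m1 m2 : nat).
Hypothesis m1_gt0 : (0 < m1)%N.
Hypothesis m2_gt0 : (0 < m2)%N.
Hypothesis m2_le : (m2 <= m1)%N.
Hypothesis N_large : ((m1.+2).*2 <= N)%N.
Hypothesis transverse : (i1 != j2) || (m2 == 1%N).
Hypothesis cost : (m1 * (m1 * m2) <= N ^ 2)%N.
Variables (A B : torus d N -> R) (D : R).
Hypothesis D_gt0 : 0 < D.
Hypothesis A_le : forall z, `|A z| <= D.
Hypothesis B_le : forall z, `|B z| <= D.
Variables (K L : R).
Hypothesis K_gt0 : 0 < K.
Hypothesis u_smooth : forall j (x : torus d N),
  (u (x + unitv N j) - u x) ^+ 2 <= L * (K / N%:R) ^+ 2.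

Local Notation H := (entropy (product_measure u) f).
Local Notation e1 := (unitv N i1).
Local Notation e2 := (unitv N j2).
Local Notation S := (subgauss_cst eps D).
Local Notation G := (local_fluct u i1 A B).

Let N_ge2 : (2 <= N)%N. Proof. by move: N_large; lia. Qed.
Let NE : N.-1.+1 = N. Proof. by move: N_large; lia. Qed.

(** In dimension one there is no second direction: [transverse] then admits [j2 = i1] with [m2 = 1],
    and the [e2] part of [offset] is zero. *)
Definition window := ('I_m1 * 'I_m2)%type.
Definition offset (k : window) : torus d N := e1 *+ k.1 + e2 *+ k.2.
Definition color (x : torus d N) : 'I_(m1.*2.-1.+1) * 'I_(m2.*2.-1.+1) :=
  (inord (cyclic_color m1 N (x i1)), inord (cyclic_color m2 N (x j2))).

Lemma unitv_mulrn (j : 'I_d) k i : ((unitv N j *+ k)%R i : nat) = if i == j then (k %% N)%N else 0%N.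
Proof.
rewrite ffunMnE ffunE Zp_mulrn /= NE; case: eqP => _; last by rewrite mod0n mul0n mod0n.
by rewrite modnMml mul1n.
Qed.

Lemma coord_add (x y : torus d N) (i : 'I_d) : ((x + y)%R i : nat) = ((x i + y i) %% N)%N.
Proof. by rewrite ffunE; exact: congr1 NE. Qed.

Lemma offset_i1 (x : torus d N) k : ((x + offset k)%R i1 : nat) = ((x i1 + k.1) %% N)%N.
Proof.
rewrite /offset !coord_add !unitv_mulrn eqxx.
have -> : (if i1 == j2 then (k.2 %% N)%N else 0%N) = 0%N.
  move: transverse; case: eqP => //= _ /eqP m21; have := ltn_ord k.2.
  by rewrite [X in (_ < X)%N]m21 ltnS leqn0 => /eqP ->; rewrite mod0n.
by rewrite addn0 modnDmr modnDmr.
Qed.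

Lemma color_inj (x : torus d N) k k' :
  color (x + offset k) = color (x + offset k') -> k = k'.
Proof.
have bd (y : torus d N) i : (y i < N)%N by rewrite -[in ltnRHS]NE.
have hc m (y : torus d N) i : (0 < m)%N -> (cyclic_color m N (y i) < m.*2.-1.+1)%N.
  move=> m0; apply: leq_trans (cyclic_color_lt m0 (bd y i)) _; lia.
case=> /(congr1 val) /=; rewrite !inordK ?hc// !offset_i1 => h1.
move=> /(congr1 val) /=; rewrite !inordK ?hc// => h2.
have k1 : k.1 = k'.1.
  by apply: val_inj; apply: (cyclic_color_inj _ _ _ h1); rewrite ?ltn_ord//; move: N_large; lia.
have k2 : k.2 = k'.2.
  move: transverse; case: eqP => /= [_ /eqP m21|/eqP ne _].
    apply: val_inj => /=; have := ltn_ord k.2; have := ltn_ord k'.2; lia.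
  have oj kk : ((x + offset kk)%R j2 : nat) = ((x j2 + kk.2) %% N)%N.
    rewrite /offset !coord_add !unitv_mulrn eqxx [j2 == i1]eq_sym (negbTE ne) add0n modnDmr.
    by rewrite modnDmr.
  rewrite !oj in h2.
  by apply: val_inj; apply: (cyclic_color_inj _ _ _ h2); rewrite ?ltn_ord//; move: N_large m2_le; lia.
by case: k k' k1 k2 {h1 h2} => [a b] [a' b'] /= -> ->.
Qed.

(** There are [4 * (m1 * m2)] colours; factoring this number out leaves [36 / 4 = 9] in front of the
    number of boxes. *)
Lemma expect_window (phi : window -> R) (V : R) : 0 < V ->
    \sum_k phi k ^+ 2 <= V ->
  expect u (fun eta => f eta * \sum_y window_sum u i1 A B offset phi y eta ^+ 2) <=
  32 * S * V * (m1 * m2)%:R * (H + 9 * (#|{: torus d N}|%:R / (m1 * m2)%:R)).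
Proof.
move=> V0 phiV.
have := expect_window_sqr eps_gt0 u_eps f_ge0 f_density i1 N_ge2 A_le B_le V0 phiV color_inj D_gt0.
move/le_trans; apply.
rewrite card_prod !card_ord.
have -> : (m1.*2.-1.+1 * m2.*2.-1.+1 = 4 * (m1 * m2))%N.
  have -> : (m1.*2.-1.+1 = m1 * 2)%N by lia.
  have -> : (m2.*2.-1.+1 = m2 * 2)%N by lia.
  by rewrite mulnACA mulnC.
rewrite (natrM _ 4) le_eqVlt; apply/orP; left; apply/eqP.
move: (m1_gt0) => m10; have M0 : (m1 * m2)%:R != 0 :> R by rewrite pnatr_eq0 -lt0n muln_gt0 m10.
by move: M0; move: (m1 * m2)%:R => M M0; field.
Qed.

Lemma window_sum_ignores (phi : window -> R) (y z' : torus d N) :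
    (forall k, phi k != 0 -> z' != y - offset k - e1 /\ z' != y - offset k - e1 - e1) ->
  ignores (window_sum u i1 A B offset phi y) z'.
Proof.
move=> hz eta; apply: eq_bigr => k _; have [->|/hz[z1 z2]] := eqVneq (phi k) 0.
  by rewrite !mul0r.
by rewrite /local_fluct /omega !flip_neq// eq_sym.
Qed.

Lemma coord0 (j : 'I_d) : ((0%R : torus d N) j : nat) = 0%N.
Proof. by rewrite ffunE. Qed.

Lemma coord_unitv_add (j : 'I_d) a (x : torus d N) :
  ((x + unitv N j *+ a)%R j : nat) = ((x j + a) %% N)%N.
Proof. by rewrite coord_add unitv_mulrn eqxx modnDmr. Qed.

Lemma window_ignores_i1 phi (y z' : torus d N) :
  ~~ (0 < ((y - z')%R i1 : nat) <= m1.+1)%N ->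
  ignores (window_sum u i1 A B offset phi y) z'.
Proof.
move=> yz; apply: window_sum_ignores => k _.
have hk := ltn_ord k.1.
have main a : (0 < a <= 2)%N -> z' != y - offset k - e1 *+ a.
  move=> a12; apply/eqP => E; move: yz.
  have -> : y - z' = (0 + e1 *+ a) + offset k.
    by rewrite E -[y - _ - _]addrA -opprD subKr add0r addrC.
  rewrite offset_i1 coord_unitv_add coord0.
  rewrite add0n modnDml modn_small; last by move: N_large; lia.
  by move: a12; lia.
by split; [exact: (main 1%N)|rewrite -addrA -opprD; exact: (main 2)].
Qed.

Lemma window_ignores_j2 phi (y z' : torus d N) : i1 != j2 ->
  ~~ (((y - z')%R j2 : nat) < m2)%N ->
  ignores (window_sum u i1 A B offset phi y) z'.
Proof.
move=> ne yz; apply: window_sum_ignores => k _.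
have hk := ltn_ord k.2.
have main a : z' != y - offset k - e1 *+ a.
  apply/eqP => E; move: yz.
  have -> : y - z' = (e1 *+ k.1 + e1 *+ a) + e2 *+ k.2.
    by rewrite E -[y - _ - _]addrA -opprD subKr /offset addrAC.
  rewrite coord_unitv_add coord_add !unitv_mulrn [j2 == i1]eq_sym (negbTE ne).
  rewrite mod0n add0n modn_small; last by move: N_large m2_le; lia.
  by rewrite hk.
by split; [exact: (main 1%N)|rewrite -addrA -opprD; exact: (main 2)].
Qed.

Lemma sub_pred_coord (j : 'I_d) (z z' : torus d N) :
  ((z - z')%R j : nat) = (((z - unitv N j - z')%R j).+1 %% N)%N.
Proof.
have -> : z - z' = (z - unitv N j - z') + unitv N j *+ 1.
  by rewrite mulr1n [z - _ - _]addrAC subrK.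
by rewrite coord_unitv_add addn1.
Qed.

Lemma coord_lt (j : 'I_d) (z : torus d N) : (z j < N)%N.
Proof. by rewrite -[in ltnRHS]NE. Qed.

(** A window reaches 1 to [m1 + 1] steps behind [y]: [k.1 < m1], plus the one or two steps inside
    [local_fluct]. The passage from [y = z - e1] to [z] adds one, whence [m1.+2]. *)
Lemma window_cyclic_past_i1 phi :
  cyclic_past i1 m1.+2 (fun z eta => omega u (z - e1) eta *
    window_sum u i1 A B offset phi (z - e1) eta).
Proof.
move=> z z'; rewrite sub_pred_coord => hz eta.
have [E|ne] := eqVneq (z - e1) z'.
  by move: hz; rewrite E subrr coord0 modn_small.
congr (_ * _); first by rewrite /omega flip_neq.
apply: window_ignores_i1; apply/negP => /andP[h0 h1].
by move: hz; rewrite modn_small; move: N_large; lia.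
Qed.

(** Along [j2] a window may share the coordinate of [y]; the shift by [e2] puts it strictly in the
    past, and [m2 <= m1] permits the same width. *)
Lemma window_cyclic_past_j2 phi : i1 != j2 ->
  cyclic_past j2 m1.+2 (fun z eta => omega u (z - e2) eta *
    window_sum u i1 A B offset phi (z - e2) eta).
Proof.
move=> ij z z'; rewrite sub_pred_coord => hz eta.
have [E|ne] := eqVneq (z - e2) z'.
  by move: hz; rewrite E subrr coord0 modn_small.
congr (_ * _); first by rewrite /omega flip_neq.
apply: window_ignores_j2 => //; apply/negP => h1.
by move: hz; rewrite modn_small; move: N_large m2_le; lia.
Qed.

(** [flow1] spreads a unit mass over a segment along [e1]; [flow2] spreads that segment, of weight
    [1 / m1] per site, along [e2]. Their squared norms are at most [m1] and [m2 / m1], and that of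
    [average] is [1 / (m1 * m2)]. *)
Definition flow1 (k : window) : R := ramp R m1 k.1 * ((k.2 : nat) == 0%N)%:R.
Definition flow2 (k : window) : R := ramp R m2 k.2 * m1%:R^-1.
Definition average (k : window) : R := (m1 * m2)%:R^-1.

Lemma fluct_decomposition eta :
  \sum_z omega u z eta * G z eta =
  \sum_(y : torus d N) (omega u y eta - omega u (y + e1) eta) *
    window_sum u i1 A B offset flow1 y eta +
  \sum_(y : torus d N) (omega u y eta - omega u (y + e2) eta) *
    window_sum u i1 A B offset flow2 y eta +
  \sum_y omega u y eta * window_sum u i1 A B offset average y eta.
Proof.
rewrite (sum_telescope e1 (fun z => G z eta) (fun z => omega u z eta) m1_gt0).
rewrite (sum_telescope e2 (fun z => m1%:R^-1 * \sum_(k < m1) G (z - e1 *+ k) eta)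
  (fun z => omega u z eta) m2_gt0).
rewrite -[RHS]addrA [RHS]addrC [X in _ = X + _]addrC.
congr (_ + _ + _).
- apply: eq_bigr => y _; congr (_ * _).
  rewrite mulr_sumr (eq_bigr (fun k : 'I_m2 => \sum_(k' < m1)
     (m1 * m2)%:R^-1 * G (y - (e1 *+ k' + e2 *+ k)) eta)); last first.
    move=> k _; rewrite mulrA mulr_sumr; apply: eq_bigr => k' _.
    rewrite natrM invfM [in RHS](mulrC m1%:R^-1); congr (_ * G _ _).
    by rewrite opprD addrAC addrA.
  by rewrite exchange_big pair_bigA.
- apply: eq_bigr => y _; congr (_ * _); rewrite /window_sum /flow2.
  rewrite -(pair_bigA _ (fun (k1 : 'I_m1) (k2 : 'I_m2) =>
    ramp R m2 k2 * m1%:R^-1 * G (y - (e1 *+ k1 + e2 *+ k2)) eta)) /=.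
  rewrite exchange_big; apply: eq_bigr => k2 _.
  rewrite mulrA mulr_sumr; apply: eq_bigr => k1 _.
  by congr (_ * G _ _); rewrite opprD addrAC addrA.
- apply: eq_bigr => y _; congr (_ * _); rewrite /window_sum /flow1.
  rewrite -(pair_bigA _ (fun (k1 : 'I_m1) (k2 : 'I_m2) =>
    ramp R m1 k1 * (k2 == 0%N :> nat)%:R * G (y - (e1 *+ k1 + e2 *+ k2)) eta)) /=.
  apply: eq_bigr => k _; rewrite (bigD1 (Ordinal m2_gt0))//= big1 ?addr0.
    by rewrite mulr1.
  move=> k2 k20; suff -> : (k2 == 0%N :> nat) = false by rewrite mulr0 mul0r.
  by apply: contraNF k20 => /eqP E; apply/eqP; apply: val_inj.
Qed.

Local Notation density_gain := (H + 9 * (#|{: torus d N}|%:R / (m1 * m2)%:R)).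

(** The squared norm contributes [m1] and the colours [m1 * m2]; by [cost] their product is
    compensated by the [1 / N^2] of the integration by parts. *)
Lemma expect_transport_window (j : 'I_d) phi : 0 <= L ->
    \sum_k phi k ^+ 2 <= m1%:R ->
    (forall y, ignores (window_sum u i1 A B offset phi y) y) ->
    (forall y : torus d N,
      ignores (window_sum u i1 A B offset phi y) (y + unitv N j)) ->
    cyclic_past j m1.+2 (fun z eta => omega u (z - unitv N j) eta *
      window_sum u i1 A B offset phi (z - unitv N j) eta) ->
  expect u (fun eta => f eta * (K * \sum_(y : torus d N)
    (omega u y eta - omega u (y + unitv N j) eta) * window_sum u i1 A B offset phi y eta)) <=
  N%:R ^+ 2 / 2 * (\sum_(y : torus d N) dirichlet_bond u f y (y + unitv N j)) + K ^+ 2 * H +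
  (9 / 2 + 4 * L) / eps ^+ 4 * (32 * S) * K ^+ 2 * density_gain.
Proof.
move=> L0 phiV hy hye hp.
apply: le_trans (expect_transport eps_gt0 u_eps f_ge0 f_density N_ge2 N_large K_gt0
   (u_smooth j) hy hye hp) _.
rewrite lerD2l.
have m10 : 0 < m1%:R :> R by rewrite ltr0n.
have hw := expect_window m10 phiV.
have N0 : 0 < N%:R :> R by rewrite ltr0n ltnW.
have c0 : 0 <= (9 / 2 + 4 * L) / eps ^+ 4 * (K / N%:R) ^+ 2.
  by rewrite mulr_ge0 ?sqr_ge0// divr_ge0 ?exprn_ge0 ?ltW//; lra.
apply: le_trans (ler_wpM2l c0 hw) _.
have S0 : 0 <= S.
  by rewrite /subgauss_cst mulr_ge0 ?sqr_ge0// divr_ge0 ?sqr_ge0.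
have g0 : 0 <= density_gain.
  by rewrite addr_ge0 ?(entropy_ge0 eps_gt0 u_eps f_ge0 f_density).
have costR : m1%:R * (m1 * m2)%:R / N%:R ^+ 2 <= 1 :> R.
  by rewrite ler_pdivrMr ?exprn_gt0// mul1r -natrM -natrX ler_nat.
move: S S0 (density_gain) g0 => s s0 g g0; set c := _ / eps ^+ 4 in c0 *.
have c1 : 0 <= c by rewrite divr_ge0 ?exprn_ge0 ?ltW//; lra.
have -> : c * (K / N%:R) ^+ 2 * (32 * s * m1%:R * (m1 * m2)%:R * g) =
    c * (32 * s) * K ^+ 2 * g * (m1%:R * (m1 * m2)%:R / N%:R ^+ 2).
  by rewrite exprMn exprVn; ring.
rewrite -[leRHS]mulr1; apply: ler_wpM2l => //.
apply: mulr_ge0 => //; apply: mulr_ge0; last exact: sqr_ge0.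
by apply: mulr_ge0 => //; rewrite mulr_ge0.
Qed.

Lemma sum_flow_sqr (phi : window -> R) (c : R) : 0 <= c ->
  (forall k, 0 <= phi k <= c) -> \sum_k phi k ^+ 2 <= c ^+ 2 * (m1 * m2)%:R.
Proof.
move=> c0 hphi; rewrite mulrC mulr_natl.
have -> : (m1 * m2)%N = #|{: window}| by rewrite card_prod !card_ord.
rewrite -sumr_const; apply: ler_sum => k _; have /andP[p0 pc] := hphi k.
by rewrite lerXn2r// nnegrE.
Qed.

Lemma expect_fluct : 0 <= L ->
  expect u (fun eta => f eta * (K * \sum_z omega u z eta * G z eta)) <=
  N%:R ^+ 2 / 2 * (\sum_(y : torus d N) dirichlet_bond u f y (y + e1)) +
  N%:R ^+ 2 / 2 * (\sum_(y : torus d N) dirichlet_bond u f y (y + e2)) +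
  (2 * K ^+ 2 + K) * H +
  ((9 / 2 + 4 * L) / eps ^+ 4 * (64 * S) * K ^+ 2 + 4 / eps ^+ 2 * (32 * S) * K) *
    density_gain.
Proof.
move=> L0.
have m10 : 0 < m1%:R :> R by rewrite ltr0n.
have m20 : 0 < m2%:R :> R by rewrite ltr0n.
have M0 : 0 < (m1 * m2)%:R :> R by rewrite ltr0n muln_gt0 m1_gt0.
have yy0 (j : 'I_d) (y : torus d N) : ((y - y)%R j : nat) = 0%N by rewrite subrr coord0.
have ye (j : 'I_d) (y : torus d N) : ((y - (y + unitv N j))%R j : nat) = N.-1.
  have := sub_pred_coord j y y; rewrite yy0.
  have -> : y - unitv N j - y = y - (y + unitv N j) by rewrite opprD addrA addrAC.
  set a := nat_of_ord _; have : (a < N)%N by exact: coord_lt.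
  rewrite leq_eqVlt => /orP[/eqP <-//|aN]; rewrite modn_small//.
have h1 : expect u (fun eta => f eta * (K * \sum_(y : torus d N)
    (omega u y eta - omega u (y + e1) eta) * window_sum u i1 A B offset flow1 y eta)) <=
  N%:R ^+ 2 / 2 * (\sum_(y : torus d N) dirichlet_bond u f y (y + e1)) + K ^+ 2 * H +
  (9 / 2 + 4 * L) / eps ^+ 4 * (32 * S) * K ^+ 2 * density_gain.
  apply: expect_transport_window => //.
  - rewrite -(pair_bigA _ (fun (k1 : 'I_m1) (k2 : 'I_m2) =>
      (ramp R m1 k1 * (k2 == 0%N :> nat)%:R) ^+ 2)) /=.
    apply: (@le_trans _ _ (\sum_(k1 < m1) (1 : R))); last by rewrite sumr_const card_ord.
    apply: ler_sum => k1 _; rewrite (bigD1 (Ordinal m2_gt0))//= big1 ?addr0.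
      by rewrite mulr1 expr_le1 ?ramp_ge0 ?ramp_le1.
    move=> k2 k20; suff -> : (k2 == 0%N :> nat) = false by rewrite mulr0 expr0n.
    by apply: contraNF k20 => /eqP E; apply/eqP; apply: val_inj.
  - by move=> y; apply: window_ignores_i1; rewrite yy0.
  - by move=> y; apply: window_ignores_i1; rewrite ye; move: N_large; lia.
  - exact: window_cyclic_past_i1.
have h2 : expect u (fun eta => f eta * (K * \sum_(y : torus d N)
    (omega u y eta - omega u (y + e2) eta) * window_sum u i1 A B offset flow2 y eta)) <=
  N%:R ^+ 2 / 2 * (\sum_(y : torus d N) dirichlet_bond u f y (y + e2)) + K ^+ 2 * H +
  (9 / 2 + 4 * L) / eps ^+ 4 * (32 * S) * K ^+ 2 * density_gain.
  have f2 k : 0 <= flow2 k <= m1%:R^-1.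
    rewrite /flow2 mulr_ge0 ?ramp_ge0 ?invr_ge0//= -[leRHS]mul1r.
    by apply: ler_wpM2r; rewrite ?invr_ge0// ramp_le1.
  (* For [m2 = 1] the second ramp vanishes, so there is no second transport; this settles the case
     [i1 = j2]. *)
  have zero : m2 = 1%N -> forall y z', ignores (window_sum u i1 A B offset flow2 y) z'.
    move=> m21 y z'; apply: window_sum_ignores => k.
    have -> : flow2 k = 0.
      rewrite /flow2 /ramp big1 ?mulr0 ?mul0r// => i _.
      by have := ltn_ord i; rewrite [X in (_ < X)%N]m21 ltnS leqn0 => /eqP ->.
    by rewrite eqxx.
  apply: expect_transport_window => //.
  - apply: le_trans (sum_flow_sqr _ f2) _; first by rewrite invr_ge0.
    rewrite natrM (_ : m1%:R^-1 ^+ 2 * (m1%:R * m2%:R) = m2%:R / m1%:R); last first.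
      by field; rewrite gt_eqF.
    rewrite ler_pdivrMr//.
    by rewrite -natrM ler_nat; apply: leq_trans m2_le _; exact: leq_pmulr.
  - by move=> y; apply: window_ignores_i1; rewrite yy0.
  - move=> y; have [E|ne] := eqVneq i1 j2; last first.
      apply: window_ignores_i1.
      have -> : y - (y + e2) = - e2 by rewrite opprD addrA subrr add0r.
      rewrite ffunE (_ : unitv N j2 i1 = 0) ?oppr0//.
      by apply: val_inj; rewrite ffunE (negbTE ne) /= mod0n.
    by apply: zero; move: transverse; rewrite E eqxx => /eqP.
  - have [E|ne] := eqVneq i1 j2; last exact: window_cyclic_past_j2.
    rewrite -E; exact: window_cyclic_past_i1.
(* The averaged term needs no Dirichlet form: its squared norm [1 / (m1 * m2)] cancels the number of
   colours. *)
have h3 : expect u (fun eta => f eta * (K * \sum_y omega u y eta *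
     window_sum u i1 A B offset average y eta)) <=
   K * H + 4 / eps ^+ 2 * (32 * S) * K * density_gain.
  have ZP : cyclic_past i1 m1.+2 (window_sum u i1 A B offset average).
    move=> z z' hz; apply: window_ignores_i1; apply/negP => /andP[h0' h1'].
    by move: hz; rewrite h0' (leq_trans h1').
  have := expect_cyclic eps_gt0 u_eps f_ge0 f_density (ltnW N_ge2) N_large ltr01 ZP.
  rewrite invr1 mul1r mulr1.
  have V0 : 0 < (m1 * m2)%:R^-1 :> R by rewrite invr_gt0.
  have hV : \sum_k average k ^+ 2 <= (m1 * m2)%:R^-1.
    apply: le_trans (sum_flow_sqr (ltW V0) _) _; last by rewrite expr2 mulfVK ?gt_eqF.
    by move=> k; rewrite /average lexx ltW.
  have := expect_window V0 hV; rewrite mulfVK ?gt_eqF// => hw hc.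
  rewrite (@eq_expect _ _ _ u _ (fun eta => K * (f eta * \sum_y omega u y eta *
     window_sum u i1 A B offset average y eta))); last by move=> eta; rewrite mulrCA.
  rewrite expectZ.
  have e20 : 0 <= 4 / eps ^+ 2 by rewrite divr_ge0 ?sqr_ge0.
  have := le_trans hc (lerD (lexx _) (ler_wpM2l e20 hw)).
  move/(ler_wpM2l (ltW K_gt0))/le_trans; apply.
  by rewrite le_eqVlt; apply/orP; left; apply/eqP; ring.
have -> : expect u (fun eta => f eta * (K * \sum_z omega u z eta * G z eta)) =
  expect u (fun eta => f eta * (K * \sum_(y : torus d N)
    (omega u y eta - omega u (y + e1) eta) * window_sum u i1 A B offset flow1 y eta)) +
  expect u (fun eta => f eta * (K * \sum_(y : torus d N)
    (omega u y eta - omega u (y + e2) eta) * window_sum u i1 A B offset flow2 y eta)) +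
  expect u (fun eta => f eta * (K * \sum_y omega u y eta *
     window_sum u i1 A B offset average y eta)).
  rewrite -!expectD; apply: eq_expect => eta.
  by rewrite fluct_decomposition !mulrDr.
apply: le_trans (lerD (lerD h1 h2) h3) _.
by rewrite le_eqVlt; apply/orP; left; apply/eqP; ring.
Qed.

End Fluctuation.

(** * The adjoint of the generator *)

Section Energy.
Variables (R : realType) (d N : nat) (u : torus d N -> R).
Variable eps : R.
Hypothesis eps_gt0 : 0 < eps.
Hypothesis u_eps : forall x, eps <= u x <= 1 - eps.
Variables (i1 : 'I_d) (gamma : R).
Hypothesis N_ge2 : (2 <= N)%N.
Implicit Types (eta : config d N) (x y z : torus d N) (f : config d N -> R).

Local Notation e := (unitv N i1).

Definition mag x : R := 2 * u x - 1.
Definition susc x : R := u x * (1 - u x).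

Lemma u_neq0 x : (u x != 0) * (1 - u x != 0).
Proof.
by have /andP[x1 x2] := u_eps x; have e0 := eps_gt0; split; rewrite gt_eqF//; lra.
Qed.

Lemma spin_omega eta x : spin R eta x = mag x + 2 * susc x * omega u x eta.
Proof.
rewrite /spin /mag /susc /omega.
by case: (eta x) => /=; field; rewrite !u_neq0.
Qed.

Lemma flip_rate_translate eta x : flip_rate i1 gamma (translate x eta) =
  1 - gamma * spin R eta x * (spin R eta (x - e) + spin R eta (x + e))
    + gamma ^+ 2 * spin R eta (x - e) * spin R eta (x + e).
Proof. by rewrite /flip_rate /spin !ffunE addr0. Qed.

Definition glauber_drift x eta : R :=
  omega u x eta * (- mag x * (1 + gamma ^+ 2 * spin R eta (x - e) * spin R eta (x + e))
    + gamma * (spin R eta (x - e) + spin R eta (x + e))).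

(** For fixed neighbours, the adjoint of the flip applied to 1 has mean zero in [eta x]; it is
    therefore a multiple of [omega u x]. *)
Lemma expect_glauber f x :
  expect u (fun eta => flip_rate i1 gamma (translate x eta) * (f (flip x eta) - f eta)) =
  expect u (fun eta => f eta * glauber_drift x eta).
Proof.
have ne1 : x + e != x by rewrite eq_sym addr_unitv_neq.
have ne2 : x - e != x.
  by apply: contraNneq (addr_unitv_neq i1 N_ge2 (x - e)) => E; rewrite subrK E.
rewrite /expect.
under eq_bigr do rewrite mulrBr mulrBl.
rewrite sumrB -(sum_flip x) -sumrB; apply: eq_bigr => eta _.
rewrite flipK !flip_rate_translate /glauber_drift.
have -> : spin R (flip x eta) (x + e) = spin R eta (x + e) by rewrite /spin flip_neq.
have -> : spin R (flip x eta) (x - e) = spin R eta (x - e) by rewrite /spin flip_neq.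
move: (spin R eta (x + e)) (spin R eta (x - e)) => sa sb.
have := product_measure_flip u x eta; rewrite /omega /spin /mag flip_eq.
set p := product_measure u _; set q := product_measure u _.
have [u0 u1] := u_neq0 x.
case: (eta x) => /= E.
  have -> : p = q * (1 - u x) / u x by rewrite -E mulfK.
  by field.
have -> : p = q * u x / (1 - u x) by rewrite -E mulfK.
by field.
Qed.

Lemma expect_exchange f x y : x != y ->
  expect u (fun eta => f (exchange x y eta) - f eta) =
  expect u (fun eta => f eta * (- (u y - u x) * current u x y eta)).
Proof.
move=> xy; rewrite /expect.
under eq_bigr do rewrite mulrBl.
rewrite sumrB -(sum_exchange x y) -sumrB; apply: eq_bigr => eta _.
by rewrite exchangeK (product_measure_exchange eps_gt0 u_eps)//; ring.
Qed.

Hypothesis u_i1 : forall j x, j != i1 -> u (x + unitv N j) = u x.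
Variable K : R.
Hypothesis K_ge : 2^-1 <= K.

(** With [m = mag x] put for the neighbouring values, the Glauber bracket is [(2 gamma - 1) m -
    gamma^2 m^3 = - potential' gamma (u x)]: a discretization of the stationary equation. *)
Definition drift x : R :=
  N%:R ^+ 2 * (u (x + e) + u (x - e) - 2 * u x) +
  K * (- mag x * (1 + gamma ^+ 2 * mag (x - e) * mag (x + e))
    + gamma * (mag (x - e) + mag (x + e))).

(** Each product of [omega]'s is attributed to its foremost site [z]. The three lines come from the
    exchange of [z - e] with [z], from the flip at [z - e], and from the flip at [z]. *)
Definition pair_coef z : R :=
  - (N%:R ^+ 2 / K * (u z - u (z - e)) ^+ 2) +
  (- (2 * gamma ^+ 2 * mag (z - e) * mag (z - e - e) * susc z) + 2 * gamma * susc z) +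
  (- (2 * gamma ^+ 2 * mag z * susc (z - e) * mag (z + e)) + 2 * gamma * susc (z - e)).

Definition triple_coef z : R :=
  - (4 * gamma ^+ 2 * mag (z - e) * susc (z - e - e) * susc z).

(* the adjoint of the generator applied to the constant function 1, expanded in
   products of the [omega]'s *)
Lemma expect_generator f :
  expect u (generator i1 gamma K f) =
  expect u (fun eta => f eta * \sum_x omega u x eta * drift x) +
  expect u (fun eta => f eta *
    (K * \sum_z omega u z eta * local_fluct u i1 pair_coef triple_coef z eta)).
Proof.
have K0 : K != 0 by rewrite gt_eqF//; have := K_ge; lra.
have EE : expect u (exclusion_gen f) = expect u (fun eta => f eta *
    \sum_(x : torus d N) (- (u (x + e) - u x) * current u x (x + e) eta)).
  transitivity (\sum_(x : torus d N) \sum_(j < d) expect u (fun eta =>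
      f (exchange x (x + unitv N j) eta) - f eta)).
    by rewrite /exclusion_gen expect_sum; apply: eq_bigr => x _; rewrite expect_sum.
  have -> : (fun eta => f eta * \sum_(x : torus d N) (- (u (x + e) - u x) * current u x (x + e) eta)) =
     fun eta => \sum_(x : torus d N) f eta * (- (u (x + e) - u x) * current u x (x + e) eta).
    by apply/funext => eta; rewrite mulr_sumr.
  rewrite expect_sum; apply: eq_bigr => x _.
  rewrite (bigD1 i1)//= big1 ?addr0 => [|j ji]; first by rewrite expect_exchange// addr_unitv_neq.
  rewrite expect_exchange ?addr_unitv_neq// u_i1// subrr oppr0.
  by rewrite -[RHS](expect_cst u 0); apply: eq_expect => eta; rewrite mul0r mulr0.
have EG : expect u (glauber_gen i1 gamma f) =
    expect u (fun eta => f eta * \sum_x glauber_drift x eta).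
  have -> : (fun eta => f eta * \sum_x glauber_drift x eta) =
     fun eta => \sum_(x : torus d N) f eta * glauber_drift x eta.
    by apply/funext => eta; rewrite mulr_sumr.
  rewrite !expect_sum; apply: eq_bigr => x _; exact: expect_glauber.
have -> : expect u (generator i1 gamma K f) =
   N%:R ^+ 2 * expect u (exclusion_gen f) + K * expect u (glauber_gen i1 gamma f).
  by rewrite -!expectZ -expectD.
rewrite EE EG -!expectZ -!expectD; apply: eq_expect => eta.
rewrite [LHS](_ : _ = f eta * (N%:R ^+ 2 * (\sum_(x : torus d N) (- (u (x + e) - u x) *
   current u x (x + e) eta)) + K * \sum_x glauber_drift x eta)); last by ring.
rewrite -mulrDr; congr (_ * _).
set w := fun x => omega u x eta.
(* Summation by parts: the linear part of the current is a discrete Laplacian, which enters [drift],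
   up to the telescoping difference [g x - g (x + e)]. *)
pose g x := N%:R ^+ 2 * (u x - u (x - e)) * w x.
pose P x := (- (N%:R ^+ 2 / K * (u (x + e) - u x) ^+ 2) +
  (- (2 * gamma ^+ 2 * mag x * mag (x - e) * susc (x + e)) + 2 * gamma * susc (x + e)))
  * w x * w (x + e).
pose Q x := (- (2 * gamma ^+ 2 * mag x * susc (x - e) * mag (x + e)) + 2 * gamma * susc (x - e))
  * w x * w (x - e).
pose C x := - (4 * gamma ^+ 2 * mag x * susc (x - e) * susc (x + e))
  * w (x - e) * w x * w (x + e).
transitivity (\sum_(x : torus d N) (w x * drift x + (g x - g (x + e)) + K * (P x + Q x + C x))).
  rewrite !mulr_sumr -big_split; apply: eq_bigr => x _ /=.
  rewrite /glauber_drift !spin_omega -!/(w _) /current -!/(w _) /g /P /Q /C /drift addrK.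
  by field.
rewrite !big_split /= sumrN [\sum_x g x](reindex_inj (addIr e)) subrr addr0.
rewrite -mulr_sumr !big_split /=; congr (_ + K * _).
rewrite [\sum_x P x](reindex_inj (addIr (- e))) [\sum_x C x](reindex_inj (addIr (- e))) /=.
rewrite -!big_split; apply: eq_bigr => z _ /=.
rewrite /P /Q /C /local_fluct -!/(w _) /pair_coef /triple_coef subrK.
by ring.
Qed.

Variable f : config d N -> R.
Hypothesis f_ge0 : forall eta, 0 <= f eta.
Hypothesis f_density : expect u f = 1.
Variables (j2 : 'I_d) (m1 m2 : nat).
Hypothesis m1_gt0 : (0 < m1)%N.
Hypothesis m2_gt0 : (0 < m2)%N.
Hypothesis m2_le : (m2 <= m1)%N.
Hypothesis N_large : ((m1.+2).*2 <= N)%N.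
Hypothesis transverse : (i1 != j2) || (m2 == 1%N).
Hypothesis cost : (m1 * (m1 * m2) <= N ^ 2)%N.
Variables (L M : R).
Hypothesis gamma01 : 0 <= gamma <= 1.
Hypothesis L_ge0 : 0 <= L.
Hypothesis u_grad : forall x, (u (x + e) - u x) ^+ 2 <= L * K / N%:R ^+ 2.
Hypothesis M_ge0 : 0 <= M.
Hypothesis drift_le : forall x, drift x ^+ 2 <= M * K ^+ 4 / N%:R ^+ 2.

Local Notation H := (entropy (product_measure u) f).
Local Notation vol := (#|{: torus d N}|%:R / (m1 * m2)%:R : R).

Lemma mulr01 (a b : R) : 0 <= a <= 1 -> 0 <= b <= 1 -> 0 <= a * b <= 1.
Proof. by move=> /andP[a0 a1] /andP[b0 b1]; rewrite mulr_ge0//=; nra. Qed.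

Lemma mag_le x : `|mag x| <= 1.
Proof.
have /andP[x1 x2] := u_eps x; have e0 := eps_gt0.
by rewrite /mag ler_norml; lra.
Qed.

Lemma susc_le x : 0 <= susc x <= 1.
Proof.
have /andP[x1 x2] := u_eps x; have e0 := eps_gt0.
by rewrite /susc; apply/andP; split; nra.
Qed.

Lemma pair_coef_le z : `|pair_coef z| <= L + 8.
Proof.
have K0 : 0 < K by have := K_ge; lra.
have N0 : 0 < N%:R :> R by rewrite ltr0n ltnW.
have /andP[g0 g1] := gamma01.
have h1 : `|- (N%:R ^+ 2 / K * (u z - u (z - e)) ^+ 2)| <= L.
  rewrite normrN ger0_norm; last by rewrite mulr_ge0 ?sqr_ge0// divr_ge0 ?sqr_ge0 ?ltW.
  have := u_grad (z - e); rewrite subrK.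
  move/(ler_wpM2l (_ : 0 <= N%:R ^+ 2 / K)); rewrite divr_ge0 ?sqr_ge0 ?(ltW K0)// => /(_ isT).
  by move/le_trans; apply; rewrite le_eqVlt; apply/orP; left; apply/eqP; field; rewrite !gt_eqF.
have cub (a b c : R) : `|a| <= 1 -> `|b| <= 1 -> 0 <= c <= 1 ->
    `|- (2 * gamma ^+ 2 * a * b * c) + 2 * gamma * c| <= 4.
  move=> a1 b1 /andP[c0 c1].
  have hab : `|gamma ^+ 2 * (a * b) * c| <= 1.
    rewrite (normrM _ c) (normrM (gamma ^+ 2)) (normrM a) (ger0_norm c0) (ger0_norm (sqr_ge0 _)).
    suff /andP[] : 0 <= gamma ^+ 2 * (`|a| * `|b|) * c <= 1 by [].
    by do !apply: mulr01; rewrite ?normr_ge0 ?a1 ?b1 ?c0 ?c1 ?sqr_ge0 ?expr_le1.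
  have hc : 0 <= gamma * c <= 1 by apply: mulr01; rewrite ?g0 ?c0.
  move: hab hc; rewrite !ler_norml => /andP[? ?] /andP[? ?]; apply/andP; split; lra.
apply: le_trans (ler_normD _ _) _.
have -> : L + 8 = (L + 4) + 4 by lra.
apply: lerD.
  apply: le_trans (ler_normD _ _) _; apply: lerD => //.
  by apply: cub; rewrite ?mag_le ?susc_le.
have -> : 2 * gamma ^+ 2 * mag z * susc (z - e) * mag (z + e) =
  2 * gamma ^+ 2 * mag z * mag (z + e) * susc (z - e) by ring.
by apply: cub; rewrite ?mag_le ?susc_le.
Qed.

Lemma triple_coef_le z : `|triple_coef z| <= L + 8.
Proof.
have /andP[g0 g1] := gamma01.
apply: (@le_trans _ _ 4); last by have := L_ge0; lra.
have m := mag_le (z - e); have /andP[s0 s1] := susc_le (z - e - e).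
have /andP[t0 t1] := susc_le z.
rewrite /triple_coef normrN.
have -> : 4 * gamma ^+ 2 * mag (z - e) * susc (z - e - e) * susc z =
  4 * (gamma ^+ 2 * (mag (z - e) * (susc (z - e - e) * susc z))) by ring.
rewrite (normrM 4) ger0_norm// -[leRHS]mulr1 ler_pM2l//.
rewrite (normrM (gamma ^+ 2)) (normrM (mag _)) (normrM (susc _)).
rewrite (ger0_norm s0) (ger0_norm t0) (ger0_norm (sqr_ge0 _)).
suff /andP[] : 0 <= gamma ^+ 2 * (`|mag (z - e)| * (susc (z - e - e) * susc z)) <= 1 by [].
apply: mulr01; first by rewrite sqr_ge0 expr_le1.
by apply: mulr01; [rewrite normr_ge0|apply: mulr01; rewrite ?s0 ?t0].
Qed.

(** The 5 is 1 from the drift plus 4 from [2 K^2 + K <= 4 K^2]; the 9 comes from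
    [H + 9 v <= 9 (H + v)]; the doubled [L] and the inner factor 2 come from [K <= 2 K^2]. *)
Definition energy_cst : R :=
  5 + 4 / eps ^+ 2 * M +
  9 * ((9 / 2 + 4 * (2 * L)) / eps ^+ 4 * (64 * subgauss_cst eps (L + 8)) +
       2 * (4 / eps ^+ 2 * (32 * subgauss_cst eps (L + 8)))).

Lemma energy_cst_ge0 : 0 <= energy_cst.
Proof.
have S0 : 0 <= subgauss_cst eps (L + 8).
  by rewrite /subgauss_cst mulr_ge0 ?sqr_ge0// divr_ge0 ?sqr_ge0.
have e2 : 0 <= 4 / eps ^+ 2 by rewrite divr_ge0 ?sqr_ge0.
have e4 : 0 <= (9 / 2 + 4 * (2 * L)) / eps ^+ 4.
  by rewrite divr_ge0 ?exprn_ge0 ?(ltW eps_gt0)//; have := L_ge0; lra.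
have h1 := mulr_ge0 e4 (mulr_ge0 (ler0n R 64) S0).
have h2 := mulr_ge0 e2 (mulr_ge0 (ler0n R 32) S0).
have h3 := mulr_ge0 e2 M_ge0.
by rewrite /energy_cst; lra.
Qed.

Lemma energy_estimate :
  expect u (generator i1 gamma K f) <=
  N%:R ^+ 2 * (\sum_(x : torus d N) \sum_(j < d) dirichlet_bond u f x (x + unitv N j)) +
  energy_cst * K ^+ 2 * (H + vol).
Proof.
have K0 : 0 < K by have := K_ge; lra.
have N0 : 0 < N%:R :> R by rewrite ltr0n ltnW.
have H0 : 0 <= H by exact: (entropy_ge0 eps_gt0 u_eps f_ge0 f_density).
have vol0 : 0 <= vol by rewrite divr_ge0.
rewrite expect_generator.
have smooth (j : 'I_d) x : (u (x + unitv N j) - u x) ^+ 2 <= 2 * L * (K / N%:R) ^+ 2.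
  have [->|ji] := eqVneq j i1; last first.
    by rewrite u_i1// subrr expr0n mulr_ge0 ?sqr_ge0// mulr_ge0.
  apply: le_trans (u_grad x) _; rewrite exprMn exprVn mulrA ler_wpM2r ?invr_ge0 ?sqr_ge0//.
  by have := K_ge; have : 0 <= L * K by [rewrite mulr_ge0// ltW]; nra.
have fl := expect_fluct eps_gt0 u_eps f_ge0 f_density m1_gt0 m2_gt0 m2_le N_large
  transverse cost (_ : 0 < L + 8) pair_coef_le triple_coef_le K0 smooth (_ : 0 <= 2 * L).
have {}fl := fl ltac:(have := L_ge0; lra) ltac:(by rewrite mulr_ge0).
have dr := expect_cyclic eps_gt0 u_eps f_ge0 f_density (ltnW N_ge2) (N_ge2 : 1.*2 <= N)%N
  (_ : 0 < (K ^+ 2)^-1) (_ : cyclic_past i1 1 (fun x _ => drift x)).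
have {}dr := dr ltac:(by rewrite invr_gt0 exprn_gt0) ltac:(by []).
rewrite invrK in dr.
(* The sum has [N^d] terms of size [K^4 / N^2], and [cost] implies [m1 * m2 <= N^2]. *)
have drQ : expect u (fun eta => f eta * \sum_z drift z ^+ 2) <= M * K ^+ 4 * vol.
  apply: (@le_trans _ _ (expect u (fun eta => M * K ^+ 4 * vol * f eta))); last first.
    by rewrite expectZ f_density mulr1.
  apply: (ler_expect eps_gt0 u_eps) => eta; rewrite [leRHS]mulrC; apply: ler_wpM2l => //.
  apply: le_trans (ler_sum _ (fun z _ => drift_le z)) _.
  rewrite sumr_const -[leLHS]mulr_natl mulrCA; apply: ler_wpM2l.
    by rewrite mulr_ge0// exprn_ge0// ltW.
  apply: ler_wpM2l => //; rewrite lef_pV2 ?posrE ?exprn_gt0 ?ltr0n ?muln_gt0 ?m1_gt0 ?m2_gt0//; last exact: ltnW.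
  by rewrite -natrX ler_nat; apply: leq_trans cost; exact: leq_pmull.
have dr2 : expect u (fun eta => f eta * \sum_x omega u x eta * drift x) <=
    K ^+ 2 * H + 4 / eps ^+ 2 * M * K ^+ 2 * vol.
  apply: le_trans dr _; rewrite lerD2l.
  apply: le_trans (ler_wpM2l _ drQ) _.
    by rewrite mulr_ge0 ?divr_ge0 ?invr_ge0 ?sqr_ge0.
  rewrite le_eqVlt; apply/orP; left; apply/eqP.
  by move: vol => v; field; rewrite !gt_eqF.
have dir j : \sum_(y : torus d N) dirichlet_bond u f y (y + unitv N j) <=
    \sum_(x : torus d N) \sum_(j < d) dirichlet_bond u f x (x + unitv N j).
  apply: ler_sum => x _; rewrite [leRHS](bigD1 j)//= lerDl.
  by apply: sumr_ge0 => ? _; exact: (dirichlet_bond_ge0 eps_gt0 u_eps).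
have N20 : 0 <= N%:R ^+ 2 / 2 :> R by rewrite divr_ge0 ?sqr_ge0.
have d1 := ler_wpM2l N20 (dir i1); have d2 := ler_wpM2l N20 (dir j2).
apply: le_trans (lerD dr2 fl) _; rewrite /energy_cst.
have S0 : 0 <= subgauss_cst eps (L + 8).
  by rewrite /subgauss_cst mulr_ge0 ?sqr_ge0// divr_ge0 ?sqr_ge0.
set c1 := (9 / 2 + _) / _ * _; set c2 := 4 / eps ^+ 2 * (32 * _).
have c10 : 0 <= c1.
  apply: mulr_ge0; last by rewrite mulr_ge0.
  by apply: divr_ge0; [have := L_ge0; lra|rewrite exprn_ge0// ltW].
have c20 : 0 <= c2 by apply: mulr_ge0; [rewrite divr_ge0 ?sqr_ge0|rewrite mulr_ge0].
have c30 : 0 <= 4 / eps ^+ 2 * M by apply: mulr_ge0; rewrite ?divr_ge0 ?sqr_ge0.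
set c3 := 4 / eps ^+ 2 * M in c30 *.
set DD := \sum_(x : torus d N) \sum_(j < d) _ in d1 d2 *.
have K2 : K <= 2 * K ^+ 2 by have := K_ge; nra.
have K20 : 0 <= K ^+ 2 by exact: sqr_ge0.
move: d1 d2 K2 K20 H0 vol0; move: vol H (K ^+ 2) => v h k2 d1 d2 K2 K20 h0 v0.
have i1' : (2 * k2 + K) * h <= 4 * k2 * h by apply: ler_wpM2r => //; lra.
have i2' : (c1 * k2 + c2 * K) * (h + 9 * v) <= ((c1 + 2 * c2) * k2) * (9 * (h + v)).
  have p1 := ler_wpM2l c20 K2.
  have p2 : 0 <= c1 * k2 by exact: mulr_ge0.
  have p3 : 0 <= c2 * K by rewrite mulr_ge0// ltW.
  by apply: ler_pM; [rewrite addr_ge0|rewrite addr_ge0// mulr_ge0|lra|lra].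
have i3 : 0 <= k2 * v by rewrite mulr_ge0.
have i4 : 0 <= c3 * (k2 * h) by apply: mulr_ge0 => //; exact: mulr_ge0.
have i5 : 0 <= k2 * h by rewrite mulr_ge0.
lra.
Qed.

End Energy.

(** * The interface profile *)

Section Interface.
Variable R : realType.

Lemma mean_value_le (g dg : R -> R) (a b C : R) : a <= b ->
    (forall x, a <= x <= b -> is_derive x 1 g (dg x)) ->
    (forall x, a <= x <= b -> `|dg x| <= C) ->
  `|g b - g a| <= C * (b - a).
Proof.
move=> ab dgx dgC.
have [||c] := @MVT_segment R g dg a b ab.
- by move=> x; rewrite in_itv /= => /andP[ax xb]; apply: dgx; rewrite !ltW.
- apply: derivable_within_continuous => x; rewrite in_itv /= => xab.
  by have [] := dgx x xab.
- rewrite in_itv /= => cab ->; rewrite normrM (ger0_norm (_ : 0 <= b - a)) ?subr_ge0//.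
  by apply: ler_wpM2r; rewrite ?subr_ge0// dgC.
Qed.

Variables (gamma K : R) (rho : R -> R).
Hypothesis gamma_itv : 1 / 2 < gamma < 1.
Hypothesis K_gt0 : 0 < K.
Hypothesis rhoP : stationary_interface gamma K rho.

Local Notation drho := (derive1 rho).
Local Notation S := (Num.sqrt K).

Lemma rho_itv (th : R) : 0 < rho th < 1.
Proof. by case: rhoP. Qed.

Lemma rho_periodic (th : R) : rho (th + S) = rho th.
Proof. by case: rhoP. Qed.

Lemma is_derive_rho (th : R) : is_derive th 1 rho (drho th).
Proof. by case: rhoP => _ _ /(_ th)[h _ _] _ _; split => //; rewrite derive1E. Qed.

Lemma is_derive_drho (th : R) : is_derive th 1 drho (potential' gamma (rho th)).
Proof.
case: rhoP => _ _ /(_ th)[_ h /eqP e] _ _; split => //.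
by rewrite -derive1E; apply/eqP; rewrite -subr_eq0.
Qed.

Lemma potentialE r : potential' gamma r =
  (2 * r - 1) * (gamma ^+ 2 * (2 * r - 1) ^+ 2 - (2 * gamma - 1)).
Proof. by rewrite /potential'; ring. Qed.

Lemma potential_le (r : R) : 0 < r < 1 -> `|potential' gamma r| <= `|2 * r - 1|.
Proof.
move=> /andP[r0 r1]; rewrite potentialE normrM -[leRHS]mulr1.
have /andP[g0 g1] := gamma_itv.
apply: ler_wpM2l => //; rewrite ler_norml.
have s1 : (2 * r - 1) ^+ 2 <= 1 by nra.
have s0 : 0 <= (2 * r - 1) ^+ 2 by exact: sqr_ge0.
have gg1 : gamma ^+ 2 <= 1 by nra.
have gg0 : 0 <= gamma ^+ 2 by exact: sqr_ge0.
by apply/andP; split; nra.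
Qed.

Lemma potential_lipschitz (r s : R) : 0 < r < 1 -> 0 < s < 1 ->
  `|potential' gamma r - potential' gamma s| <= 8 * `|r - s|.
Proof.
move=> /andP[r0 r1] /andP[s0 s1].
have /andP[g0 g1] := gamma_itv.
set a := 2 * r - 1; set b := 2 * s - 1.
have -> : potential' gamma r - potential' gamma s =
   (r - s) * (2 * (gamma ^+ 2 * (a ^+ 2 + a * b + b ^+ 2) - (2 * gamma - 1))).
  by rewrite /potential' /a /b; ring.
rewrite normrM mulrC; apply: ler_wpM2r => //.
have ha : -1 <= a <= 1 by rewrite /a; apply/andP; split; lra.
have hb : -1 <= b <= 1 by rewrite /b; apply/andP; split; lra.
case/andP: ha => a1 a2; case/andP: hb => b1 b2.
have q1 : a ^+ 2 + a * b + b ^+ 2 <= 3 by nra.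
have q0 : 0 <= a ^+ 2 + a * b + b ^+ 2 by nra.
have gg1 : gamma ^+ 2 <= 1 by nra.
have gg0 : 0 <= gamma ^+ 2 by exact: sqr_ge0.
rewrite ler_norml; move: (a ^+ 2 + a * b + b ^+ 2) q0 q1 => q q0 q1.
by apply/andP; split; nra.
Qed.

Lemma potential_le1 (th : R) : `|potential' gamma (rho th)| <= 1.
Proof.
have h := rho_itv th; apply: le_trans (potential_le h) _.
by case/andP: h => ? ?; rewrite ler_norml; apply/andP; split; lra.
Qed.

(** On an interval of length 1 some slope equals an increment of [rho], hence is at most 1 in
    absolute value, and the slope varies by at most 1 because the second derivative does not exceed
    1. *)
Lemma drho_le (th : R) : `|drho th| <= 2.
Proof.
have t1 : th <= th + 1 by lra.
have [|c] := @MVT_segment R rho drho th (th + 1) t1 (fun x _ => is_derive_rho x).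
  by apply: derivable_within_continuous => x _; have [] := is_derive_rho x.
rewrite in_itv /= => /andP[c1 c2]; rewrite [th + 1 - th]addrAC subrr add0r mulr1 => E.
have h1 := rho_itv th; have h2 := rho_itv (th + 1).
have := @mean_value_le drho (fun x => potential' gamma (rho x)) th c 1 c1
  (fun x _ => is_derive_drho x) (fun x _ => potential_le1 x).
rewrite -E; case/andP: h1 => ? ?; case/andP: h2 => ? ?.
by rewrite !ler_norml => /andP[? ?]; apply/andP; split; lra.
Qed.

Lemma rho_lipschitz (a b : R) : `|rho b - rho a| <= 2 * `|b - a|.
Proof.
wlog ab : a b / a <= b => [th|].
  by have [/th//|/ltW/th] := leP a b; rewrite distrC [`|a - b|]distrC.
rewrite (ger0_norm (_ : 0 <= b - a)) ?subr_ge0//.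
by apply: (mean_value_le ab (fun x _ => is_derive_rho x)) => x _; exact: drho_le.
Qed.

(** Third order accuracy without a third derivative: the derivative in the step [s] is [2 s] times a
    difference of values of the potential term, and Lipschitz continuity bounds that difference by
    [16 s]. *)
Lemma second_difference (th h : R) : 0 <= h ->
  `|rho (th + h) + rho (th - h) - 2 * rho th - h ^+ 2 * potential' gamma (rho th)|
  <= 32 * h ^+ 3.
Proof.
move=> h0; set V := potential' gamma (rho th).
pose q (s : R) : R := rho (th + s) + rho (th - s) - 2 * rho th - s ^+ 2 * V.
pose dq (s : R) : R := drho (th + s) - drho (th - s) - 2 * s * V.
have dqP (s : R) : is_derive s 1 q (dq s).
  have d1 : is_derive s 1 (fun s : R => rho (th + s)) (drho (th + s)).
    have h1 : is_derive s 1 (fun s : R => th + s) (1 : R).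
      by apply: is_derive_eq; rewrite add0r mul1r.
    have := @is_derive1_comp R rho (fun s : R => th + s) s _ _ (is_derive_rho (th + s)) h1.
    by rewrite mulr1.
  have d2 : is_derive s 1 (fun s : R => rho (th - s)) (- drho (th - s)).
    have h1 : is_derive s 1 (fun s : R => th - s) (- 1 : R).
      by apply: is_derive_eq; rewrite add0r mul1r.
    have := @is_derive1_comp R rho (fun s : R => th - s) s _ _ (is_derive_rho (th - s)) h1.
    by rewrite mulrN1.
  rewrite /q; apply: is_derive_eq.
  by rewrite /dq scaler0 /GRing.scale /=; ring.
have := @mean_value_le q dq 0 h (32 * h ^+ 2) h0 (fun x _ => dqP x).
have -> : q 0 = 0 by rewrite /q !addr0 subr0; ring.
rewrite !subr0 -mulrA -exprSr; apply => s /andP[s0 sh].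
have ts : th - s <= th + s by lra.
have [|c] := @MVT_segment R drho _ (th - s) (th + s) ts (fun x _ => is_derive_drho x).
  by apply: derivable_within_continuous => x _; have [] := is_derive_drho x.
rewrite in_itv /= => /andP[c1 c2] E.
have -> : dq s = 2 * s * (potential' gamma (rho c) - V).
  by rewrite /dq E; ring.
have hc : `|c - th| <= s by rewrite ler_norml; apply/andP; split; lra.
have := potential_lipschitz (rho_itv c) (rho_itv th); rewrite -/V => h1.
have h2 := rho_lipschitz th c.
have h3 : `|potential' gamma (rho c) - V| <= 16 * s by lra.
rewrite normrM (ger0_norm (_ : 0 <= 2 * s)); last by lra.
have : 2 * s * `|potential' gamma (rho c) - V| <= 2 * s * (16 * s).
  by apply: ler_wpM2l => //; lra.
move/le_trans; apply; nra.
Qed.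

(* the zeros of the potential are [1/2] and [1/2 +- sqrt (2 gamma - 1) / (2 gamma)];
   by the maximum principle the profile stays between the outer two *)
Definition interface_gap : R := (1 - Num.sqrt (2 * gamma - 1) / gamma) / 2.

Lemma interface_gap_gt0 : 0 < interface_gap.
Proof.
have /andP[g0 g1] := gamma_itv.
rewrite /interface_gap divr_gt0// subr_gt0 ltr_pdivrMr; last by lra.
rewrite mul1r -[ltRHS]ger0_norm; last by lra.
rewrite -sqrtr_sqr ltr_sqrt; first by nra.
by rewrite exprn_gt0//; lra.
Qed.

Lemma critical_value_le (s : R) : s * (gamma ^+ 2 * s ^+ 2 - (2 * gamma - 1)) <= 0 ->
  s <= Num.sqrt (2 * gamma - 1) / gamma.
Proof.
have /andP[g0 g1] := gamma_itv => hs.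
have r0 : 0 <= Num.sqrt (2 * gamma - 1) by exact: sqrtr_ge0.
rewrite ler_pdivlMr; last by lra.
have [s0|s0] := leP s 0; first by apply: le_trans r0; nra.
rewrite -[leLHS]ger0_norm; last by nra.
rewrite -sqrtr_sqr ler_sqrt; last by lra.
rewrite pmulr_rle0// in hs; nra.
Qed.

Let S_gt0 : 0 < S. Proof. by rewrite sqrtr_gt0. Qed.

Lemma rho_gap (th : R) : 0 <= th <= S -> interface_gap <= rho th <= 1 - interface_gap.
Proof.
move=> /andP[t0 t1].
have S3 : 0 <= 3 * S by have := S_gt0; lra.
have cont : {within `[0, 3 * S], continuous rho}.
  by apply: derivable_within_continuous => x _; have [] := is_derive_rho x.
(* An extremal point is moved by a period into the middle third, so that [c - h] and [c + h] stay in
   the interval. The sign of the second difference there, divided by [h^2] as [h] tends to 0, gives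
   the sign of the potential term at [rho c]. *)
have recenter c : c \in `[0, 3 * S]%R -> exists2 c', S <= c' <= 2 * S & rho c' = rho c.
  rewrite in_itv /= => /andP[c0 c3]; have [cS|cS] := ltP c S.
    by exists (c + S); [apply/andP; split; lra|exact: rho_periodic].
  have [c2|c2] := ltP (2 * S) c; last by exists c; rewrite ?cS.
  exists (c - S); first by apply/andP; split; lra.
  by have := rho_periodic (c - S); rewrite subrK.
have small (v : R) : (forall h, 0 < h -> h <= S -> v <= h) -> v <= 0.
  move=> hv; rewrite leNgt; apply/negP => v0.
  have m0 : 0 < Num.min S (v / 2) by rewrite lt_min S_gt0 divr_gt0.
  have := hv _ m0; rewrite ge_min lexx => /(_ isT); rewrite le_min => /andP[_]; lra.
have sq h : 0 < h -> 0 < h ^+ 2 by move=> ?; rewrite exprn_gt0.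
have [cM cMin cMax] := EVT_max S3 cont.
have [cm cmin cmMin] := EVT_min S3 cont.
have tin : th \in `[0, 3 * S]%R by rewrite in_itv /=; apply/andP; split; lra.
apply/andP; split.
  apply: le_trans (cmMin _ tin).
  have [c /andP[c1 c2] E] := recenter _ cmin; rewrite -E.
  have hV : - (32^-1 * potential' gamma (rho c)) <= 0.
    apply: small => h h0 hS.
    have := second_difference c (ltW h0); rewrite ler_norml => /andP[_ h2].
    have b1 : rho c <= rho (c + h).
      by rewrite E; apply: cmMin; rewrite in_itv /=; apply/andP; split; lra.
    have b2 : rho c <= rho (c - h).
      by rewrite E; apply: cmMin; rewrite in_itv /=; apply/andP; split; lra.
    have : h ^+ 2 * (- potential' gamma (rho c)) <= h ^+ 2 * (32 * h).
      by rewrite mulrCA -exprSr; lra.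
    by rewrite ler_pM2l ?sq//; lra.
  have := @critical_value_le (- (2 * rho c - 1)).
  by rewrite sqrrN mulNr -potentialE /interface_gap; lra.
apply: le_trans (cMax _ tin) _.
have [c /andP[c1 c2] E] := recenter _ cMin; rewrite -E.
have hV : 32^-1 * potential' gamma (rho c) <= 0.
  apply: small => h h0 hS.
  have := second_difference c (ltW h0); rewrite ler_norml => /andP[h2 _].
  have b1 : rho (c + h) <= rho c.
    by rewrite E; apply: cMax; rewrite in_itv /=; apply/andP; split; lra.
  have b2 : rho (c - h) <= rho c.
    by rewrite E; apply: cMax; rewrite in_itv /=; apply/andP; split; lra.
  have : h ^+ 2 * (potential' gamma (rho c)) <= h ^+ 2 * (32 * h).
    by rewrite [leRHS]mulrCA -exprSr; lra.
  by rewrite ler_pM2l ?sq//; lra.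
have := @critical_value_le (2 * rho c - 1).
by rewrite -potentialE /interface_gap; lra.
Qed.

(* [rho = 1/2] is the only solution on a short circle: with P the maximum of
   [|2 rho - 1|], Rolle's theorem and [rho 0 = 1/2] yield [P <= 2 K P] *)
Lemma interface_K_ge : 2^-1 <= K.
Proof.
have K2 : S ^+ 2 = K by rewrite sqr_sqrtr// ltW.
have [r0 dr0] : rho 0 = 2^-1 /\ drho 0 < 0 by case: rhoP.
have rS : rho S = rho 0 by rewrite -[S]add0r rho_periodic.
have cont (a b : R) : {within `[a, b], continuous rho}.
  by apply: derivable_within_continuous => x _; have [] := is_derive_rho x.
have mcont : {within `[0, S], continuous (fun x => (2 * rho x - 1) ^+ 2)}.
  apply: derivable_within_continuous => x _.
  have dm : is_derive x 1 (fun x => 2 * rho x - 1) (2 * drho x).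
    have hx := is_derive_rho x.
    by apply: is_derive_eq; rewrite /GRing.scale /= subr0.
  by have [] := @is_deriveX R R (fun x => 2 * rho x - 1) 2 x 1 (2 * drho x) dm.
have [c cin cmax0] := EVT_max (ltW S_gt0) mcont.
set P := `|2 * rho c - 1|.
have cmax x : x \in `[0, S]%R -> `|2 * rho x - 1| <= P.
  move=> xin; have := cmax0 _ xin.
  rewrite -(real_normK (num_real (2 * rho x - 1))) -(real_normK (num_real (2 * rho c - 1))).
  by rewrite ler_sqr ?nnegrE.
have inS x : 0 <= x <= S -> x \in `[0, S]%R by rewrite in_itv.
have P0 : 0 <= P by rewrite /P.
have V_le x : 0 <= x <= S -> `|potential' gamma (rho x)| <= P.
  move=> xS; apply: le_trans (potential_le (rho_itv x)) _.
  exact: cmax (inS _ xS).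
have drv x : x \in `]0, S[%R -> derivable rho x 1.
  by move=> _; have [] := is_derive_rho x.
(* From the critical point [a], the bound [P] on the second derivative gives a slope of at most
   [P S]; integrating once more from 0 yields [P <= 2 P S^2]. *)
have [a] := Rolle S_gt0 drv (cont 0 S) (esym rS).
rewrite in_itv /= => /andP[a0 aS] da.
have da0 : drho a = 0 by have [_ <-] := da; rewrite derive1E.
have dr_le x : 0 <= x <= S -> `|drho x| <= P * S.
  move=> /andP[x0 xS]; have [xa|ax] := leP x a.
    have := @mean_value_le drho _ x a P xa (fun y _ => is_derive_drho y).
    rewrite da0 sub0r normrN => h; apply: le_trans (h _) _.
      by move=> y /andP[xy ya]; apply: V_le; rewrite (le_trans x0 xy) (le_trans ya)// ltW.
    by apply: ler_wpM2l => //; lra.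
  have := @mean_value_le drho _ a x P (ltW ax) (fun y _ => is_derive_drho y).
  rewrite da0 subr0 => h; apply: le_trans (h _) _.
    by move=> y /andP[ay yx]; apply: V_le; rewrite (le_trans (ltW a0) ay) (le_trans yx).
  by apply: ler_wpM2l => //; lra.
have PE : P = 2 * `|rho c - 2^-1|.
  by rewrite /P -[X in X * `|_|]ger0_norm// -normrM; congr `|_|; field.
have PK : P <= 2 * K * P.
  move: cin; rewrite in_itv /= => /andP[c0 cS].
  have := @mean_value_le rho _ 0 c (P * S) c0 (fun y _ => is_derive_rho y).
  rewrite r0 subr0 => h.
  have {}h : `|rho c - 2^-1| <= P * S * c.
    by apply: h => y /andP[y0 yc]; apply: dr_le; rewrite y0 (le_trans yc).
  have : P * S * c <= P * S * S by apply: ler_wpM2l => //; rewrite mulr_ge0// ltW.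
  by rewrite -[P * S * S]mulrA -expr2 K2 => h2; rewrite [X in X <= _]PE; lra.
rewrite leNgt; apply/negP => Ks.
(* If [K < 1/2], then [P = 0] and the slope vanishes everywhere, against its strict sign at 0. *)
have {}P0 : P = 0 by apply/eqP; rewrite eq_le P0 andbT; nra.
have := dr_le 0; rewrite P0 mul0r lexx ltW// => /(_ isT).
by rewrite normr_le0 => /eqP E; move: dr0; rewrite E ltxx.
Qed.

Variables (d N : nat) (i1 : 'I_d).
Implicit Types x : torus d N.

Local Notation u := (interface_profile i1 K rho : torus d N -> R).
Local Notation h := (S / N%:R).
Local Notation pos x := ((x i1 : nat)%:R * S / N%:R).

Lemma profile_gap x : (0 < N)%N -> interface_gap <= u x <= 1 - interface_gap.
Proof.
move=> N_gt0; apply: rho_gap.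
have N0 : 0 < N%:R :> R by rewrite ltr0n.
rewrite divr_ge0 ?mulr_ge0// ?sqrtr_ge0//= ler_pdivrMr// mulrC.
apply: ler_wpM2l; first exact: sqrtr_ge0.
rewrite ler_nat; apply: leq_trans (ltnW (ltn_ord (x i1))) _.
by rewrite prednK.
Qed.

Hypothesis N_ge2 : (2 <= N)%N.

Lemma profile_succ x : u (x + unitv N i1) = rho (pos x + h).
Proof.
have N0 : N%:R != 0 :> R by rewrite pnatr_eq0 -lt0n ltnW.
have NE : N.-1.+1 = N by case: N N_ge2 => [|[|]].
have xN : (x i1 < N)%N by rewrite -[in ltnRHS]NE.
rewrite /interface_profile.
have -> : ((x + unitv N i1)%R i1 : nat) = ((x i1).+1 %% N)%N.
  rewrite ffunE /= unitv_same//; have := ltn_ord (x i1); move: (x i1 : nat) => a.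
  by rewrite addn1 => _; exact: congr1 NE.
have [lt|ge] := ltnP (x i1).+1 N.
  by rewrite modn_small//; congr rho; rewrite -natr1; field.
have E : ((x i1).+1 = N)%N by apply/eqP; rewrite eqn_leq xN ge.
rewrite E modnn -rho_periodic; congr rho.
have Er : (x i1 : nat)%:R + 1 = N%:R :> R by rewrite natr1; exact: congr1 E.
have -> : (x i1 : nat)%:R = N%:R - 1 :> R by rewrite -Er addrK.
by field.
Qed.

Lemma profile_pred x : u (x - unitv N i1) = rho (pos x - h).
Proof.
have N0 : N%:R != 0 :> R by rewrite pnatr_eq0 -lt0n ltnW.
have NE : N.-1.+1 = N by case: N N_ge2 => [|[|]].
pose y := x - unitv N i1; have yN : (y i1 < N)%N by rewrite -[in ltnRHS]NE.
have xy : (x i1 : nat) = ((y i1).+1 %% N)%N.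
  rewrite -[x](subrK (unitv N i1)) -/y ffunE /= unitv_same//.
  by rewrite addn1; exact: congr1 NE.
rewrite -/y /interface_profile.
have [lt|ge] := ltnP (y i1).+1 N.
  by rewrite xy modn_small//; congr rho; rewrite -natr1; field.
have E : ((y i1).+1 = N)%N by apply/eqP; rewrite eqn_leq yN ge.
rewrite xy E modnn -[RHS]rho_periodic; congr rho.
have Er : (y i1 : nat)%:R + 1 = N%:R :> R by rewrite natr1; exact: congr1 E.
have -> : (y i1 : nat)%:R = N%:R - 1 :> R by rewrite -Er addrK.
by field.
Qed.

Lemma profile_transverse (j : 'I_d) x : j != i1 -> u (x + unitv N j) = u x.
Proof.
move=> ji; rewrite /interface_profile ffunE (_ : unitv N j i1 = 0) ?addr0//.
by apply: val_inj; rewrite ffunE eq_sym (negbTE ji) /= mod0n.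
Qed.

Let h_sqr : h ^+ 2 = K / N%:R ^+ 2.
Proof. by rewrite exprMn sqr_sqrtr ?(ltW K_gt0)// exprVn. Qed.

Let h_ge0 : 0 <= h. Proof. by rewrite divr_ge0 ?sqrtr_ge0. Qed.

Lemma profile_grad x : (u (x + unitv N i1) - u x) ^+ 2 <= 4 * K / N%:R ^+ 2.
Proof.
rewrite profile_succ -[leLHS](real_normK (num_real _)).
have := rho_lipschitz (pos x) (pos x + h); rewrite [X in 2 * `|X|]addrAC subrr add0r.
rewrite (ger0_norm h_ge0) => le.
apply: (@le_trans _ _ ((2 * h) ^+ 2)); first by rewrite lerXn2r ?nnegrE// mulr_ge0.
by rewrite exprMn h_sqr mulrA (_ : 2 ^+ 2 = 4)//; ring.
Qed.

(** Two errors of order [K h = K^(3/2) / N]: 32 from the second difference, 16 from the neighbours'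
    magnetizations replacing the local one. The bound [K >= 1/2] then turns [K^3] into [2 K^4]. *)
Lemma profile_drift x : drift u i1 gamma K x ^+ 2 <= 2 * 48 ^+ 2 * K ^+ 4 / N%:R ^+ 2.
Proof.
have N0 : 0 < N%:R :> R by rewrite ltr0n ltnW.
have /andP[g0 g1] := gamma_itv.
have Kge := interface_K_ge.
suff le : `|drift u i1 gamma K x| <= 48 * K * h.
  rewrite -(real_normK (num_real _)).
  apply: (@le_trans _ _ ((48 * K * h) ^+ 2)).
    by rewrite lerXn2r ?nnegrE// mulr_ge0// mulr_ge0// ltW.
  rewrite exprMn h_sqr mulrA; apply: ler_wpM2r; first by rewrite invr_ge0 sqr_ge0.
  have : 0 <= K ^+ 3 by rewrite exprn_ge0// ltW.
  have -> : (48 * K) ^+ 2 * K = 48 ^+ 2 * (K ^+ 3 * 1) by ring.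
  have -> : 2 * 48 ^+ 2 * K ^+ 4 = 48 ^+ 2 * (K ^+ 3 * (2 * K)) by ring.
  by move=> K3; do 2!(apply: ler_wpM2l; rewrite ?sqr_ge0//); lra.
rewrite /drift /mag profile_succ profile_pred.
have -> : u x = rho (pos x) by [].
have sd := second_difference (pos x) h_ge0.
have lp := rho_lipschitz (pos x) (pos x + h); have lm := rho_lipschitz (pos x) (pos x - h).
have Ep : pos x + h - pos x = h by rewrite addrAC subrr add0r.
have Em : pos x - h - pos x = - h by rewrite addrAC subrr add0r.
move: sd lp lm; rewrite Ep Em normrN (ger0_norm h_ge0).
have /andP[] := rho_itv (pos x); have /andP[] := rho_itv (pos x + h).
have /andP[] := rho_itv (pos x - h).
rewrite /potential'.
move: (rho (pos x)) (rho (pos x + h)) (rho (pos x - h)) => r rp rm.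
move=> m0 m1 p0 p1 z0 z1.
set s := 2 * r - 1; set sp := 2 * rp - 1; set sm := 2 * rm - 1.
set V := _ + _ * _ ^+ 3; set q := rp + rm - 2 * r => sd lp lm.
have -> : N%:R ^+ 2 * q + K * (- s * (1 + gamma ^+ 2 * sm * sp) + gamma * (sm + sp)) =
   N%:R ^+ 2 * (q - h ^+ 2 * V) +
   K * (- gamma ^+ 2 * s * (sm * sp - s ^+ 2) + gamma * (sm + sp - 2 * s)).
  by rewrite h_sqr /V -/s; field; rewrite gt_eqF.
have hsp : `|sp - s| <= 4 * h.
  have -> : sp - s = 2 * (rp - r) by rewrite /sp /s; ring.
  by rewrite normrM ger0_norm//; lra.
have hsm : `|sm - s| <= 4 * h.
  have -> : sm - s = 2 * (rm - r) by rewrite /sm /s; ring.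
  by rewrite normrM ger0_norm//; lra.
have s1 : `|s| <= 1 by rewrite /s ler_norml; apply/andP; split; lra.
have sm1 : `|sm| <= 1 by rewrite /sm ler_norml; apply/andP; split; lra.
have gg : gamma ^+ 2 <= 1 by nra.
apply: le_trans (ler_normD _ _) _.
have -> : 48 * K * h = 32 * K * h + K * (16 * h) by ring.
apply: lerD.
  rewrite normrM (ger0_norm (sqr_ge0 _)).
  apply: le_trans (ler_wpM2l (sqr_ge0 _) sd) _.
  rewrite [h ^+ 3]exprS h_sqr le_eqVlt; apply/orP; left; apply/eqP.
  by field; rewrite gt_eqF.
rewrite normrM (ger0_norm (ltW K_gt0)); apply: ler_wpM2l; first exact: ltW.
have h1 : `|sm * sp - s ^+ 2| <= 8 * h.
  have -> : sm * sp - s ^+ 2 = sm * (sp - s) + s * (sm - s) by ring.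
  apply: le_trans (ler_normD _ _) _; rewrite !normrM.
  have : `|sm| * `|sp - s| <= 1 * (4 * h) by apply: ler_pM.
  have : `|s| * `|sm - s| <= 1 * (4 * h) by apply: ler_pM.
  lra.
have h2 : `|- gamma ^+ 2 * s| <= 1.
  rewrite normrM normrN (ger0_norm (sqr_ge0 _)) -[leRHS]mulr1.
  by apply: ler_pM => //; exact: sqr_ge0.
have h3 : `|sm + sp - 2 * s| <= 8 * h.
  have -> : sm + sp - 2 * s = (sm - s) + (sp - s) by ring.
  by apply: le_trans (ler_normD _ _) _; lra.
have h4 : `|- gamma ^+ 2 * s * (sm * sp - s ^+ 2)| <= 1 * (8 * h).
  by rewrite normrM; apply: ler_pM.
have h5 : `|gamma * (sm + sp - 2 * s)| <= 1 * (8 * h).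
  by rewrite normrM; apply: ler_pM => //; rewrite ger0_norm; lra.
by apply: le_trans (ler_normD _ _) _; lra.
Qed.

End Interface.

(** * Entropy production *)

Section Production.
Variables (R : realType) (d N : nat) (u : torus d N -> R).
Variable eps : R.
Hypothesis eps_gt0 : 0 < eps.
Hypothesis u_eps : forall x, eps <= u x <= 1 - eps.
Variables (i1 : 'I_d) (gamma K : R).
Hypothesis gamma01 : 0 <= gamma <= 1.
Hypothesis K_ge0 : 0 <= K.
Variable f : config d N -> R.

(** As [s_0^2 = 1] for the spin at the origin, the rate is the product of [1 - gamma s_0 s_(-e1)]
    and [1 - gamma s_0 s_(e1)], each factor lying between 0 and 2. *)
Lemma flip_rate_itv (eta : config d N) : 0 <= flip_rate i1 gamma eta <= 4.
Proof.
have /andP[g0 g1] := gamma01.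
have spinE x : spin R eta x = if eta x then 1 else -1.
  by rewrite /spin; case: (eta x) => /=; ring.
rewrite /flip_rate !spinE.
by case: (eta _); case: (eta _); case: (eta _); apply/andP; split; nra.
Qed.

Lemma expect_flip_le x : (forall eta, 0 <= f eta) ->
  expect u (fun eta => f (flip x eta)) <= eps^-1 * expect u f.
Proof.
move=> f0; rewrite {1}/expect -(sum_flip x) -expectZ.
apply: ler_sum => eta _; rewrite flipK [leRHS]mulrAC [leRHS]mulrC; apply: ler_wpM2l => //.
exact: product_measure_flip_le.
Qed.

Lemma expect_exchange_le x y : (forall eta, 0 <= f eta) ->
  expect u (fun eta => f (exchange x y eta)) <= eps^-1 ^+ 2 * expect u f.
Proof.
move=> f0; rewrite {1}/expect -(sum_exchange x y) -expectZ.
apply: ler_sum => eta _; rewrite exchangeK [leRHS]mulrAC [leRHS]mulrC; apply: ler_wpM2l => //.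
have i0 : 0 < eps^-1 by rewrite invr_gt0.
have p0 := product_measure_gt0 eps_gt0 u_eps eta.
have i1' : 1 <= eps^-1.
  by rewrite invf_ge1//; have /andP[] := u_eps x; have := eps_gt0; lra.
have [E|E] := eqVneq (eta x) (eta y).
  rewrite exchange_id// -[leLHS]mul1r; apply: ler_wpM2r; first exact: ltW.
  by rewrite exprn_ege1.
have xy : x != y by apply: contraNneq E => ->.
rewrite exchange_flip// expr2 -mulrA.
apply: le_trans (product_measure_flip_le eps_gt0 u_eps _ _) _.
by apply: ler_wpM2l; [exact: ltW|exact: product_measure_flip_le].
Qed.

(** A bound without any cancellation, far too large for big [N]; it serves for [N < 64]. *)
Lemma expect_generator_le : (forall eta, 0 <= f eta) -> expect u f = 1 ->
  expect u (generator i1 gamma K f) <=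
  #|{: torus d N}|%:R * (N%:R ^+ 2 * (d%:R * eps^-1 ^+ 2) + K * (4 * eps^-1)).
Proof.
move=> f0 f1.
have -> : expect u (generator i1 gamma K f) =
   N%:R ^+ 2 * expect u (exclusion_gen f) + K * expect u (glauber_gen i1 gamma f).
  by rewrite -!expectZ -expectD.
have hE (x : torus d N) (j : 'I_d) :
    expect u (fun eta => f (exchange x (x + unitv N j) eta) - f eta) <= eps^-1 ^+ 2.
  rewrite -[leRHS]mulr1 -f1.
  apply: le_trans _ (expect_exchange_le x (x + unitv N j) f0).
  by apply: (ler_expect eps_gt0 u_eps) => eta; rewrite lerBlDr lerDl.
have hG (x : torus d N) : expect u (fun eta => flip_rate i1 gamma (translate x eta) *
    (f (flip x eta) - f eta)) <= 4 * eps^-1.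
  rewrite -[leRHS]mulr1 -[X in _ <= _ * X]f1 -[leRHS]mulrA.
  apply: (@le_trans _ _ (4 * expect u (fun eta => f (flip x eta)))); last first.
    by rewrite ler_pM2l//; exact: expect_flip_le.
  rewrite -expectZ; apply: (ler_expect eps_gt0 u_eps) => eta.
  have /andP[r0 r4] := flip_rate_itv (translate x eta).
  have := f0 (flip x eta); have := f0 eta.
  move: (flip_rate i1 gamma _) r0 r4 => r r0 r4 ? ?; nra.
rewrite mulrDr (mulrCA _ (N%:R ^+ 2)) (mulrCA _ K); apply: lerD.
  apply: ler_wpM2l; first exact: sqr_ge0.
  rewrite /exclusion_gen expect_sum.
  apply: (@le_trans _ _ (\sum_(x : torus d N) d%:R * eps^-1 ^+ 2)).
    apply: ler_sum => x _; rewrite expect_sum.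
    apply: le_trans (ler_sum _ (fun j _ => hE x j)) _.
    by rewrite sumr_const card_ord -[leLHS]mulr_natl.
  by rewrite sumr_const -[leLHS]mulr_natl.
apply: ler_wpM2l => //.
rewrite /glauber_gen expect_sum.
apply: le_trans (ler_sum _ (fun x _ => hG x)) _.
by rewrite sumr_const -[leLHS]mulr_natl.
Qed.

(** The inequality [ln y <= y - 1] is applied to the ratio of the square roots rather than to
    [b / a]; this gains the squared difference. *)
Lemma mul_ln_diff_le (a b : R) : 0 < a -> 0 < b ->
  a * (ln b - ln a) <= b - a - (Num.sqrt b - Num.sqrt a) ^+ 2.
Proof.
move=> a0 b0.
have root c : 0 < c -> exists2 p : R, 0 < p & Num.sqrt c = p /\ c = p ^+ 2.
  by move=> c0; exists (Num.sqrt c); rewrite ?sqrtr_gt0// sqr_sqrtr// ltW.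
have [p p0 [-> ->]] := root a a0; have [q q0 [-> ->]] := root b b0.
rewrite !lnXn//.
have := @le_ln1Dx R (q / p - 1); rewrite [1 + _]addrC subrK ln_div ?posrE//.
have qp : 0 < q / p by rewrite divr_gt0.
move=> /(_ ltac:(lra)) h.
have := ler_wpM2l (sqr_ge0 p) h; rewrite [X in _ <= X]mulrBr mulr1.
have -> : p ^+ 2 * (q / p) = p * q by field; rewrite gt_eqF.
move=> {}h.
have -> : q ^+ 2 - p ^+ 2 - (q - p) ^+ 2 = 2 * (p * q - p ^+ 2) by ring.
have -> : p ^+ 2 * (ln q *+ 2 - ln p *+ 2) = 2 * (p ^+ 2 * (ln q - ln p)) by ring.
by rewrite ler_pM2l.
Qed.

(** The gain is kept for the exchanges and discarded for the flips. The Dirichlet form appears with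
    the coefficient [N^2] that [energy_estimate] consumes. *)
Lemma entropy_production : (forall eta, 0 < f eta) ->
  expect u (fun eta => f eta * generator i1 gamma K (fun zeta => ln (f zeta)) eta) <=
  expect u (generator i1 gamma K f) -
  N%:R ^+ 2 * (\sum_(x : torus d N) \sum_(j < d) dirichlet_bond u f x (x + unitv N j)).
Proof.
move=> f0.
have -> : \sum_(x : torus d N) \sum_(j < d) dirichlet_bond u f x (x + unitv N j) =
   expect u (fun eta => \sum_(x : torus d N) \sum_(j < d)
     (Num.sqrt (f (exchange x (x + unitv N j) eta)) - Num.sqrt (f eta)) ^+ 2).
  by rewrite expect_sum; apply: eq_bigr => x _; rewrite expect_sum.
rewrite -mulNr -expectZ -expectD; apply: (ler_expect eps_gt0 u_eps) => eta.
rewrite /generator mulrDr mulNr addrAC; apply: lerD.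
  rewrite mulrCA -mulrBr; apply: ler_wpM2l; first exact: sqr_ge0.
  rewrite /exclusion_gen mulr_sumr -sumrB; apply: ler_sum => x _.
  by rewrite mulr_sumr -sumrB; apply: ler_sum => j _; exact: mul_ln_diff_le.
rewrite mulrCA; apply: ler_wpM2l => //.
rewrite /glauber_gen mulr_sumr; apply: ler_sum => x _.
rewrite mulrCA; apply: ler_wpM2l; first by have /andP[] := flip_rate_itv (translate x eta).
by apply: le_trans (mul_ln_diff_le _ _) _ => //; rewrite gerBl sqr_ge0.
Qed.

End Production.

(** * Markov semigroups on a finite state space *)

Lemma is_derive_fin_sum (R : realType) (I : finType) (h : I -> R -> R) (dh : I -> R) (t : R) :
  (forall i, is_derive t 1 (h i) (dh i)) ->
  is_derive t 1 (fun s => \sum_i h i s) (\sum_i dh i).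
Proof.
move=> hd.
suff main (r : seq I) : is_derive t 1 (fun s => \sum_(i <- r) h i s) (\sum_(i <- r) dh i).
  exact: main.
elim: r => [|i r IH].
  rewrite big_nil (_ : (fun s => _) = cst 0); first exact: is_derive_cst.
  by apply/funext => s; rewrite big_nil.
rewrite big_cons (_ : (fun s => _) = (h i + (fun s => \sum_(i <- r) h i s)))//.
  by apply: is_deriveD.
by apply/funext => s; rewrite big_cons.
Qed.

Section LinearSemigroup.
Variables (R : realType) (d N : nat).
Local Notation fct := (config d N -> R).
Implicit Types (L : fct -> fct) (f g : fct) (eta zeta xi : config d N).

Definition linear_op L : Prop := forall (a : R) f g,
  L (fun eta => a * f eta + g eta) = fun eta => a * L f eta + L g eta.

Definition point_mass zeta : fct := fun xi => (xi == zeta)%:R.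

Lemma linear_op0 L : linear_op L -> L (fun=> 0) = fun=> 0.
Proof.
move=> HL; have := HL 1 (fun=> 0) (fun=> 0).
have -> : (fun _ : config d N => 1 * 0 + 0 : R) = fun=> 0.
  by apply/funext => eta; rewrite mulr0 addr0.
move=> E; apply/funext => eta; have := congr1 (fun F : fct => F eta) E.
by rewrite mul1r => /eqP; rewrite -subr_eq subrr => /eqP.
Qed.

Lemma linear_op_sum L (HL : linear_op L) f eta :
  L f eta = \sum_zeta f zeta * L (point_mass zeta) eta.
Proof.
have E : f = fun xi => \sum_(zeta <- index_enum (config d N)) f zeta * point_mass zeta xi.
  apply/funext => xi; rewrite (bigD1 xi)//= big1 ?addr0 => [|z zx].
    by rewrite /point_mass eqxx mulr1.
  by rewrite /point_mass eq_sym (negbTE zx) mulr0.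
rewrite [in LHS]E; elim: (index_enum _) => [|z r IH].
  by under eq_fun do rewrite big_nil; rewrite linear_op0// big_nil.
by under eq_fun do rewrite big_cons; rewrite HL big_cons IH.
Qed.

Lemma linear_op_iter L k : linear_op L -> linear_op (iter k L).
Proof. by move=> HL a f g; elim: k => //= k ->; rewrite HL. Qed.

Variable L : fct -> fct.
Hypothesis HL : linear_op L.

Let norm1 f := \sum_zeta `|f zeta|.
Let opnorm := \sum_eta \sum_zeta `|L (point_mass zeta) eta|.

Let opnorm_ge0 : 0 <= opnorm.
Proof. by do 2!(apply: sumr_ge0 => ? _). Qed.

Let norm1_ge0 f : 0 <= norm1 f.
Proof. exact: sumr_ge0. Qed.

Let norm1_le f : norm1 (L f) <= opnorm * norm1 f.
Proof.
rewrite /opnorm mulr_suml; apply: ler_sum => eta _.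
rewrite (linear_op_sum HL) mulr_suml; apply: le_trans (ler_norm_sum _ _ _) _.
apply: ler_sum => z _; rewrite normrM mulrC; apply: ler_wpM2l => //.
by rewrite /norm1 (bigD1 z)//= lerDl sumr_ge0.
Qed.

Let iter_le f k eta : `|iter k L f eta| <= opnorm ^+ k * norm1 f.
Proof.
apply: (@le_trans _ _ (norm1 (iter k L f))).
  by rewrite /norm1 (bigD1 eta)//= lerDl sumr_ge0.
elim: k => [|k IH] /=; first by rewrite expr0 mul1r.
by apply: le_trans (norm1_le _) _; rewrite exprS -mulrA ler_wpM2l.
Qed.

Let coef f eta k : R := (k`!%:R)^-1 * iter k L f eta.

Let semigroupE t f eta : semigroup L t f eta = limn (pseries (coef f eta) t).
Proof.
rewrite /semigroup /pseries; congr (limn (series _)); apply/funext => k.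
by rewrite /coef [RHS]mulrC mulrA.
Qed.

Let coef_cvg f eta (t : R) : cvgn (pseries (coef f eta) t).
Proof.
apply: normed_cvg; apply: (@series_le_cvg _ _ (norm1 f *: exp_coeff (opnorm * `|t|))).
- by move=> n; rewrite normr_ge0.
- move=> n; apply: mulr_ge0 => //; apply: exp_coeff_ge0.
  by rewrite mulr_ge0.
- move=> n; rewrite [leLHS]/= /coef !normrM normrX normfV normr_nat.
  have -> : (norm1 f *: exp_coeff (opnorm * `|t|)) n =
      n`!%:R^-1 * (opnorm ^+ n * norm1 f) * `|t| ^+ n.
    transitivity (norm1 f * ((opnorm * `|t|) ^+ n / n`!%:R)); first by [].
    by rewrite exprMn; ring.
  by apply: ler_wpM2r; [exact: exprn_ge0|apply: ler_wpM2l; rewrite ?invr_ge0].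
- exact/is_cvg_seriesZ/is_cvg_series_exp_coeff.
Qed.

Let coef_diffs f eta : pseries_diffs (coef f eta) = coef (L f) eta.
Proof.
apply/funext => k; rewrite /pseries_diffs /coef -iterSr factS natrM invfM.
by rewrite !mulrA divff ?mul1r ?pnatr_eq0.
Qed.

Lemma semigroup0 f eta : semigroup L 0 f eta = f eta.
Proof.
rewrite /semigroup; apply: cvg_lim => //.
(* The partial sum of index 0 is empty; from index 1 on the sequence is constant. *)
rewrite -cvg_shiftS /= (_ : (fun n => _) = cst (f eta)); first exact: cvg_cst.
apply/funext => n; rewrite /series /= big_nat_recl//= fact0 expr0 divr1 mul1r.
by rewrite big1 ?addr0// => k _; rewrite expr0n /= !mul0r.
Qed.

Lemma is_derive_semigroup f eta (t : R) :
  is_derive t 1 (fun s => semigroup L s f eta) (semigroup L t (L f) eta).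
Proof.
rewrite (_ : (fun s => _) = fun s => limn (pseries (coef f eta) s)); last first.
  by apply/funext => s; rewrite semigroupE.
rewrite semigroupE -coef_diffs.
apply: (@pseries_snd_diffs _ _ (`|t| + 1)); rewrite ?coef_diffs; try exact: coef_cvg.
by rewrite [ltRHS]ger0_norm ?addr_ge0// ltrDl.
Qed.

Lemma linear_op_semigroup t : linear_op (semigroup L t).
Proof.
move=> a f g; apply/funext => eta; rewrite !semigroupE.
have -> : pseries (coef (fun xi => a * f xi + g xi) eta) t =
   series (a *: (fun k => coef f eta k * t ^+ k) + (fun k => coef g eta k * t ^+ k)).
  rewrite /pseries; congr series; apply/funext => k.
  transitivity (a * (coef f eta k * t ^+ k) + coef g eta k * t ^+ k); last by [].
  have E := congr1 (fun F : fct => F eta) (linear_op_iter k HL a f g).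
  by rewrite /coef /= E; ring.
rewrite lim_seriesD; first by rewrite lim_seriesZ//; exact: coef_cvg.
  by apply: is_cvg_seriesZ; exact: coef_cvg.
exact: coef_cvg.
Qed.

Hypothesis L_offdiag : forall zeta eta, eta != zeta -> 0 <= L (point_mass zeta) eta.
Hypothesis L_cst : L (fun=> 1) = fun=> 0.
Variable nu : fct.
Hypothesis nu_gt0 : forall eta, 0 < nu eta.
Hypothesis nu_mass : \sum_eta nu eta = 1.

Local Notation mu := (evolved_law L nu).

Lemma evolved_law0 zeta : mu 0 zeta = nu zeta.
Proof.
rewrite /evolved_law (bigD1 zeta)//= big1 ?addr0 => [|z zz].
  by rewrite semigroup0 eqxx mulr1.
by rewrite semigroup0 (negbTE zz) mulr0.
Qed.

(** The forward equation. Term-by-term differentiation yields [S(t) (L g)]; expanding [L g] in point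
    masses expresses the result through the evolved law itself. *)
Lemma is_derive_evolved_law zeta (t : R) :
  is_derive t 1 (fun s => mu s zeta) (\sum_xi mu t xi * L (point_mass zeta) xi).
Proof.
have -> : \sum_xi mu t xi * L (point_mass zeta) xi =
    \sum_eta nu eta * semigroup L t (L (point_mass zeta)) eta.
  under [RHS]eq_bigr do rewrite (linear_op_sum (linear_op_semigroup t)) mulr_sumr.
  rewrite exchange_big; apply: eq_bigr => xi _.
  rewrite /evolved_law mulr_suml; apply: eq_bigr => eta _.
  by rewrite -mulrA; congr (_ * _); exact: mulrC.
apply: is_derive_fin_sum => eta.
have h := is_derive_semigroup (point_mass zeta) eta t.
have := @is_deriveZ _ _ _ (fun s => semigroup L s (point_mass zeta) eta) (nu eta) t 1 _ h.
by [].
Qed.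

Lemma evolved_law_mass (t : R) : \sum_zeta mu t zeta = 1.
Proof.
have hd (s : R) : is_derive s 1 (fun s => \sum_zeta mu s zeta) 0.
  have := is_derive_fin_sum (fun zeta => is_derive_evolved_law zeta s).
  rewrite exchange_big /= big1// => xi _; rewrite -mulr_sumr.
  have := linear_op_sum HL (fun=> 1) xi; rewrite L_cst.
  by under eq_bigr do rewrite mul1r; move=> <-; rewrite mulr0.
have := is_derive_0_is_cst t 0 hd.
by move=> ->; rewrite -nu_mass; apply: eq_bigr => z _; rewrite evolved_law0.
Qed.

Lemma continuous_evolved_law zeta : continuous (fun s : R => mu s zeta).
Proof.
move=> t; apply/differentiable_continuous/derivable1_diffP.
by have [] := is_derive_evolved_law zeta t.
Qed.

Let c := \sum_zeta `|L (point_mass zeta) zeta|.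

(* [e^(c s) mu_s zeta] is nondecreasing as long as [mu] stays positive *)
Lemma evolved_law_gt0_step (t : R) zeta : 0 < t ->
  (forall s xi, 0 <= s < t -> 0 < mu s xi) -> 0 < mu t zeta.
Proof.
move=> t0 hs.
pose p s := expR (c * s) * mu s zeta.
pose dp s := expR (c * s) * (c * mu s zeta + \sum_xi mu s xi * L (point_mass zeta) xi).
have pP (s : R) : is_derive s 1 p (dp s).
  have h := is_derive_evolved_law zeta s.
  have e1 : is_derive s 1 (fun s => expR (c * s)) (c * expR (c * s)).
    have cs : is_derive s 1 (fun s : R => c * s) c.
      by apply: is_derive_eq; rewrite /GRing.scale /= mulr1.
    have := @is_derive1_comp R expR (fun s => c * s) s _ _ (is_derive_expR _) cs.
    by rewrite mulrC.
  have := @is_deriveM R R (fun s => expR (c * s)) (fun s => mu s zeta) s 1 _ _ e1 h.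
  by move=> h3; apply: (is_derive_eq h3); rewrite /dp /GRing.scale /=; ring.
have [|s] := @MVT R p dp 0 t t0 (fun x _ => pP x).
  by apply: derivable_within_continuous => x _; have [] := pP x.
rewrite in_itv /= => /andP[s0 st]; rewrite /p mulr0 expR0 mul1r evolved_law0 subr0 => E.
have dp0 : 0 <= dp s.
  have ms xi : 0 < mu s xi by apply: hs; rewrite (ltW s0).
  rewrite /dp mulr_ge0 ?expR_ge0// (bigD1 zeta)//= addrA addr_ge0//.
    rewrite [X in X + _]mulrC -mulrDr mulr_ge0 ?(ltW (ms zeta))//.
    have := ler_norm (- L (point_mass zeta) zeta); rewrite normrN.
    have : `|L (point_mass zeta) zeta| <= c by rewrite /c (bigD1 zeta)//= lerDl sumr_ge0.
    lra.
  apply: sumr_ge0 => xi xz; rewrite mulr_ge0 ?(ltW (ms xi))//; exact: L_offdiag.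
have : 0 < expR (c * t) * mu t zeta.
  by rewrite -[ltRHS](subrK (nu zeta)) E ltr_wpDl// mulr_ge0// ltW.
by rewrite pmulr_rgt0// expR_gt0.
Qed.

(** At the infimum of the times where positivity fails it still holds, by the preceding step;
    continuity and the finiteness of the state space extend it beyond, a contradiction. It is needed
    to differentiate the logarithm of the density. *)
Lemma evolved_law_gt0 (t : R) zeta : 0 <= t -> 0 < mu t zeta.
Proof.
move=> t0; apply: contrapT => /negP nt.
pose A := [set s : R | 0 <= s /\ exists xi, ~~ (0 < mu s xi)].
have At : A t by split=> //; exists zeta.
have A_lb : has_inf A by split; [exists t|exists 0 => s []].
pose t1 := inf A.
have lbA (s : R) : A s -> t1 <= s.
  by move=> As; apply: ge_inf => //; exists 0 => y [].
have t1_ge0 : 0 <= t1 by apply: lb_le_inf; [exists t|move=> s []].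
have before s xi : 0 <= s < t1 -> 0 < mu s xi.
  move=> /andP[s0 st1]; apply: contrapT => /negP ns.
  have : t1 <= s by apply: lbA; split=> //; exists xi.
  by rewrite leNgt st1.
have at_t1 xi : 0 < mu t1 xi.
  move: t1_ge0; rewrite le_eqVlt => /predU1P[<-|t1_gt0].
    by rewrite evolved_law0.
  exact: evolved_law_gt0_step.
have nearby : \forall s \near t1, forall xi, 0 < mu s xi.
  apply: (@filter_forall _ _ (fun xi s => 0 < mu s xi) (nbhs t1)) => xi.
  have := @continuous_evolved_law xi t1; move/cvgr_gt; apply; exact: at_t1.
have [e /= e0 he] := nearby.
have [s [s0 [xi nx]] se] := inf_adherent e0 A_lb.
have ts : t1 <= s by apply: lbA; split=> //; exists xi.
case/negP: nx; apply: he; rewrite /= ltr_distlC; apply/andP; split.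
  by apply: lt_le_trans ts; rewrite ltrBlDr ltrDl.
exact: se.
Qed.

Variables (a B : R).
Hypothesis B_ge0 : 0 <= B.
Hypothesis production : forall f, (forall eta, 0 < f eta) ->
  \sum_eta f eta * nu eta = 1 ->
  \sum_eta f eta * L (fun zeta => ln (f zeta)) eta * nu eta <= a * (entropy nu f + B).

Local Notation f t := (density L nu t).

(** Conservation of mass cancels the term from differentiating the logarithm, which leaves the left
    side of [production]. The Gronwall argument runs on [entropy + B], equal to [B] at time 0. *)
Lemma entropy_gronwall (t : R) : 0 <= t -> entropy nu (f t) <= B * expR (a * t).
Proof.
move=> t0.
have nu0 eta : nu eta != 0 by rewrite gt_eqF.
have HE s : entropy nu (f s) = \sum_zeta mu s zeta * ln (mu s zeta / nu zeta).
  by apply: eq_bigr => eta _; rewrite /density mulrAC divfK.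
pose dH s := \sum_eta f s eta * L (fun zeta => ln (f s zeta)) eta * nu eta.
have HP (s : R) : 0 <= s -> is_derive s 1 (fun s => entropy nu (f s)) (dH s).
  move=> s0.
  rewrite (_ : (fun s => _) = fun s => \sum_zeta mu s zeta * ln (mu s zeta / nu zeta));
    last by apply/funext => r; rewrite HE.
  pose dmu zeta := \sum_xi mu s xi * L (point_mass zeta) xi.
  have m0 zeta := evolved_law_gt0 zeta s0.
  have -> : dH s = \sum_zeta dmu zeta * (ln (mu s zeta / nu zeta) + 1).
    rewrite /dH.
    transitivity (\sum_eta \sum_zeta mu s eta * (ln (f s zeta) * L (point_mass zeta) eta)).
      apply: eq_bigr => eta _.
      rewrite {1}/density mulrAC divfK// (linear_op_sum HL (fun zeta => ln (f s zeta))).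
      by rewrite mulr_sumr.
    have dm : \sum_zeta dmu zeta = 0.
      rewrite /dmu exchange_big /= big1// => xi _; rewrite -mulr_sumr.
      have := linear_op_sum HL (fun=> 1) xi; rewrite L_cst.
      by under eq_bigr do rewrite mul1r; move=> <-; rewrite mulr0.
    under [RHS]eq_bigr do rewrite mulrDr mulr1.
    rewrite big_split /= dm addr0 exchange_big; apply: eq_bigr => zeta _.
    by rewrite /dmu mulr_suml; apply: eq_bigr => xi _; rewrite /density; ring.
  apply: is_derive_fin_sum => zeta.
  have h := is_derive_evolved_law zeta s; rewrite -/(dmu zeta) in h.
  have h1 : is_derive s 1 (fun s => mu s zeta / nu zeta) (dmu zeta / nu zeta).
    have h2 := @is_deriveZ _ _ _ (fun s => mu s zeta) (nu zeta)^-1 s 1 _ h.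
    rewrite (_ : (fun s => _) = (nu zeta)^-1 *: (fun s => mu s zeta)); last first.
      by apply/funext => r; rewrite mulrC.
    by apply: (is_derive_eq h2); rewrite mulrC.
  have q0 : 0 < mu s zeta / nu zeta by rewrite divr_gt0.
  have h3 := @is_derive1_comp R (@ln R) (fun s => mu s zeta / nu zeta) s _ _
    (is_derive1_ln q0) h1.
  have h4 := @is_deriveM R R (fun s => mu s zeta) (fun s => ln (mu s zeta / nu zeta)) s 1 _ _ h h3.
  apply: (is_derive_eq h4); rewrite /GRing.scale /=.
  by field; rewrite (gt_eqF (m0 zeta)) nu0.
pose G s := expR (- (a * s)) * (entropy nu (f s) + B).
pose dG s := expR (- (a * s)) * (dH s - a * (entropy nu (f s) + B)).
have GP (s : R) : 0 <= s -> is_derive s 1 G (dG s).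
  move=> s0.
  have e1 : is_derive s 1 (fun s => expR (- (a * s))) (- a * expR (- (a * s))).
    have cs : is_derive s 1 (fun s : R => - (a * s)) (- a).
      by apply: is_derive_eq; rewrite /GRing.scale /= mulr1.
    have := @is_derive1_comp R expR (fun s => - (a * s)) s _ _ (is_derive_expR _) cs.
    by rewrite mulrC.
  have h2 : is_derive s 1 (fun s => entropy nu (f s) + B) (dH s).
    have h := HP s s0.
    have := @is_deriveD _ _ _ (fun s => entropy nu (f s)) (cst B) s 1 _ _ h (is_derive_cst B s 1).
    by rewrite addr0.
  have h3 := @is_deriveM R R (fun s => expR (- (a * s))) (fun s => entropy nu (f s) + B) s 1 _ _ e1 h2.
  by apply: (is_derive_eq h3); rewrite /dG /GRing.scale /=; ring.
have dG0 s : 0 <= s -> dG s <= 0.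
  move=> s0; rewrite /dG pmulr_rle0 ?expR_gt0// subr_le0; apply: production.
    by move=> eta; rewrite /density divr_gt0// evolved_law_gt0.
  by rewrite -(evolved_law_mass s); apply: eq_bigr => eta _; rewrite /density divfK.
have H0 : entropy nu (f 0) = 0.
  rewrite HE big1// => z _; rewrite evolved_law0 divff// ln1 mulr0.
  by [].
have GB : G t <= B.
  have -> : B = G 0 by rewrite /G H0 mulr0 oppr0 expR0 mul1r add0r.
  have [||s] := @MVT_segment R G dG 0 t t0.
  - by move=> s; rewrite in_itv /= => /andP[s0 _]; apply: GP; exact: ltW.
  - apply: derivable_within_continuous => s; rewrite in_itv /= => /andP[s0 _].
    by have [] := GP s s0.
  rewrite in_itv /= => /andP[s0 st] E.
  rewrite -subr_le0 E mulr_le0_ge0 ?dG0// subr0.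
  exact: t0.
have : entropy nu (f t) + B <= B * expR (a * t).
  by move: GB; rewrite /G expRN mulrC ler_pdivrMr ?expR_gt0.
by have := B_ge0; lra.
Qed.

End LinearSemigroup.

(** * The differential inequality *)

Section Assembly.
Variable R : realType.

Lemma card_torus d N : (0 < N)%N -> #|{: torus d N}| = (N ^ d)%N.
Proof. by move=> N0; rewrite card_ffun !card_ord prednK. Qed.

Section Generator.
Variables (d N : nat) (i1 : 'I_d) (gamma K : R).
Hypothesis gamma01 : 0 <= gamma <= 1.
Hypothesis K_ge0 : 0 <= K.

Local Notation L := (@generator R d N i1 gamma K).

Lemma linear_op_generator : linear_op L.
Proof.
move=> a f g; apply/funext => eta; rewrite /generator /exclusion_gen /glauber_gen.
set Ef := \sum_(x : torus d N) \sum_(j < d) (f _ - _).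
set Eg := \sum_(x : torus d N) \sum_(j < d) (g _ - _).
set Gf := \sum_(x : torus d N) _ * (f _ - _).
set Gg := \sum_(x : torus d N) _ * (g _ - _).
have -> : \sum_(x : torus d N) \sum_(j < d) (a * f (exchange x (x + unitv N j) eta) +
    g (exchange x (x + unitv N j) eta) - (a * f eta + g eta)) = a * Ef + Eg.
  rewrite /Ef /Eg mulr_sumr -big_split; apply: eq_bigr => x _.
  by rewrite mulr_sumr -big_split; apply: eq_bigr => j _ /=; ring.
have -> : \sum_x flip_rate i1 gamma (translate x eta) *
    (a * f (flip x eta) + g (flip x eta) - (a * f eta + g eta)) = a * Gf + Gg.
  by rewrite /Gf /Gg mulr_sumr -big_split; apply: eq_bigr => x _ /=; ring.
by ring.
Qed.

Lemma generator_offdiag (zeta eta : config d N) : eta != zeta ->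
  0 <= L (point_mass R zeta) eta.
Proof.
move=> ne; have p0 : point_mass R zeta eta = 0 :> R by rewrite /point_mass (negbTE ne).
rewrite /generator /exclusion_gen /glauber_gen; apply: addr_ge0; apply: mulr_ge0 => //.
- by do 2!(apply: sumr_ge0 => ? _); rewrite p0 subr0 /point_mass ler0n.
- apply: sumr_ge0 => x _; rewrite p0 subr0; apply: mulr_ge0; last by rewrite /point_mass ler0n.
  by have /andP[] := flip_rate_itv i1 gamma01 (translate x eta).
Qed.

Lemma generator_cst : L (fun=> 1) = fun=> 0.
Proof.
apply/funext => eta; rewrite /generator /exclusion_gen /glauber_gen.
rewrite big1 => [|x _]; last by rewrite big1// => j _; rewrite subrr.
by rewrite big1 => [|x _]; rewrite ?subrr ?mulr0 ?addr0.
Qed.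

End Generator.

Lemma expR1_le4 : expR 1 <= 4 :> R.
Proof.
have h : 1 + - 2^-1 <= expR (- 2^-1) :> R by exact: expR_ge1Dx.
have e : expR 1 * expR (- 2^-1) ^+ 2 = 1 :> R.
  by rewrite -expRM_natl -expRD (_ : 1 + 2%:R * - 2^-1 = 0) ?expR0//; field.
have e0 : 0 < expR 1 :> R by exact: expR_gt0.
have : 4^-1 <= expR (- 2^-1) ^+ 2 :> R.
  have -> : 4^-1 = 2^-1 ^+ 2 :> R by field.
  by rewrite lerXn2r ?nnegrE ?expR_ge0//; lra.
by move: e; move: (expR (- 2^-1) ^+ 2) => x e hx; nra.
Qed.

(** For [d = 2], either [l <= e <= 4], or [ln l >= 1] and the defining equation gives [l^3 <= N^2].
    For [d >= 3] the last bound is an equality. *)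
Lemma block_size_le d N (l : R) : (0 < d)%N -> (0 < N)%N -> block_size d N l ->
  [/\ 0 < l, d = 1%N -> l <= N%:R &
      (1 < d)%N -> l ^+ d <= 16 \/ (l ^+ d) ^+ 3 <= N%:R ^+ 4].
Proof.
move=> + N0; have N1 : 1 <= N%:R :> R by rewrite ler1n.
have Np : 0 < N%:R :> R by rewrite ltr0n.
case: d => [//|[|[|d]]] _.
- move=> /= ->; split=> //; first exact: powR_gt0.
  move=> _; rewrite -[leRHS]powRr1//; apply: ler_powR => //; lra.
- move=> /= E; have N2 : 0 < N%:R ^+ 2 :> R by rewrite exprn_gt0.
  (* The default value [ln l = 0] for [l <= 0] would force [N^2 = 0]. *)
  have l0 : 0 < l.
    rewrite ltNge; apply/negP => l0; move: E; rewrite ln0// mulr0 => E.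
    by rewrite -E ltxx in N2.
  split=> // _; have [le|/ltW ge] := leP l (expR 1).
    left; have l4 := le_trans le expR1_le4.
    have -> : 16 = 4 ^+ 2 :> R by ring.
    by rewrite lerXn2r ?nnegrE// ltW.
  right; rewrite -exprM mulnC exprM (_ : 4%N = (2 * 2)%N)// [leRHS]exprM.
  rewrite lerXn2r ?nnegrE ?sqr_ge0 ?exprn_ge0 ?(ltW l0)//.
  rewrite -E ler_peMr ?exprn_ge0 ?(ltW l0)//.
  by rewrite -(expRK 1) ler_ln ?posrE ?expR_gt0.
- move=> /= ->; split=> //; first exact: powR_gt0.
  move=> _; right; rewrite -exprM -powR_mulrn ?powR_ge0// -powRrM -powR_mulrn//.
  rewrite (_ : 4 / (3 * d.+3%:R) * (d.+3 * 3)%:R = 4%:R)//.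
  have : d.+3%:R != 0 :> R by rewrite pnatr_eq0.
  by rewrite natrM; move: (d.+3%:R) => x x0; field.
Qed.

Lemma le_of_exprn_le (a b : R) (n : nat) : 0 <= a -> 0 <= b -> (0 < n)%N ->
  a ^+ n <= b ^+ n -> a <= b.
Proof. by move=> a0 b0 n0; rewrite ler_pXn2r ?nnegrE. Qed.

Lemma small_block_size d N (l : R) : (0 < d)%N -> (0 < N)%N -> block_size d N l ->
  0 < l /\ l ^+ d <= 16 * N%:R ^+ 2.
Proof.
move=> d0 N0 /(block_size_le d0 N0)[l0 h1 h2]; split=> //.
have N1 : 1 <= N%:R :> R by rewrite ler1n.
have [d1|d1] := ltnP 1 d; last first.
  have E : d = 1%N by apply/eqP; rewrite eqn_leq d1.
  by rewrite E expr1; have := h1 E; nra.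
have N2 : 1 <= N%:R ^+ 2 :> R by rewrite exprn_ege1.
have [h|h] := h2 d1; first by lra.
suff : l ^+ d <= N%:R ^+ 2 by lra.
apply: (@le_of_exprn_le _ _ 3) => //; rewrite ?exprn_ge0 ?(ltW l0)//.
apply: le_trans h _; rewrite -exprM; apply: ler_weXn2l => //.
Qed.

(* For [d >= 2] two transverse directions of length [N^(2/3)] suffice. *)
Lemma transport_box d (i1 : 'I_d) N (l : R) : (64 <= N)%N -> block_size d N l ->
  exists (j2 : 'I_d) (m1 m2 : nat),
    [/\ [/\ (0 < m1)%N, (0 < m2)%N & (m2 <= m1)%N],
        ((m1.+2).*2 <= N)%N, (i1 != j2) || (m2 == 1%N),
        (m1 * (m1 * m2) <= N ^ 2)%N & l ^+ d <= 16 * (m1 * m2)%:R].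
Proof.
move=> N64; have d0 : (0 < d)%N by apply: leq_ltn_trans (ltn_ord i1).
have N0 : (0 < N)%N by apply: leq_trans N64.
move=> /(block_size_le d0 N0)[l0 h1 h2].
have [d1|d1] := ltnP 1 d; last first.
  have E : d = 1%N by apply/eqP; rewrite eqn_leq d1.
  (* The length [N / 8] leaves room for twice the window width, while [16 m1 >= N]. *)
  exists i1, (N %/ 8)%N, 1%N; rewrite orbT muln1.
  have m8 : (8 <= N %/ 8)%N by rewrite leq_divRL.
  have hN := divn_eq N 8; have hr := ltn_pmod N (isT : 0 < 8)%N.
  split=> //; first by split=> //; apply: leq_trans m8.
  - by move: m8 hN hr; lia.
  - by rewrite leq_mul// leq_div.
  - rewrite E expr1; apply: le_trans (h1 E) _.
    by rewrite -natrM ler_nat; move: m8 hN hr; lia.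
have [m hm hmax] : exists2 m, (m ^ 3 <= N ^ 2)%N & (N ^ 2 < m.+1 ^ 3)%N.
  have ex : exists m, (m ^ 3 <= N ^ 2)%N by exists 0%N.
  have ub m : (m ^ 3 <= N ^ 2)%N -> (m <= N ^ 2)%N.
    by apply: leq_trans; case: m => // m; rewrite expnS leq_pmulr.
  have [m hm max_m] := ex_maxnP ex ub.
  by exists m => //; rewrite ltnNge; apply/negP => /max_m; rewrite ltnn.
(* The threshold 64 originates here: [64^2 = 16^3]. In turn [m >= 16] gives [16 m^2 <= m^3 <= N^2],
   so the box occupies at most a quarter of the side. *)
have m16 : (16 <= m)%N.
  rewrite leqNgt; apply/negP => m16.
  have : (m.+1 ^ 3 <= 16 ^ 3)%N by rewrite leq_exp2r.
  have : (64 ^ 2 <= N ^ 2)%N by rewrite leq_exp2r.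
  by move: hmax; move: (m.+1 ^ 3)%N (N ^ 2)%N; lia.
have m4 : (4 * m <= N)%N.
  rewrite leqNgt; apply/negP => m4.
  have : (N ^ 2 < (4 * m) ^ 2)%N by rewrite ltn_exp2r.
  have : (16 * m ^ 2 <= m ^ 3)%N by rewrite [(m ^ 3)%N]expnS leq_mul2r m16 orbT.
  have -> : ((4 * m) ^ 2 = 16 * m ^ 2)%N by rewrite expnMn.
  by move: hm; lia.
have nontriv : exists j2 : 'I_d, i1 != j2.
  have [E|ne] := eqVneq (i1 : nat) 0%N.
    by exists (Ordinal d1); apply/eqP => /(congr1 val) /=; rewrite E.
  by exists (Ordinal d0); apply: contraNneq ne => ->.
have [j2 ij] := nontriv; exists j2, m, m; rewrite ij; split=> //.
- by split=> //; apply: leq_trans m16.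
- by move: m4 m16; lia.
have m1 : 1 <= m%:R :> R by rewrite ler1n; apply: leq_trans m16.
have mm : 1 <= (m * m)%:R :> R by rewrite ler1n muln_gt0 andbb; apply: leq_trans m16.
have [h|h] := h2 d1; first by lra.
suff : l ^+ d <= 4 * (m * m)%:R by lra.
apply: (@le_of_exprn_le _ _ 3) => //; rewrite ?exprn_ge0 ?(ltW l0)//.
apply: le_trans h _.
have NR : N%:R ^+ 2 <= 8 * m%:R ^+ 3 :> R.
  have : (N ^ 2 <= 8 * m ^ 3)%N.
    apply: leq_trans (ltnW hmax) _; rewrite (_ : 8 = 2 ^ 3)%N// -expnMn leq_exp2r//.
    by move: m16; lia.
  by rewrite -(ler_nat R) natrM !natrX.
have -> : N%:R ^+ 4 = (N%:R ^+ 2) ^+ 2 :> R by rewrite -exprM.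
have -> : (4 * (m * m)%:R) ^+ 3 = (8 * m%:R ^+ 3) ^+ 2 :> R by rewrite natrM; ring.
by rewrite lerXn2r ?nnegrE ?sqr_ge0// mulr_ge0// exprn_ge0.
Qed.

(** The first summand covers [N >= 64], with 4 and [2 * 48^2] from [profile_grad] and
    [profile_drift] and 16 from the volume of the box. The second covers [N < 64], with [1 <= 4 K^2]
    and [K <= 2 K^2]. *)
Definition growth_cst (d : nat) (gamma : R) : R :=
  16 * energy_cst (interface_gap gamma) 4 (2 * 48 ^+ 2) +
  16 * 64 ^+ 2 * (4 * 64 ^+ 2 * d%:R * (interface_gap gamma)^-1 ^+ 2 +
    8 * (interface_gap gamma)^-1).

Lemma entropy_rate (d N : nat) (i1 : 'I_d) (gamma K l : R) (rho : R -> R)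
    (f : config d N -> R) :
    1 / 2 < gamma < 1 -> 0 < K -> stationary_interface gamma K rho ->
    (0 < N)%N -> block_size d N l ->
    (forall eta, 0 < f eta) ->
    expect (interface_profile i1 K rho : torus d N -> R) f = 1 ->
  expect (interface_profile i1 K rho) (fun eta => f eta *
    generator i1 gamma K (fun zeta => ln (f zeta)) eta) <=
  growth_cst d gamma * K ^+ 2 *
    (entropy (product_measure (interface_profile i1 K rho)) f + (N%:R / l) ^+ d).
Proof.
move=> g01 K0 rhoP N0 hl f0 f1; set u := interface_profile _ _ _ in f1 *.
have d0 : (0 < d)%N by apply: leq_ltn_trans (ltn_ord i1).
set eps := interface_gap gamma.
have eps0 : 0 < eps := interface_gap_gt0 g01.
have u_eps x : eps <= u x <= 1 - eps by exact: (profile_gap g01 K0 rhoP).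
have K12 : 2^-1 <= K := interface_K_ge g01 K0 rhoP.
have g01' : 0 <= gamma <= 1 by case/andP: g01 => ? ?; apply/andP; split; lra.
have fge0 eta : 0 <= f eta by exact: ltW.
have H0 : 0 <= entropy (product_measure u) f := entropy_ge0 eps0 u_eps fge0 f1.
have [l0 lN] := small_block_size d0 N0 hl.
have ld0 : 0 < l ^+ d by exact: exprn_gt0.
have B0 : 0 <= (N%:R / l) ^+ d by rewrite exprn_ge0// divr_ge0// ltW.
have NlE : (N%:R / l) ^+ d = N%:R ^+ d / l ^+ d by rewrite exprMn exprVn.
have Nd0 : 0 <= N%:R ^+ d :> R by exact: exprn_ge0.
have M0 : 0 <= 2 * 48 ^+ 2 :> R by rewrite mulr_ge0 ?sqr_ge0.
have ec0 := energy_cst_ge0 eps0 (ler0n R 4) M0.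
have cr0 : 0 <= 4 * 64 ^+ 2 * d%:R * eps^-1 ^+ 2 + 8 * eps^-1.
  by rewrite addr_ge0// mulr_ge0 ?invr_ge0 ?(ltW eps0)// ?sqr_ge0// mulr_ge0.
have K20 : 0 <= K ^+ 2 by exact: sqr_ge0.
apply: le_trans (entropy_production eps0 u_eps i1 g01' (ltW K0) f0) _.
(* For [N < 64] the Dirichlet term is dropped; as [l^d <= 16 N^2], the volume [N^d] is within a
   constant of [(N/l)^d]. *)
have [N64|N64] := leqP 64 N.
  have [j2 [m1 [m2 [[m10 m20 m21] NL tr cost hbox]]]] := transport_box i1 N64 hl.
  have N2 : (1 < N)%N by apply: leq_trans N64.
  have tv j (x : torus d N) : j != i1 -> u (x + unitv N j) = u x.
    exact: profile_transverse.
  have est := energy_estimate eps0 u_eps N2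
    tv
    K12 fge0 f1 m10 m20 m21 NL tr cost g01' _ (profile_grad g01 K0 rhoP i1 N2)
    _ (profile_drift g01 K0 rhoP i1 N2).
  have {}est := est (ler0n R 4) M0.
  rewrite lerBlDl; apply: le_trans est _; rewrite lerD2l.
  have mm0 : 0 < (m1 * m2)%:R :> R by rewrite ltr0n muln_gt0 m10.
  have vol_le : #|{: torus d N}|%:R / (m1 * m2)%:R <= 16 * (N%:R / l) ^+ d.
    rewrite card_torus// natrX NlE mulrA ler_pdivrMr// mulrAC ler_pdivlMr//.
    by rewrite [16 * _]mulrC -mulrA; apply: ler_wpM2l.
  rewrite /growth_cst -/eps.
  move: vol_le; move: (#|_|%:R / _) => v vol_le.
  move: H0 B0 vol_le; move: (entropy _ f) ((N%:R / l) ^+ d) => h b h0 b0 vol_le.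
  move: ec0 cr0; move: (energy_cst eps 4 (2 * 48 ^+ 2)) (4 * 64 ^+ 2 * d%:R * _ + _) => c c' c0 c'0.
  apply: (@le_trans _ _ (c * K ^+ 2 * (16 * (h + b)))).
    apply: ler_wpM2l; first exact: mulr_ge0.
    lra.
  have -> : c * K ^+ 2 * (16 * (h + b)) = 16 * c * K ^+ 2 * (h + b) by ring.
  rewrite ler_wpM2r ?addr_ge0// ler_wpM2r// lerDl.
  by rewrite mulr_ge0.
rewrite lerBlDr; apply: le_trans (expect_generator_le eps0 u_eps i1 g01' (ltW K0) fge0 f1) _.
have D0 : 0 <= N%:R ^+ 2 * (\sum_(x : torus d N) \sum_(j < d)
    dirichlet_bond u f x (x + unitv N j)).
  rewrite mulr_ge0 ?sqr_ge0//; do 2!(apply: sumr_ge0 => ? _).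
  exact: (dirichlet_bond_ge0 eps0 u_eps).
rewrite -[leLHS]addr0; apply: lerD => //.
have N64R : N%:R ^+ 2 <= 64 ^+ 2 :> R.
  by rewrite lerXn2r ?nnegrE// ler_nat ltnW.
rewrite card_torus// natrX.
have NB : N%:R ^+ d <= 16 * 64 ^+ 2 * (N%:R / l) ^+ d.
  rewrite NlE mulrA ler_pdivlMr// [leRHS]mulrC; apply: ler_wpM2l => //.
  lra.
have rate_le : N%:R ^+ 2 * (d%:R * eps^-1 ^+ 2) + K * (4 * eps^-1) <=
    (4 * 64 ^+ 2 * d%:R * eps^-1 ^+ 2 + 8 * eps^-1) * K ^+ 2.
  have e2 : 0 <= d%:R * eps^-1 ^+ 2 by rewrite mulr_ge0 ?sqr_ge0.
  have e1 : 0 <= eps^-1 by rewrite invr_ge0 ltW.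
  have k1 : 1 <= 4 * K ^+ 2 by nra.
  have k2 : K <= 2 * K ^+ 2 by nra.
  have a1 : N%:R ^+ 2 * (d%:R * eps^-1 ^+ 2) <= 64 ^+ 2 * (4 * K ^+ 2) * (d%:R * eps^-1 ^+ 2).
    by apply: ler_wpM2r => //; lra.
  have a2 : K * (4 * eps^-1) <= 2 * K ^+ 2 * (4 * eps^-1).
    by apply: ler_wpM2r => //; lra.
  lra.
rewrite /growth_cst -/eps.
move: H0 B0 NB; move: (entropy _ f) ((N%:R / l) ^+ d) => h b h0 b0 NB.
move: cr0 rate_le; set r := N%:R ^+ 2 * _ + _; set c' := _ + 8 * _ => c'0 rate_le.
apply: (@le_trans _ _ (16 * 64 ^+ 2 * b * (c' * K ^+ 2))).
  apply: ler_pM => //.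
  rewrite addr_ge0// mulr_ge0 ?sqr_ge0 ?(ltW K0)// mulr_ge0 ?sqr_ge0//.
  by rewrite invr_ge0 ltW.
have -> : 16 * 64 ^+ 2 * b * (c' * K ^+ 2) = 16 * 64 ^+ 2 * c' * K ^+ 2 * b by ring.
apply: ler_pM => //; last by lra.
- by apply: mulr_ge0 => //; lra.
- by apply: ler_wpM2r => //; lra.
Qed.

End Assembly.

Theorem corollary2p3 (R : realType) (d : nat) (hd : (0 < d)%N)
    (gamma : R) (hgamma : 1 / 2 < gamma < 1)
    (ell : nat -> R) (hell : forall N, (1 <= N)%N -> block_size d N (ell N)) :
  exists c0 : forall N : nat, (torus d N -> R) -> R,
  forall (K : nat -> R) (rho : nat -> R -> R),
    (forall N, (1 <= N)%N -> 0 < K N) ->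
    (forall M N, (1 <= M <= N)%N -> K M <= K N) ->
    K N @[N --> \oo] --> +oo ->
    K N / N%:R @[N --> \oo] --> 0 ->
    (exists A : R, forall N, (1 <= N)%N -> K N ^+ 2 / ell N ^+ d <= A) ->
    (forall N, (1 <= N)%N -> stationary_interface gamma (K N) (rho N)) ->
    let i1 : 'I_d := Ordinal hd in
    let u N : torus d N -> R := interface_profile i1 (K N) (rho N) in
    let nu N : config d N -> R := product_measure (u N) in
    let f N (t : R) : config d N -> R :=
      density (generator i1 gamma (K N)) (nu N) t in
    (exists C : R, forall N, (1 <= N)%N -> `|c0 N (u N)| <= C) /\
    (forall N, (1 <= N)%N -> forall t : R, 0 <= t ->
       entropy (nu N) (f N t)
         <= (N%:R / ell N) ^+ d * expR (c0 N (u N) * K N ^+ 2 * t)).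
Proof.
exists (fun _ _ => growth_cst d gamma) => K rho K0 _ _ _ _ rhoP i1 u nu f; split.
  by exists `|growth_cst d gamma|.
move=> N N0 t t0; have KN := K0 N N0; have rN := rhoP N N0.
have g01 : 0 <= gamma <= 1 by case/andP: hgamma => ? ?; apply/andP; split; lra.
have eps0 := interface_gap_gt0 hgamma.
have u_eps x : interface_gap gamma <= u N x <= 1 - interface_gap gamma.
  exact: (profile_gap hgamma KN rN).
have [l0 _] := small_block_size hd N0 (hell N N0).
have B0 : 0 <= (N%:R / ell N) ^+ d by rewrite exprn_ge0// divr_ge0// ltW.
apply: (entropy_gronwall (linear_op_generator i1 gamma (K N))) => //.
- by move=> zeta eta; apply: generator_offdiag => //; exact: ltW.
- exact: generator_cst.
- exact: product_measure_gt0 eps0 u_eps.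
- exact: sum_product_measure.
- by move=> g g0 g1; exact: (entropy_rate hgamma KN rN N0 (hell N N0) g0 g1).
Qed.
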